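(* Let $G$ be a finite group acting smoothly on a (finite-dimensional) smooth manifold $M$, and let $k$ be an integer. If all the isotropy subgroups $G_x=\{g\in G \mid gx=x\}$, $x\in M$, are elementary abelian groups of rank $\leq k$, then $G$ acts freely and smoothly on $M\times \mathbb{S}^{n_1}\times\dots\times\mathbb{S}^{n_k}$ for some positive integers $n_1,\dots,n_k$.
   Context: An elementary abelian group of rank $r$ is a group isomorphic to $(\mathbb{Z}/p)^r$ for some prime $p$. Spheres carry their standard smooth structure and products carry the product smooth structure. *)

(* Defs.v *)
From HB Require Import structures.
From mathcomp Require Import all_boot all_order all_algebra all_fingroup.
From mathcomp Require Import all_classical all_reals all_analysis.
From mathcomp Require Import ring lra.

Set Implicit Arguments.
Unset Strict Implicit.
Unset Printing Implicit Defensive.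

Import Order.TTheory GRing.Theory Num.Theory.
Import numFieldNormedType.Exports.

Local Open Scope classical_set_scope.
Local Open Scope ring_scope.

(* [f] is only examined on the open set [U]: its partial derivatives up to
   order [k] all exist and are continuous at every point of [U].
   The norm of ['rV[R]_n] is the sup norm; it induces the usual topology. *)
Fixpoint Ck_on {R : realType} {n : nat} {W : normedModType R} (k : nat)
    (U : set 'rV[R]_n) (f : 'rV[R]_n -> W) : Prop :=
  (forall x, U x -> {for x, continuous f}) /\
  (if k is k'.+1 then
     forall i : 'I_n, (forall x, U x -> derivable f x (delta_mx 0 i)) /\
                      Ck_on k' U ('D_(delta_mx 0 i) f)
   else True).

Definition smooth_on {R : realType} {n : nat} {W : normedModType R}
    (U : set 'rV[R]_n) (f : 'rV[R]_n -> W) : Prop :=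
  forall k : nat, Ck_on k U f.

(* [chart_map] and [chart_inv] are total functions, only meaningful on
   [chart_dom] and [chart_img] respectively. *)
Record chart (R : realType) (T : topologicalType) (m : nat) := Chart {
  chart_dom : set T;
  chart_img : set 'rV[R]_m;
  chart_map : T -> 'rV[R]_m;
  chart_inv : 'rV[R]_m -> T }.

Definition is_chart {R : realType} {T : topologicalType} {m : nat}
    (c : chart R T m) : Prop :=
  [/\ open (chart_dom c) /\ open (chart_img c),
      (forall x, chart_dom c x -> chart_img c (chart_map c x)) /\
      (forall y, chart_img c y -> chart_dom c (chart_inv c y)),
      (forall x, chart_dom c x -> chart_inv c (chart_map c x) = x) /\
      (forall y, chart_img c y -> chart_map c (chart_inv c y) = y) &
      (forall x, chart_dom c x -> {for x, continuous (chart_map c)}) /\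
      (forall y, chart_img c y -> {for y, continuous (chart_inv c)})].

Definition smooth_atlas {R : realType} {T : topologicalType} {m : nat}
    (A : set (chart R T m)) : Prop :=
  [/\ forall c, A c -> is_chart c,
      forall x, exists2 c, A c & chart_dom c x &
      forall a b, A a -> A b ->
        smooth_on (chart_map a @` (chart_dom a `&` chart_dom b))
                  (chart_map b \o chart_inv a)].

(* The smooth structure is the one generated by the atlas, which need not be
   maximal.  A manifold is of pure dimension [dim] and has no boundary; it may
   be empty, disconnected or noncompact. *)
Record manifold (R : realType) := Manifold {
  carrier :> topologicalType;
  dim : nat;
  atlas : set (chart R carrier dim);
  manifold_hausdorff : hausdorff_space carrier;
  manifold_second_countable : @second_countable carrier;
  manifold_atlas : smooth_atlas atlas }.

Arguments dim {R} m : rename.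
Arguments atlas {R} m _ : rename.

Definition smooth {R : realType} {M N : manifold R} (f : M -> N) : Prop :=
  continuous f /\
  forall a b, atlas M a -> atlas N b ->
    smooth_on (chart_map a @` (chart_dom a `&` f @^-1` chart_dom b))
              (chart_map b \o f \o chart_inv a).

Section Ck_theory.
Context {R : realType} {n : nat}.
Implicit Types (U V : set 'rV[R]_n) (k : nat).

Lemma Ck_cts {W : normedModType R} k U (f : 'rV[R]_n -> W) x :
  Ck_on k U f -> U x -> {for x, continuous f}.
Proof. by case: k => [|k] [+ _]; apply. Qed.

Lemma CkW {W : normedModType R} k U (f : 'rV[R]_n -> W) :
  Ck_on k.+1 U f -> Ck_on k U f.
Proof.
elim: k f => [|k IH] f [fc fd]; first by split.
split=> // i; have [fdi fki] := fd i; split=> //; exact: IH.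
Qed.

Lemma Ck_ext {W : normedModType R} k U (f g : 'rV[R]_n -> W) :
  open U -> (forall x, U x -> f x = g x) -> Ck_on k U f -> Ck_on k U g.
Proof.
move=> oU; have near_fg (f' g' : 'rV[R]_n -> W) x : (forall x, U x -> f' x = g' x) -> U x ->
    \forall y \near x, f' y = g' y.
  by move=> fg Ux; near=> y; apply: fg; near: y; exact: open_nbhs_nbhs.
have cfg (f' g' : 'rV[R]_n -> W) x : (forall x, U x -> f' x = g' x) -> U x ->
    {for x, continuous f'} -> {for x, continuous g'}.
  move=> fg Ux fc; suff : g' @ x --> f' x by rewrite fg.
  apply: cvg_trans fc; apply: (@near_eq_cvg _ _ (nbhs x)); exact: (near_fg f' g' x fg Ux).
elim: k f g => [|k IH] f g fg [fc fd].
  by split=> // x Ux; apply: (cfg f) => //; exact: fc.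
split=> [x Ux|i]; first by apply: (cfg f) => //; exact: fc.
have [fdi fki] := fd i; split=> [x Ux|].
  by apply: near_eq_derivable (fdi x Ux); exact: (near_fg f g x fg Ux).
by apply: IH fki => x Ux; apply: near_eq_derive; exact: (near_fg f g x fg Ux).
Unshelve. all: by end_near. Qed.

Lemma Ck_eq {W : normedModType R} k U (f g : 'rV[R]_n -> W) :
  f =1 g -> Ck_on k U f -> Ck_on k U g.
Proof. by move=> /funext ->. Qed.

Lemma Ck_cst {W : normedModType R} k U (c : W) :
  Ck_on k U (fun _ : 'rV[R]_n => c).
Proof.
have cc (w : W) : continuous (fun _ : 'rV[R]_n => w) by apply: cst_continuous.
elim: k c => [|k IH] c; first by split=> // x _; exact: cc.
split=> [x _|i]; first exact: cc.
split=> [x _|]; first exact: derivable_cst.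
rewrite (_ : 'D__ _ = (fun=> 0)); first exact: IH.
by apply/funext => x; exact: derive_cst.
Qed.

Lemma Ck_mx k U p q (f : 'rV[R]_n -> 'M[R]_(p, q)) : open U ->
  (forall i j, Ck_on k U (fun x => f x i j : R^o)) -> Ck_on k U f.
Proof.
move=> oU; elim: k f => [|k IH] f fij.
  split=> // x Ux; apply/(@cvgrPdist_le _ _ _ (nbhs x)) => /= e e0; near=> y.
  rewrite /Num.Def.normr/= mx_normrE (bigmax_le _ (ltW e0))//= => -[i j] _.
  rewrite !mxE/=; move: i j; near: y; apply: filter_forall => /= i.
  apply: filter_forall => j.
  have := Ck_cts (fij i j) Ux; rewrite /continuous_at.
  by move=> /(@cvgrPdist_le _ _ _ (nbhs x))/(_ e e0).
have fd i x : U x -> derivable f x (delta_mx 0 i).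
  move=> Ux; apply/derivable_mxP => a b; have [_ /(_ i)[+ _]] := fij a b.
  exact.
split=> [x Ux|i].
  have : Ck_on k U f by apply: IH => i j; apply: CkW.
  by move/Ck_cts; apply.
split=> [x Ux|]; first exact: fd.
apply: IH => a b; have [_ /(_ i)[_]] := fij a b.
by apply: Ck_ext => // x Ux; rewrite derive_mx ?mxE//; exact: fd.
Unshelve. all: by end_near. Qed.

Lemma Ck_mxE k U p q (f : 'rV[R]_n -> 'M[R]_(p, q)) i j : open U ->
  Ck_on k U f -> Ck_on k U (fun x => f x i j : R^o).
Proof.
move=> oU; elim: k f => [|k IH] f [fc fd].
  split=> // x Ux.
  by apply: (@continuous_comp _ _ _ f (fun M => M i j));
    [exact: fc|exact: coord_continuous].
split=> [x Ux|a].
  by apply: (@continuous_comp _ _ _ f (fun M => M i j));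
    [exact: fc|exact: coord_continuous].
have [fda fka] := fd a; split=> [x Ux|].
  by have /derivable_mxP := fda x Ux; apply.
by have := IH _ fka; apply: Ck_ext => // x Ux; rewrite derive_mx ?mxE//; exact: fda.
Qed.

Lemma Ck_coord k U i : Ck_on k U (fun x => x 0 i : R^o).
Proof.
case: k => [|k]; first by split=> // x _; exact: coord_continuous.
split=> [x _|j]; first exact: coord_continuous.
have d x : derivable (fun x : 'rV[R]_n => x 0 i : R^o) x (delta_mx 0 j).
  by have /derivable_mxP/(_ 0 i) := @derivable_id R _ x (delta_mx 0 j).
split=> [x _|]; first exact: d.
apply: (Ck_eq _ (Ck_cst k U ((delta_mx 0 j : 'rV[R]_n) 0 i : R^o))).
move=> x; have := @derive_mx R _ _ _ id x (delta_mx 0 j) (@derivable_id _ _ _ _).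
by rewrite derive_id => /matrixP/(_ 0 i); rewrite [RHS]mxE => ->.
Qed.

Lemma CkD k U (f g : 'rV[R]_n -> R^o) : open U ->
  Ck_on k U f -> Ck_on k U g -> Ck_on k U (fun x => f x + g x).
Proof.
move=> oU; elim: k f g => [|k IH] f g [fc fd] [gc gd].
  by split=> // x Ux; exact: (continuousD (fc x Ux) (gc x Ux)).
split=> [x Ux|i]; first by exact: (continuousD (fc x Ux) (gc x Ux)).
have [fdi fki] := fd i; have [gdi gki] := gd i.
split=> [x Ux|]; first by apply: derivableD; [exact: fdi|exact: gdi].
apply: Ck_ext (IH _ _ fki gki) => // x Ux.
by rewrite deriveD//; [exact: fdi|exact: gdi].
Qed.

Lemma CkM k U (f g : 'rV[R]_n -> R^o) : open U ->
  Ck_on k U f -> Ck_on k U g -> Ck_on k U (fun x => f x * g x : R^o).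
Proof.
move=> oU; elim: k f g => [|k IH] f g fk gk; have [fc fd] := fk; have [gc gd] := gk.
  by split=> // x Ux; exact: (continuousM (fc x Ux) (gc x Ux)).
split=> [x Ux|i]; first by exact: (continuousM (fc x Ux) (gc x Ux)).
have [fdi fki] := fd i; have [gdi gki] := gd i.
split=> [x Ux|]; first by apply: derivableM; [exact: fdi|exact: gdi].
apply: Ck_ext (CkD oU (IH _ _ (CkW fk) gki) (IH _ _ (CkW gk) fki)) => // x Ux.
by rewrite (@deriveM _ _ f g)//; [exact: fdi|exact: gdi].
Qed.

Lemma CkV k U (f : 'rV[R]_n -> R^o) : open U -> (forall x, U x -> f x != 0) ->
  Ck_on k U f -> Ck_on k U (fun x => (f x)^-1 : R^o).
Proof.
move=> oU f0; elim: k => [|k IH] fk; have [fc fd] := fk.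
  by split=> // x Ux; exact: (continuousV (f0 x Ux) (fc x Ux)).
split=> [x Ux|i]; first by exact: (continuousV (f0 x Ux) (fc x Ux)).
have [fdi fki] := fd i.
split=> [x Ux|]; first by apply: derivableV; [exact: f0|exact: fdi].
have kV := IH (CkW fk).
apply: Ck_ext (CkM oU (CkM oU (CkM oU (Ck_cst k U (-1 : R^o)) kV) kV) fki) => // x Ux.
rewrite deriveV; [|exact: f0|exact: fdi].
by rewrite !mulN1r !mulNr scaleNr -invrM ?unitfE ?f0// -expr2.
Qed.

Lemma Ck_sum k U (I : Type) (s : seq I) (f : I -> 'rV[R]_n -> R^o) : open U ->
  (forall i, Ck_on k U (f i)) -> Ck_on k U (fun x => \sum_(i <- s) f i x : R^o).
Proof.
move=> oU fk; elim: s => [|a s IH].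
  apply: Ck_ext (Ck_cst k U (0 : R^o)) => // x _; by rewrite big_nil.
by apply: Ck_ext (CkD oU (fk a) IH) => // x _; rewrite big_cons.
Qed.

End Ck_theory.

Lemma Ck_comp_linear {R : realType} {n p : nat} {W : normedModType R} k
    (L : {linear 'rV[R]_p -> 'rV[R]_n}) U (f : 'rV[R]_n -> W) :
  continuous L ->
  (forall i, L (delta_mx 0 i) = 0 \/ exists j, L (delta_mx 0 i) = delta_mx 0 j) ->
  Ck_on k U f -> Ck_on k (L @^-1` U) (f \o L).
Proof.
move=> Lc Ld.
have LD (g : 'rV[R]_n -> W) v z : (derivable g (L z) (L v) -> derivable (g \o L) z v) /\
   'D_v (g \o L) z = 'D_(L v) g (L z).
  have E : (fun h : R => h^-1 *: ((g \o L \o shift z) (h *: v) - (g \o L) z))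
   = (fun h => h^-1 *: ((g \o shift (L z)) (h *: L v) - g (L z))).
    by apply/funext => h /=; have -> : L (h *: v + z) = h *: L v + L z by rewrite linearP.
  by rewrite /derivable /derive E; split.
elim: k f => [|k IH] f [fc fd].
  by split=> // x Ux; apply: continuous_comp; [exact: Lc|exact: fc].
split=> [x Ux|i]; first by apply: continuous_comp; [exact: Lc|exact: fc].
have [L0|[j Lj]] := Ld i.
  split=> [x Ux|]; first by apply: (LD _ _ _).1; rewrite L0; exact: derivable0.
  rewrite (_ : 'D__ _ = (fun=> 0)); first exact: Ck_cst.
  by apply/funext => x; rewrite (LD _ _ _).2 L0 derive0.
have [fdj fkj] := fd j; split=> [x Ux|].
  by apply: (LD _ _ _).1; rewrite Lj; exact: fdj.
rewrite (_ : 'D__ _ = 'D_(delta_mx 0 j) f \o L); first exact: IH.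
by apply/funext => x; rewrite (LD _ _ _).2 Lj.
Qed.

Section topology_facts.

Lemma cluster_map (S T : topologicalType) (f : S -> T) (p q : S) :
  {for p, continuous f} -> {for q, continuous f} ->
  cluster (nbhs p) q -> cluster (nbhs (f p)) (f q).
Proof.
move=> fp fq pq A B Afp Bfq; have [x [Ax Bx]] := pq _ _ (fp _ Afp) (fq _ Bfq).
by exists (f x).
Qed.

Lemma prod_hausdorff (S T : topologicalType) :
  hausdorff_space S -> hausdorff_space T -> hausdorff_space (S * T)%type.
Proof.
move=> hS hT [p1 p2] [q1 q2] pq.
have c1 : continuous (fst : S * T -> S) by move=> x; exact: cvg_fst.
have c2 : continuous (snd : S * T -> T) by move=> x; exact: cvg_snd.
by congr pair; [apply: hS; exact: cluster_map (c1 _) (c1 _) pq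
               |apply: hT; exact: cluster_map (c2 _) (c2 _) pq].
Qed.

Lemma prod_second_countable (S T : topologicalType) :
  @second_countable S -> @second_countable T -> @second_countable (S * T)%type.
Proof.
move=> [B cB [oB bB]] [C cC [oC bC]].
exists ((fun P : set S * set T => P.1 `*` P.2) @` (B `*` C)).
  by apply: (sub_countable (card_image_le _ _)); exact: countableX.
split=> [_ [[P Q] [/= BP CQ] <-]|[x y] V [[P Q]] /= [Px Qy] PQV].
  rewrite openE => -[x y] /= [Px Qy]; exists (P, Q) => //; split; apply: open_nbhs_nbhs.
    by split=> //; exact: oB.
  by split=> //; exact: oC.
have [P' [BP' P'x] P'P] := bB x _ Px; have [Q' [CQ' Q'y] Q'Q] := bC y _ Qy.
exists (P' `*` Q'); first by split=> //; exists (P', Q').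
by move=> [a b] [/= /P'P ? /Q'Q ?]; exact: PQV.
Qed.

Lemma subtype_hausdorff (T : topologicalType) (A : set T) :
  hausdorff_space T -> hausdorff_space (set_type A).
Proof.
move=> hT p q pq; apply: val_inj; apply: hT.
have c : continuous (set_val : set_type A -> T) by exact: initial_continuous.
exact: cluster_map (c _) (c _) pq.
Qed.

Lemma subtype_second_countable (T : topologicalType) (A : set T) :
  @second_countable T -> @second_countable (set_type A).
Proof.
move=> [B cB [oB bB]]; exists ((fun P => set_val @^-1` P : set (set_type A)) @` B).
  exact: (sub_countable (card_image_le _ _)).
split=> [_ [P BP <-]|x V]; first by exists P => //; exact: oB.
rewrite nbhsE => -[_ [[P oP <-] Px] PV].
have [Q [BQ Qx] QP] := bB (set_val x) P (open_nbhs_nbhs (conj oP Px)).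
exists (set_val @^-1` Q); first by split=> //; exists Q.
by move=> y /= /QP /PV.
Qed.

Lemma subtype_continuous (S T : topologicalType) (A : set T)
    (f : S -> set_type A) x :
  {for x, continuous (set_val \o f)} -> {for x, continuous f}.
Proof.
move=> fc V; rewrite nbhsE => -[_ [[P oP <-] Px] PV].
have := fc P (open_nbhs_nbhs (conj oP Px)).
by apply: (@filterS _ (nbhs x)) => y /= Py; exact: PV.
Qed.

Lemma rV_second_countable (R : realType) n : @second_countable 'rV[R]_n.
Proof.
pose box (qk : 'rV[rat]_n * nat) : set 'rV[R]_n :=
  ball (map_mx ratr qk.1 : 'rV[R]_n) (qk.2.+1%:R^-1).
exists (range box).
  by apply: (sub_countable (card_image_le _ _)); exact: countableP.
split=> [_ [qk _ <-]|x V /nbhs_ballP[e /= e0 eV]]; first exact: ball_open.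
have [k _ ke] : exists2 k, True & k.+1%:R^-1 < e / 2.
  have [//|k] := @ltr_add_invr R 0 (e / 2) _; first by rewrite divr_gt0.
  by rewrite add0r; exists k.
have k0 : 0 < k.+1%:R^-1 :> R by rewrite invr_gt0.
have qP j : {q : rat | ratr q \in `]x 0 j - k.+1%:R^-1, x 0 j + k.+1%:R^-1[ }.
  apply: cid; apply: rat_in_itvoo.
  by rewrite ltrD2l (lt_trans _ k0)// oppr_lt0.
pose q : 'rV[rat]_n := \row_j sval (qP j).
have xq : ball (map_mx ratr q : 'rV[R]_n) k.+1%:R^-1 x.
  split => // i j; rewrite !mxE ord1 /ball/= distrC.
  have := svalP (qP j); rewrite in_itv/= => /andP[l r].
  by rewrite ltr_distlC l r.
exists (box (q, k)); first by split=> //; exists (q, k).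
move=> y yq; apply: eV; rewrite (splitr e).
apply: (ball_triangle (y := map_mx ratr q : 'rV[R]_n)).
  by apply: le_ball (ball_sym xq); exact: ltW.
by apply: le_ball yq; exact: ltW.
Qed.

End topology_facts.

Lemma Ck_sub {R : realType} {n : nat} {W : normedModType R} k (U V : set 'rV[R]_n)
    (f : 'rV[R]_n -> W) : V `<=` U -> Ck_on k U f -> Ck_on k V f.
Proof.
move=> VU; elim: k f => [|k IH] f [fc fd]; first by split=> // x /VU; exact: fc.
split=> [x /VU|i]; first exact: fc.
by have [fdi fki] := fd i; split=> [x /VU|]; [exact: fdi|exact: IH].
Qed.

Section sub_row.
Context {R : realType} {m n : nat}.

Lemma Ck_lsubmx {W : normedModType R} k U (f : 'rV[R]_m -> W) :
  Ck_on k U f -> Ck_on k (lsubmx @^-1` U) (fun z : 'rV[R]_(m + n) => f (lsubmx z)).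
Proof.
apply: (@Ck_comp_linear _ _ _ _ _ (lsubmx : {linear 'rV[R]_(m + n) -> 'rV[R]_m})).
  exact: continuous_lsubmx.
move=> i; case: (split_ordP i) => j ->; [right; exists j|left];
  apply/rowP => l; rewrite !mxE.
  by rewrite eq_lshift.
by rewrite eq_lrshift.
Qed.

Lemma Ck_rsubmx {W : normedModType R} k U (f : 'rV[R]_n -> W) :
  Ck_on k U f -> Ck_on k (rsubmx @^-1` U) (fun z : 'rV[R]_(m + n) => f (rsubmx z)).
Proof.
apply: (@Ck_comp_linear _ _ _ _ _ (rsubmx : {linear 'rV[R]_(m + n) -> 'rV[R]_n})).
  exact: continuous_rsubmx.
move=> i; case: (split_ordP i) => j ->; [left|right; exists j];
  apply/rowP => l; rewrite !mxE.
  by rewrite eq_rlshift.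
by rewrite eq_rshift.
Qed.

Lemma Ck_row_mx {p : nat} k (U : set 'rV[R]_p) (f : 'rV[R]_p -> 'rV[R]_m)
    (g : 'rV[R]_p -> 'rV[R]_n) :
  open U -> Ck_on k U f -> Ck_on k U g -> Ck_on k U (fun z => row_mx (f z) (g z)).
Proof.
move=> oU fk gk; apply: Ck_mx => // i j; case: (split_ordP j) => l ->.
  by apply: Ck_eq (Ck_mxE i l oU fk) => z; rewrite row_mxEl.
by apply: Ck_eq (Ck_mxE i l oU gk) => z; rewrite row_mxEr.
Qed.

End sub_row.

Lemma open_chart_map {R : realType} {T : topologicalType} {m : nat}
    (c : chart R T m) (V : set T) :
  is_chart c -> open V -> open (chart_map c @` (chart_dom c `&` V)).
Proof.
move=> [[od oi] [di id] [ci ic] [cc cic]] oV.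
rewrite openE => _ [x [dx Vx] <-].
have ix := di _ dx.
have Vn : nbhs (chart_inv c (chart_map c x)) V by apply: open_nbhs_nbhs; rewrite ci.
have := cic _ ix _ Vn => /= Vn'.
have in' : nbhs (chart_map c x) (chart_img c) by exact: open_nbhs_nbhs.
apply: filterS (filterI in' Vn') => y [iy Vy].
by exists (chart_inv c y); [split=> //; exact: id|exact: ic].
Qed.

Section product.
Context {R : realType}.

Definition prod_chart {S T : topologicalType} {m n : nat}
    (a : chart R S m) (b : chart R T n) : chart R (S * T)%type (m + n) :=
  {| chart_dom := chart_dom a `*` chart_dom b;
     chart_img := [set z | chart_img a (lsubmx z) /\ chart_img b (rsubmx z)];
     chart_map := fun x => row_mx (chart_map a x.1) (chart_map b x.2);
     chart_inv := fun z => (chart_inv a (lsubmx z), chart_inv b (rsubmx z)) |}.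

Definition prod_atlas {S T : topologicalType} {m n : nat}
    (A : set (chart R S m)) (B : set (chart R T n)) :
    set (chart R (S * T)%type (m + n)) :=
  [set prod_chart a b | a in A & b in B].

Lemma prod_is_chart {S T : topologicalType} {m n : nat}
    (a : chart R S m) (b : chart R T n) :
  is_chart a -> is_chart b -> is_chart (prod_chart a b).
Proof.
move=> [[oda oia] [dia ida] [cia ica] [cca cica]].
move=> [[odb oib] [dib idb] [cib icb] [ccb cicb]].
split.
- split.
    rewrite openE => -[x y] /= [dx dy]; exists (chart_dom a, chart_dom b) => //.
    by split; exact: open_nbhs_nbhs.
  apply: (@openI _ (lsubmx @^-1` chart_img a) (rsubmx @^-1` chart_img b)).
    by apply: open_comp => // x _; exact: continuous_lsubmx.
  by apply: open_comp => // x _; exact: continuous_rsubmx.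
- split=> [[x y]|z] /= [dx dy]; split.
  + by rewrite row_mxKl; exact: dia.
  + by rewrite row_mxKr; exact: dib.
  + exact: ida.
  + exact: idb.
- split=> [[x y]|z] /= [dx dy]; first by rewrite row_mxKl row_mxKr cia ?cib.
  by rewrite ica ?icb// hsubmxK.
- split=> [[x y]|z] /= [dx dy].
    apply/(@cvgrPdist_le _ _ _ (nbhs (x, y))) => /= e e0.
    have {}ca := cca _ dx; have {}cb := ccb _ dy.
    have : nbhs (x, y) ([set u | `|chart_map a x - chart_map a u| <= e] `*`
                        [set v | `|chart_map b y - chart_map b v| <= e]).
      exists ([set u | `|chart_map a x - chart_map a u| <= e],
              [set v | `|chart_map b y - chart_map b v| <= e]) => //; split=> /=.
        by have /(@cvgrPdist_le _ _ _ (nbhs x))/(_ e e0) := ca.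
      by have /(@cvgrPdist_le _ _ _ (nbhs y))/(_ e e0) := cb.
    apply: (@filterS _ (nbhs (x, y))) => -[u v] [/= ue ve].
    rewrite /Num.Def.normr/= mx_normrE (bigmax_le _ (ltW e0))//= => -[i j] _.
    rewrite opp_row_mx add_row_mx; case: (split_ordP j) => l ->.
      rewrite row_mxEl; apply: le_trans ue.
      rewrite [leRHS]/Num.Def.normr/= mx_normrE.
      exact: (le_bigmax _ (fun k => `|(chart_map a x - chart_map a u) k.1 k.2|) (i, l)).
    rewrite row_mxEr; apply: le_trans ve.
    rewrite [leRHS]/Num.Def.normr/= mx_normrE.
    exact: (le_bigmax _ (fun k => `|(chart_map b y - chart_map b v) k.1 k.2|) (i, l)).
  have c1 : {for z, continuous (chart_inv a \o lsubmx)}.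
    by apply: continuous_comp; [exact: continuous_lsubmx|exact: cica].
  have c2 : {for z, continuous (chart_inv b \o rsubmx)}.
    by apply: continuous_comp; [exact: continuous_rsubmx|exact: cicb].
  exact: cvg_pair c1 c2.
Qed.

Lemma prod_smooth_atlas {S T : topologicalType} {m n : nat}
    (A : set (chart R S m)) (B : set (chart R T n)) :
  smooth_atlas A -> smooth_atlas B -> smooth_atlas (prod_atlas A B).
Proof.
move=> [cA covA compA] [cB covB compB]; split.
- by move=> _ [a Aa [b Bb <-]]; apply: prod_is_chart; [exact: cA|exact: cB].
- move=> [x y]; have [a Aa ax] := covA x; have [b Bb yb] := covB y.
  by exists (prod_chart a b) => //; exists a => //; exists b.
- move=> _ _ [a Aa [b Bb <-]] [a' Aa' [b' Bb' <-]] k.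
  have [[oda' _] _ _ _] := cA _ Aa'; have [[odb' _] _ _ _] := cB _ Bb'.
  have oa := open_chart_map (cA _ Aa) oda'.
  have ob := open_chart_map (cB _ Bb) odb'.
  have fk := @Ck_lsubmx R m n _ _ _ _ (compA a a' Aa Aa' k).
  have gk := @Ck_rsubmx R m n _ _ _ _ (compB b b' Bb Bb' k).
  have c := prod_is_chart (cA _ Aa) (cB _ Bb).
  have [[odab _] _ _ _] := prod_is_chart (cA _ Aa') (cB _ Bb').
  apply: (Ck_row_mx (open_chart_map c odab)).
    apply: Ck_sub fk => _ [[x y] [/= [ax bx] [ay by_]] <-] /=.
    by rewrite row_mxKl; exists x.
  apply: Ck_sub gk => _ [[x y] [/= [ax bx] [ay by_]] <-] /=.
  by rewrite row_mxKr; exists y.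
Qed.

Definition prod_manifold (M N : manifold R) : manifold R :=
  Manifold (prod_hausdorff (@manifold_hausdorff _ M) (@manifold_hausdorff _ N))
           (prod_second_countable (@manifold_second_countable _ M)
                                  (@manifold_second_countable _ N))
           (prod_smooth_atlas (manifold_atlas M) (manifold_atlas N)).

End product.

Section sphere.
Context {R : realType} {n : nat}.

(* The sup norm of the library would give a cube: the Euclidean norm is needed. *)
Definition sqnorm {m : nat} (x : 'rV[R]_m) : R := \sum_(i < m) x 0 i ^+ 2.

(* The ambient dimension is [n + 1] rather than [n.+1] so that the first [n]
   coordinates of [x] are [lsubmx x].  As a type, [unit_sphere] carries the
   topology induced from ['rV[R]_(n + 1)]. *)
Definition unit_sphere : set 'rV[R]_(n + 1) := [set x | sqnorm x = 1].

Definition last_coord (x : 'rV[R]_(n + 1)) : R := x 0 (rshift n ord0).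

(* Stereographic projection from the pole [(0, ..., 0, (-1) ^+ s)], and its
   inverse [stereo_vec s]. *)
Definition stereo_map (s : bool) (x : unit_sphere) : 'rV[R]_n :=
  (1 - (-1) ^+ s * last_coord (set_val x))^-1 *: lsubmx (set_val x).

Definition stereo_vec (s : bool) (y : 'rV[R]_n) : 'rV[R]_(n + 1) :=
  (sqnorm y + 1)^-1 *: row_mx (2%:R *: y) (const_mx ((-1) ^+ s * (sqnorm y - 1))).

Lemma sqnorm_ge0 m (x : 'rV[R]_m) : 0 <= sqnorm x.
Proof. by apply: sumr_ge0 => i _; exact: sqr_ge0. Qed.

Lemma sqnormZ m a (x : 'rV[R]_m) : sqnorm (a *: x) = a ^+ 2 * sqnorm x.
Proof. by rewrite /sqnorm mulr_sumr; apply: eq_bigr => i _; rewrite mxE exprMn. Qed.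

Lemma sqnormS (x : 'rV[R]_(n + 1)) :
  sqnorm x = sqnorm (lsubmx x) + last_coord x ^+ 2.
Proof.
rewrite /sqnorm big_split_ord big_ord1; congr (_ + _).
by apply: eq_bigr => i _; rewrite mxE.
Qed.

Lemma sqnorm1_neq0 m (y : 'rV[R]_m) : sqnorm y + 1 != 0.
Proof. by rewrite gt_eqF// ltr_wpDl// sqnorm_ge0. Qed.

Lemma lsub_stereo_vec s y : lsubmx (stereo_vec s y) = (2 / (sqnorm y + 1)) *: y.
Proof.
by apply/rowP => i; rewrite !mxE (unsplitK (inl i)) !mxE mulrA [_ * 2]mulrC.
Qed.

Lemma last_stereo_vec s y :
  last_coord (stereo_vec s y) = (-1) ^+ s * ((sqnorm y - 1) / (sqnorm y + 1)).
Proof.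
by rewrite /last_coord !mxE (unsplitK (inr _)) mxE mulrC mulrA.
Qed.

Lemma stereo_vec_sphere s y : stereo_vec s y \in unit_sphere.
Proof.
apply/mem_set; rewrite /unit_sphere/= sqnormS lsub_stereo_vec sqnormZ last_stereo_vec.
rewrite [((-1) ^+ s * _) ^+ 2]exprMn sqrr_sign mul1r; move: (sqnorm1_neq0 y) => y0.
by field.
Qed.

Definition stereo_inv (s : bool) (y : 'rV[R]_n) : unit_sphere :=
  SigSub (stereo_vec_sphere s y).

Definition stereo (s : bool) : chart R unit_sphere n :=
  {| chart_dom := [set x : unit_sphere | last_coord (set_val x) != (-1) ^+ s];
     chart_img := setT;
     chart_map := stereo_map s;
     chart_inv := stereo_inv s |}.

Definition sphere_atlas : set (chart R unit_sphere n) := range stereo.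

Lemma stereo_den s (x : unit_sphere) : last_coord (set_val x) != (-1) ^+ s ->
  1 - (-1) ^+ s * last_coord (set_val x) != 0.
Proof.
apply: contra_neq => /eqP; rewrite subr_eq0 => /eqP /(congr1 (fun u => (-1) ^+ s * u)).
by rewrite mulrA -expr2 sqrr_sign mul1r mulr1.
Qed.

Lemma sphere_eq (x : unit_sphere) :
  sqnorm (lsubmx (set_val x)) = 1 - last_coord (set_val x) ^+ 2.
Proof.
have : sqnorm (set_val x) = 1 by have := set_valP x.
by rewrite sqnormS => <-; rewrite addrK.
Qed.

Lemma Ck_sqnorm m k (U : set 'rV[R]_m) : open U -> Ck_on k U (sqnorm : _ -> R^o).
Proof.
move=> oU; apply: Ck_sum => // i.
by apply: Ck_eq (CkM oU (Ck_coord k U i) (Ck_coord k U i)) => x; rewrite expr2.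
Qed.

Lemma continuous_last : continuous last_coord.
Proof. exact: coord_continuous. Qed.

Lemma CkZ m p k (U : set 'rV[R]_m) (a : 'rV[R]_m -> R^o) (f : 'rV[R]_m -> 'rV[R]_p) :
  open U -> Ck_on k U a -> Ck_on k U f -> Ck_on k U (fun x => a x *: f x).
Proof.
move=> oU ak fk; apply: Ck_mx => // i j.
by apply: Ck_eq (CkM oU ak (Ck_mxE i j oU fk)) => x; rewrite mxE.
Qed.

Lemma Ck_id m k (U : set 'rV[R]_m) : open U -> Ck_on k U id.
Proof. by move=> oU; apply: Ck_mx => // i j; rewrite ord1; exact: Ck_coord. Qed.

Lemma Ck_stereo_vec s k : Ck_on k setT (stereo_vec s).
Proof.
have oT : open [set: 'rV[R]_n] by exact: openT.
have Ns := Ck_sqnorm k oT.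
apply: CkZ => //.
  apply: CkV => // [x _|]; first exact: sqnorm1_neq0.
  by apply: CkD => //; exact: Ck_cst.
apply: Ck_row_mx => //.
  apply: CkZ => //; [exact: Ck_cst|exact: Ck_id].
apply: Ck_mx => // i j.
apply: (Ck_eq (f := fun x => (-1) ^+ s * (sqnorm x + (-1)))) => [x|].
  by rewrite mxE.
apply: CkM => //; first exact: Ck_cst.
by apply: CkD => //; exact: Ck_cst.
Qed.

Lemma Ck_den s k (U : set 'rV[R]_(n + 1)) : open U ->
  Ck_on k U (fun x => 1 - (-1) ^+ s * last_coord x : R^o).
Proof.
move=> oU; apply: (Ck_eq (f := fun x => 1 + (- (-1) ^+ s) * last_coord x)) => [z|].
  by rewrite mulNr.
apply: CkD => //; first exact: Ck_cst.
by apply: CkM => //; [exact: Ck_cst|exact: Ck_coord].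
Qed.

Lemma stereoK s x : chart_dom (stereo s) x -> stereo_inv s (stereo_map s x) = x.
Proof.
move=> /= /stereo_den d; apply: val_inj => /=.
set t := last_coord (set_val x) in d *.
have t2 : sqnorm (stereo_map s x) = (1 + (-1) ^+ s * t) / (1 - (-1) ^+ s * t).
  rewrite sqnormZ sphere_eq -/t exprVn.
  have -> : 1 - t ^+ 2 = (1 + (-1) ^+ s * t) * (1 - (-1) ^+ s * t).
    by rewrite mulrC -subr_sqr expr1n exprMn sqrr_sign mul1r.
  by field.
have e1 : (sqnorm (stereo_map s x) + 1)^-1 = (1 - (-1) ^+ s * t) / 2.
  rewrite t2 (_ : _ / _ + 1 = 2 / (1 - (-1) ^+ s * t)) ?invf_div//; by field.
rewrite -[RHS]hsubmxK -[LHS]hsubmxK; congr row_mx.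
  rewrite lsub_stereo_vec e1 /stereo_map scalerA -/t.
  rewrite [X in X *: _](_ : _ = 1) ?scale1r//; by field.
apply/rowP => j; rewrite [LHS]mxE [RHS]mxE ord1 -/(last_coord _) last_stereo_vec -/t.
rewrite e1 t2 (_ : _ * (_ / 2) = (-1) ^+ s * t); last by field.
by rewrite mulrA -expr2 sqrr_sign mul1r.
Qed.

Lemma stereo_vec_last s y : last_coord (stereo_vec s y) != (-1) ^+ s.
Proof.
rewrite last_stereo_vec; apply/eqP => /(congr1 (fun u => (-1) ^+ s * u)).
rewrite mulrA -expr2 sqrr_sign mul1r => /eqP.
rewrite -subr_eq0 (_ : _ - 1 = - 2 / (sqnorm y + 1)); last first.
  move: (sqnorm1_neq0 y) => y0; by field.
by rewrite mulf_eq0 invr_eq0 (negbTE (sqnorm1_neq0 y)) oppr_eq0 pnatr_eq0.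
Qed.

Lemma stereo_invK s y : stereo_map s (stereo_inv s y) = y.
Proof.
rewrite /stereo_map /= lsub_stereo_vec last_stereo_vec scalerA.
rewrite [(-1) ^+ s * (_ * _)]mulrA -expr2 sqrr_sign mul1r.
have y0 := sqnorm1_neq0 y.
have -> : 1 - (sqnorm y - 1) / (sqnorm y + 1) = 2 / (sqnorm y + 1) by field.
by rewrite mulVf ?scale1r// mulf_neq0 ?invr_eq0// pnatr_eq0.
Qed.

Lemma stereo_is_chart s : is_chart (stereo s).
Proof.
have c : continuous (set_val : unit_sphere -> 'rV[R]_(n + 1)) by exact: initial_continuous.
split.
- split; last exact: openT.
  apply: (@open_comp _ _ (last_coord \o set_val) [set t | t != (-1) ^+ s]).
    by move=> x _; apply: continuous_comp; [exact: c|exact: continuous_last].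
  exact: open_neq.
- by split=> // y _; exact: stereo_vec_last.
- by split=> [x|y _]; [exact: stereoK|exact: stereo_invK].
- split=> [x /= /stereo_den d|y _].
    pose U : set 'rV[R]_(n + 1) := [set x | 1 - (-1) ^+ s * last_coord x != 0].
    have oU : open U.
      apply: (@open_comp _ _ (fun x => 1 - (-1) ^+ s * last_coord x) [set t | t != 0]).
        by move=> z _; exact: (Ck_cts (Ck_den s 0 openT)).
      exact: open_neq.
    have fk : Ck_on 0 U (fun x => (1 - (-1) ^+ s * last_coord x)^-1 *: lsubmx x).
      apply: CkZ; [exact: oU| |].
        by apply: CkV; [exact: oU| |exact: Ck_den].
      apply: Ck_mx; first exact: oU.
      move=> i j; apply: Ck_eq (Ck_coord 0 U (lshift 1 j)) => z.
      by rewrite mxE ord1.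
    have fc := Ck_cts fk (d : U (set_val x)).
    exact: (continuous_comp (c x) fc).
  apply: subtype_continuous; exact: (Ck_cts (Ck_stereo_vec s 0)).
Qed.

Lemma sphere_smooth_atlas : smooth_atlas sphere_atlas.
Proof.
split.
- by move=> _ [s _ <-]; exact: stereo_is_chart.
- move=> x; have [x1|x1] := eqVneq (last_coord (set_val x)) 1.
    exists (stereo true); first by exists true.
    by rewrite /= x1 expr1 gt_eqF// (lt_trans (ltrN10 R))// ltr01.
  by exists (stereo false) => //; exists false.
- move=> _ _ [s _ <-] [s' _ <-] k.
  have [[od' _] _ _ _] := stereo_is_chart s'.
  have oU := open_chart_map (stereo_is_chart s) od'.
  set U := (X in Ck_on _ X) in oU *.
  have Ny : forall y, U y -> 1 - (-1) ^+ s' * last_coord (stereo_vec s y) != 0.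
    move=> _ [x [dx dx'] <-]; apply: (@stereo_den s' (stereo_inv s (stereo_map s x))).
    by rewrite stereoK.
  have Sk : Ck_on k U (stereo_vec s) by apply: Ck_sub (Ck_stereo_vec s k).
  apply: CkZ => //.
    apply: CkV => //.
    apply: (Ck_eq (f := fun y => 1 + (- (-1) ^+ s') * last_coord (stereo_vec s y))) => [z|].
      by rewrite mulNr.
    apply: CkD => //; first exact: Ck_cst.
    by apply: CkM => //; [exact: Ck_cst|exact: Ck_mxE].
  apply: Ck_mx => // i j; apply: Ck_eq (Ck_mxE i (lshift 1 j) oU Sk) => z.
  by rewrite [RHS]mxE.
Qed.

End sphere.

Definition sphere (R : realType) (n : nat) : manifold R :=
  Manifold (@subtype_hausdorff _ _ (@norm_hausdorff _ _))
           (@subtype_second_countable _ _ (@rV_second_countable R (n + 1)))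
           (@sphere_smooth_atlas R n).

(* ((M * S^n1) * S^n2) * ... * S^nk for ns = [:: n1; n2; ...; nk]. *)
Definition prod_spheres {R : realType} (M : manifold R) (ns : seq nat) :
    manifold R :=
  foldl (fun N n => prod_manifold N (sphere R n)) M ns.

(* MathComp's {action gT &-> T} are right actions. *)
Definition left_action {gT : finGroupType} {T : Type} (act : gT -> T -> T) : Prop :=
  (forall x, act 1%g x = x) /\ (forall g h x, act (g * h)%g x = act g (act h x)).

Definition free_action {gT : finGroupType} {T : Type} (act : gT -> T -> T) : Prop :=
  forall g x, act g x = x -> g = 1%g.

Definition smooth_action {R : realType} {gT : finGroupType} {M : manifold R}
    (act : gT -> M -> M) : Prop :=
  left_action act /\ (forall g, smooth (act g)).

Definition isotropy {gT : finGroupType} {T : eqType} (act : gT -> T -> T) (x : T) :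
    {set gT} :=
  [set g | act g x == x]%SET.

(* ['rV['F_p]_r] is viewed as an additive group, that is (Z/p)^r. *)
Definition elementary_abelian {gT : finGroupType} (A : {set gT}) (r : nat) : Prop :=
  exists2 p : nat, prime p & (A \isog [set: 'rV['F_p]_r]%SET)%g.

(* Main.v *)
(* By induction on [k] it suffices to find an action on [M * S^n] covering the
   given one whose isotropy groups have order [p ^ r] with [r < k]: only the
   orders of the isotropy groups matter.  Such an action comes from a smooth
   cocycle [G * M -> GL_(n+1)] such that, where [#|G_x| = p ^ k], no nonzero
   vector is fixed by [G_x].
   An equivariant smooth map to a linear representation of [G] which preserves
   isotropy groups reduces the construction to an invariant open subset of the
   representation.  For a fixed prime [p], put [a = #|G| / p ^ k].  One builds a
   matrix-valued map [F] such that the matrix [(F (h x))_h] always has maximal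
   rank, and such that at the points with [#|G_x| = p ^ k], whose orbits have
   exactly [a] elements, its kernel contains no nonzero [G_x]-invariant vector:
   there [F] trivialises a multiple of the permutation bundle over the
   configurations of [a] points, elsewhere the orbits have at least [p * a]
   points and a generic perturbation works.  The kernel is an equivariant
   vector bundle which is smoothly trivial for dimension reasons, and its
   equivariant structure in a frame is the cocycle.  The regular representation
   being equivariantly trivial over the free locus, the frame can be chosen
   there so that the cocycle is trivial away from the points with [p]-torsion in
   their isotropy, which allows gluing the cocycles of the various primes. *)
Require Import Defs.
From HB Require Import structures.
From mathcomp Require Import all_boot all_order all_algebra all_fingroup.
From mathcomp Require Import all_classical all_reals all_analysis.
From mathcomp Require Import ring lra.
From mathcomp Require pgroup.

Set Implicit Arguments.
Unset Strict Implicit.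
Unset Printing Implicit Defensive.

Import Order.TTheory GRing.Theory Num.Theory.
Import numFieldNormedType.Exports.

Local Open Scope classical_set_scope.
Local Open Scope ring_scope.

(** * Smooth functions on open sets *)


Section one_variable_chain_rule.
Context {R : realType}.

(** The number of rows of [F] is forced. Where [#|G_x| = p ^ k], the [G_x]-invariant vectors in [K]
    copies of the regular representation are the functions on an orbit of [a] points, a space of
    dimension [a * #|K|]. With exactly that many rows, [F] restricted to them is square, and a
    trivialisation of the permutation bundle makes it invertible: maximal rank and the absence of
    invariant kernel vectors follow together. At the other points only the rank matters, and the
    larger orbits leave at least [a * #|K|] spare conditions; a large [K] makes this exceed [N], and
    also makes the rank of the kernel exceed the dimension of its base. All trivialisations exist
    only after passing to multiples, and each prime has its own, so dimensions are kept in the form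
    [n0 * l] with [l] free, and one common multiple serves all primes. The cocycle takes values in
    invertible matrices and the sphere is reached by normalising vectors; finiteness of the group
    turns fixed rays into fixed vectors. The generic choices all come from [generic_avoidance],
    where a count of grid points and cells takes the place of Sard's theorem. *)

Lemma derive_line {V W : normedModType R} (f : V -> W) x v :
  'D_v f x = 'D_1 (fun h : R => f (h *: v + x)) 0.
Proof.
rewrite /derive; set g1 := fun h => h^-1 *: _; set g2 := fun h => h^-1 *: _.
suff -> : g1 = g2 by [].
by rewrite funeqE /g1 /g2 => h /=; rewrite addr0 scale0r add0r [_%:A]mulr1.
Qed.

(** Restriction to the line through [x] in the direction [v] reduces this to the chain rule in one
    variable. *)
Lemma derive_comp1 {V : normedModType R} (phi : R -> R) (dphi : R) (f : V -> R^o) x v :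
  is_derive (f x) 1 phi dphi -> derivable f x v ->
  derivable (phi \o f : V -> R^o) x v /\
  'D_v (phi \o f : V -> R^o) x = dphi * 'D_v f x.
Proof.
move=> phid /derivable1P fd; set F := fun h : R => f (h *: v + x).
have F0 : F 0 = f x by rewrite /F scale0r add0r.
have phid1 : derivable phi (F 0) 1 by rewrite F0; exact: ex_derive.
have := @derive1_comp R F phi 0 fd phid1.
rewrite !derive1E F0 (@derive_val _ _ _ _ _ _ _ phid) -derive_line => E.
split; last by rewrite derive_line -E.
have /derivable1_diffP dF : derivable (F : R -> R) 0 1 := fd.
have /derivable1_diffP dphi1 : derivable (phi : R -> R) (F 0) 1 := phid1.
have := differentiable_comp dF dphi1.
by move=> /derivable1_diffP d; apply/derivable1P.
Qed.

(* [P] is a class of functions stable under derivation on [D], such as the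
   multiples of the bump function by polynomials in [t^-1]. *)
Lemma Ck_comp1 (P : (R -> R) -> Prop) (D : set R) n (U : set 'rV[R]_n) k
    (phi : R -> R) (f : 'rV[R]_n -> R^o) :
  (forall phi, P phi -> exists2 phi', P phi' &
     forall t, D t -> is_derive t 1 phi (phi' t)) ->
  open U -> P phi -> (forall x, U x -> D (f x)) -> Ck_on k U f ->
  Ck_on k U (phi \o f : _ -> R^o).
Proof.
move=> HP oU; elim: k phi f => [|k IH] phi f Pphi fD fk.
  split=> // x Ux; have [phi' _ d] := HP _ Pphi.
  apply: continuous_comp; first exact: (Ck_cts fk).
  by apply/differentiable_continuous/derivable1_diffP; have [] := d _ (fD _ Ux).
have [phi' Pphi' d] := HP _ Pphi; have [fc fd] := fk.
split=> [x Ux|i].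
  apply: continuous_comp; first exact: fc.
  by apply/differentiable_continuous/derivable1_diffP; have [] := d _ (fD _ Ux).
have [fdi fki] := fd i; split=> [x Ux|].
  by have [] := derive_comp1 (d _ (fD _ Ux)) (fdi x Ux).
apply: Ck_ext (CkM oU (IH _ _ Pphi' fD (CkW fk)) fki) => // x Ux.
by have [_ ->] := derive_comp1 (d _ (fD _ Ux)) (fdi x Ux).
Qed.

(** [flat 1] is the classical function exp (-1/t); the family over all [p] is closed under
    derivation. *)
Definition flat (p : {poly R}) (t : R) : R :=
  if 0 < t then expR (- t^-1) * p.[t^-1] else 0.

Lemma expR_horner_bound (p : {poly R}) : exists2 C : R, 0 < C &
  forall y, 0 <= y -> expR (- y) * `|p.[y]| <= C.
Proof.
have bd n y : 0 <= y -> expR (- y) * y ^+ n <= n`!%:R.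
  move=> y0; rewrite expRN mulrC ler_pdivrMr ?expR_gt0//.
  case: n => [|n]; first by rewrite expr0 mul1r (le_trans _ (expR_ge1Dx y))// lerDl.
  have := expR_ge1Dxn n y0; rewrite -(ler_pM2l (x := n.+1`!%:R)) ?ltr0n ?fact_gt0//.
  move=> H; apply: le_trans _ H.
  by rewrite mulrDr mulrCA divff ?mulr1 ?lerDr ?mulr_ge0// pnatr_eq0 -lt0n fact_gt0.
exists (1 + \sum_(i < size p) `|p`_i| * i`!%:R).
  by rewrite ltr_pwDl// sumr_ge0// => i _; rewrite mulr_ge0.
move=> y y0; rewrite horner_coef.
apply: (@le_trans _ _ (\sum_(i < size p) `|p`_i| * i`!%:R)); last by rewrite lerDr.
apply: le_trans (ler_wpM2l (expR_ge0 _) (ler_norm_sum _ _ _)) _.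
rewrite mulr_sumr; apply: ler_sum => i _.
rewrite normrM mulrCA ler_wpM2l// (ger0_norm (exprn_ge0 _ y0)); exact: bd.
Qed.

Lemma flat_le0 p t : t <= 0 -> flat p t = 0.
Proof. by rewrite /flat ltNge => ->. Qed.

Lemma flat_gt0 t : 0 < t -> 0 < flat 1 t.
Proof. by rewrite /flat => ->; rewrite hornerC mulr1 expR_gt0. Qed.

Lemma flat_ge0 t : 0 <= flat 1 t.
Proof. by have [/flat_le0->|/flat_gt0/ltW] := leP t 0. Qed.

Lemma flat1_eq0 t : (flat 1 t == 0) = (t <= 0).
Proof.
by have [/flat_le0->|/flat_gt0 h] := leP t 0; rewrite ?eqxx// gt_eqF.
Qed.

Lemma flat_derive (p : {poly R}) (t : R) :
  is_derive t 1 (flat p) (flat ('X^2 * (p - p^`())) t).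
Proof.
have [t0|t0|->] := ltgtP t 0.
- rewrite (flat_le0 _ (ltW t0)).
  apply: (@near_eq_is_derive _ _ _ (cst (0 : R))).
  by near=> u; rewrite flat_le0// ltW//; near: u; exact: lt_nbhsl.
- rewrite {2}/flat t0.
  apply: (@near_eq_is_derive _ _ _ (fun t : R => expR (- t^-1) * p.[t^-1])).
    by near=> u; rewrite /flat ifT//; near: u; exact: lt_nbhsr.
  have t1 : t != 0 by rewrite gt_eqF.
  have d1 : is_derive t 1 (fun t : R => t^-1) (- t ^- 2).
    apply: DeriveDef; first by apply: derivableV => //; exact: derivable_id.
    by rewrite deriveV// derive_id /GRing.scale/= mulr1.
  have dp : is_derive t 1 (fun t : R => p.[t^-1]) (p^`().[t^-1] * (- t ^- 2)).
    exact: (@is_derive1_comp R (horner p) (fun t => t^-1) t _ _ (is_derive_poly p t^-1) d1).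
  have dN : is_derive t 1 (fun t : R => - t^-1) (t ^- 2).
    by have := is_deriveN d1; rewrite opprK.
  have de : is_derive t 1 (fun t : R => expR (- t^-1)) (expR (- t^-1) * t ^- 2).
    exact: (@is_derive1_comp R expR (fun t => - t^-1) t _ _ (is_derive_expR _) dN).
  have := is_deriveM de dp.
  move/is_derive_eq; apply; rewrite /GRing.scale/= !hornerE/=.
  by field.
- rewrite flat_le0//.
  (* The factor ['X^2] makes [flat p u] at most of order [u ^+ 2], so the derivative at 0 exists and
     is 0. *)
  have [C C0 HC] := expR_horner_bound ('X^2 * p).
  have bd u : `|flat p u| <= C * `|u| ^+ 2.
    have [u0|u0] := leP u 0; first by rewrite flat_le0// normr0 mulr_ge0 ?sqr_ge0// ltW.
    rewrite /flat u0 normrM (ger0_norm (expR_ge0 _)) (gtr0_norm u0).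
    have ui : 0 <= u^-1 by rewrite invr_ge0 ltW.
    have := HC _ ui; rewrite hornerM hornerXn normrM normrX (ger0_norm ui) exprVn.
    by rewrite mulrCA ler_pdivrMl ?exprn_gt0// [_ * C]mulrC.
  have cv : (fun h : R => h^-1 *: ((flat p \o shift 0) (h *: 1) - flat p 0)) @ 0^' --> (0 : R).
    apply/cvgrPdist_le => e e0; near=> h.
    rewrite flat_le0// subr0 sub0r normrN /= addr0 /GRing.scale/= mulr1 normrM.
    have h0 : h != 0 by near: h; exact: nbhs_dnbhs_neq.
    rewrite normrV ?unitfE// ler_pdivrMl ?normr_gt0//.
    apply: le_trans (bd h) _; rewrite expr2 mulrCA ler_wpM2l//.
    rewrite -ler_pdivlMl//; near: h; apply: nbhs_dnbhs.
    have e1 : 0 < C^-1 * e by rewrite mulr_gt0// invr_gt0.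
    by exists (C^-1 * e) => //= h /=; rewrite sub0r normrN => /ltW.
  by split; [apply/cvg_ex; exists 0|apply/cvg_lim].
Unshelve. all: by end_near. Qed.

(** Multiples of the powers of exponent 1/2 - n, a class closed under derivation on the positive
    reals. *)
Definition sqrt_class (phi : R -> R) :=
  exists c n, phi = (fun t => c * Num.sqrt t * (t^-1) ^+ n).

Lemma sqrt_class_derive phi : sqrt_class phi -> exists2 phi', sqrt_class phi' &
  forall t : R, 0 < t -> is_derive t 1 phi (phi' t).
Proof.
move=> [c [n ->]]; exists (fun t => c * (2^-1 - n%:R) * Num.sqrt t * (t^-1) ^+ n.+1).
  by exists (c * (2^-1 - n%:R)), n.+1.
move=> t t0; have t1 : t != 0 by rewrite gt_eqF.
have ds := is_derive1_sqrt t0.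
have dc : is_derive t 1 (fun t => c * Num.sqrt t) (c * (2 * Num.sqrt t)^-1).
  exact: is_deriveZ.
have d1 : is_derive t 1 (fun t : R => t^-1) (- t ^- 2).
  apply: DeriveDef; first by apply: derivableV => //; exact: derivable_id.
  by rewrite deriveV// derive_id /GRing.scale/= mulr1.
have dn : is_derive t 1 (fun t : R => t^-1 ^+ n) (n%:R * t^-1 ^+ n.-1 * (- t ^- 2)).
  have := @is_derive1_comp R (fun x => x ^+ n) (fun t => t^-1) t (n%:R * t^-1 ^+ n.-1) _ _ d1.
  apply; apply: DeriveDef; first exact: exprn_derivable.
  by rewrite exp_derive /GRing.scale/= mulr1 mulr_natl.
have := is_deriveM dc dn; move/is_derive_eq; apply; rewrite /GRing.scale/=.
have s0 : Num.sqrt t != 0 by rewrite gt_eqF// sqrtr_gt0.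
have -> : (2 * Num.sqrt t)^-1 = 2^-1 * Num.sqrt t * t^-1.
  by rewrite -{3}(sqr_sqrtr (ltW t0)); field.
case: n {dn} => [|n]; first by rewrite !expr0 expr1; ring.
by rewrite /= !exprS; field.
Qed.

(** A smooth step: 0 up to 1/3 and 1 from 2/3 on. Being constant near both ends, it allows
    homotopies to be concatenated and cut off smoothly. *)
Definition st (t : R) : R :=
  flat 1 (t - 3^-1) / (flat 1 (t - 3^-1) + flat 1 (2 / 3 - t)).

Lemma st_den t : flat 1 (t - 3^-1) + flat 1 (2 / 3 - t) != 0.
Proof.
have [h|h] := leP t (2^-1); rewrite gt_eqF//.
  by rewrite ltr_wpDl ?flat_ge0// flat_gt0//; lra.
by rewrite ltr_wpDr ?flat_ge0// flat_gt0//; lra.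
Qed.

Lemma st_le t : t <= 3^-1 -> st t = 0.
Proof. by move=> h; rewrite /st flat_le0 ?mul0r//; lra. Qed.

Lemma st_ge t : 2 / 3 <= t -> st t = 1.
Proof.
move=> h; rewrite /st (@flat_le0 _ (2 / 3 - t)); last lra.
by rewrite addr0 divff// gt_eqF// flat_gt0//; lra.
Qed.

Lemma st_eq0 t : (st t == 0) = (t <= 3^-1).
Proof. by rewrite mulf_eq0 invr_eq0 (negbTE (st_den t)) orbF flat1_eq0 subr_le0. Qed.

End one_variable_chain_rule.

Section smooth_functions.
Context {R : realType}.

Definition sm {n} (U : set 'rV[R]_n) (f : 'rV[R]_n -> R) : Prop :=
  smooth_on U (f : _ -> R^o).

Section closure.
Context {n : nat} {U : set 'rV[R]_n} (oU : open U).
Implicit Types f g : 'rV[R]_n -> R.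

Lemma sm_cst (c : R) : sm U (fun=> c).
Proof. by move=> k; exact: Ck_cst. Qed.

Lemma sm_coord i : sm U (fun x => x 0 i).
Proof. by move=> k; exact: Ck_coord. Qed.

Lemma sm_ext f g : (forall x, U x -> f x = g x) -> sm U f -> sm U g.
Proof. by move=> fg fk k; exact: Ck_ext (fk k). Qed.

Lemma smD f g : sm U f -> sm U g -> sm U (fun x => f x + g x).
Proof. by move=> ? ? k; exact: CkD. Qed.

Lemma smM f g : sm U f -> sm U g -> sm U (fun x => f x * g x).
Proof. by move=> ? ? k; exact: CkM. Qed.

Lemma smN f : sm U f -> sm U (fun x => - f x).
Proof.
by move=> ?; apply: (@sm_ext (fun x => (-1) * f x)) => [x _|];
  [rewrite mulN1r|apply: smM => //; exact: sm_cst].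
Qed.

Lemma smB f g : sm U f -> sm U g -> sm U (fun x => f x - g x).
Proof. by move=> ? ?; apply: smD => //; exact: smN. Qed.

Lemma smV f : (forall x, U x -> f x != 0) -> sm U f -> sm U (fun x => (f x)^-1).
Proof. by move=> ? ? k; exact: CkV. Qed.

Lemma sm_sum (I : Type) (s : seq I) (P : pred I) (f : I -> 'rV[R]_n -> R) :
  (forall i, P i -> sm U (f i)) -> sm U (fun x => \sum_(i <- s | P i) f i x).
Proof.
move=> fk; elim: s => [|a s IH].
  by apply: sm_ext (sm_cst 0) => x _; rewrite big_nil.
case Pa : (P a); last by apply: sm_ext IH => x _; rewrite big_cons Pa.
by apply: sm_ext (smD (fk a Pa) IH) => x _; rewrite big_cons Pa.
Qed.

Lemma sm_prod (I : Type) (s : seq I) (P : pred I) (f : I -> 'rV[R]_n -> R) :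
  (forall i, P i -> sm U (f i)) -> sm U (fun x => \prod_(i <- s | P i) f i x).
Proof.
move=> fk; elim: s => [|a s IH].
  by apply: sm_ext (sm_cst 1) => x _; rewrite big_nil.
case Pa : (P a); last by apply: sm_ext IH => x _; rewrite big_cons Pa.
by apply: sm_ext (smM (fk a Pa) IH) => x _; rewrite big_cons Pa.
Qed.

Lemma smX f k : sm U f -> sm U (fun x => f x ^+ k).
Proof.
move=> fs; elim: k => [|k IH]; first exact: sm_cst.
by apply: sm_ext (smM fs IH) => x _; rewrite exprS.
Qed.

Lemma sm_flat p f : sm U f -> sm U (fun x => flat p (f x)).
Proof.
move=> fs k; apply: (@Ck_comp1 _ (fun phi => exists p, phi = flat p) setT) => //.
- move=> _ [q ->]; exists (flat ('X^2 * (q - q^`()))).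
    by exists ('X^2 * (q - q^`())).
  by move=> t _; exact: flat_derive.
- by exists p.
Qed.

Lemma sm_sqrt f : (forall x, U x -> 0 < f x) -> sm U f ->
  sm U (fun x => Num.sqrt (f x)).
Proof.
move=> f0 fs k; apply: (@Ck_comp1 _ sqrt_class [set t | 0 < t]) => //.
- by move=> phi /sqrt_class_derive.
- by exists 1, 0; apply/funext => t; rewrite mul1r expr0 mulr1.
Qed.

Lemma sm_st f : sm U f -> sm U (fun x => st (f x)).
Proof.
move=> fs; apply: smM.
  by apply: sm_flat; apply: smB => //; exact: sm_cst.
apply: smV => [x _|]; first exact: st_den.
by apply: smD; apply: sm_flat; apply: smB => //; exact: sm_cst.
Qed.

Lemma sm_mulmx {p q r} (A : 'rV[R]_n -> 'M[R]_(p, q)) (B : 'rV[R]_n -> 'M[R]_(q, r)) :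
  (forall i j, sm U (fun x => A x i j)) -> (forall i j, sm U (fun x => B x i j)) ->
  forall i j, sm U (fun x => (A x *m B x) i j).
Proof.
move=> As Bs i j; apply: (@sm_ext (fun x => \sum_k A x i k * B x k j)).
  by move=> x _; rewrite mxE.
by apply: sm_sum => k _; apply: smM.
Qed.

Lemma sm_sqnorm {p} (f : 'rV[R]_n -> 'rV[R]_p) :
  (forall j, sm U (fun x => f x 0 j)) -> sm U (fun x => sqnorm (f x)).
Proof. by move=> fs; apply: sm_sum => j _; apply: smX. Qed.

Lemma sm_mx {p q} (f : 'rV[R]_n -> 'M[R]_(p, q)) :
  (forall i j, sm U (fun x => f x i j)) -> smooth_on U f.
Proof. by move=> fs k; apply: Ck_mx => // i j; exact: fs. Qed.

Lemma sm_mxE {p q} (f : 'rV[R]_n -> 'M[R]_(p, q)) i j :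
  smooth_on U f -> sm U (fun x => f x i j).
Proof. by move=> fs k; exact: Ck_mxE. Qed.

End closure.

Lemma sm_cts {n} {U : set 'rV[R]_n} f x : sm U f -> U x -> {for x, continuous f}.
Proof. by move=> /(_ 0%N) [+ _]; apply. Qed.

Lemma sm_sub {n} {U V : set 'rV[R]_n} f : V `<=` U -> sm U f -> sm V f.
Proof. by move=> VU fs k; exact: Ck_sub (fs k). Qed.

Lemma sm_local {n} {U : set 'rV[R]_n} f :
  (forall x, U x -> exists V, [/\ open V, V x & sm V f]) -> sm U f.
Proof.
move=> H k.
have {}H x : U x -> exists V, [/\ open V, V x & Ck_on k V (f : _ -> R^o)].
  by move=> /H[V [? ? fV]]; exists V; split.
elim: k (f : _ -> R^o) H => [|k IH] g H.
  by split=> // x /H[V [_ Vx [+ _]]]; apply.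
split=> [x /H[V [_ Vx [+ _]]]|i]; first exact.
split=> [x /H[V [_ Vx [_ /(_ i)[+ _]]]]|]; first exact.
by apply: IH => x /H[V [oV Vx [_ /(_ i)[_ ?]]]]; exists V.
Qed.

Lemma sm_lsub {m n} {U : set 'rV[R]_m} f :
  sm U f -> sm (lsubmx @^-1` U) (fun z : 'rV[R]_(m + n) => f (lsubmx z)).
Proof. by move=> fs k; exact: Ck_lsubmx (fs k). Qed.

Lemma open_preim {n} {U : set 'rV[R]_n} (f : 'rV[R]_n -> R) (A : set R) :
  open U -> sm U f -> open A -> open (U `&` f @^-1` A).
Proof.
move=> oU fs oA; rewrite openE => x [Ux Afx].
apply: filterI; first exact: open_nbhs_nbhs.
by have := sm_cts fs Ux; apply; exact: open_nbhs_nbhs.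
Qed.

End smooth_functions.

(** * Generic avoidance *)


(** Baire's theorem is applied in a space of row vectors, which has to be known as complete. *)
HB.instance Definition _ (R : realType) m n :=
  Uniform_isComplete.Build 'M[R]_(m, n) cauchy_cvg.

Section lipschitz.
Context {R : realType}.

Lemma mx_norm_entry m n (A : 'M[R]_(m, n)) i j : `|A i j| <= `|A|.
Proof.
rewrite [leRHS]/Num.Def.normr/= mx_normrE.
exact: (le_bigmax _ (fun k => `|A k.1 k.2|) (i, j)).
Qed.

Lemma mx_norm_le m n (A : 'M[R]_(m, n)) e : 0 <= e ->
  (forall i j, `|A i j| <= e) -> `|A| <= e.
Proof.
move=> e0 H; rewrite /Num.Def.normr/= mx_normrE.
by apply: bigmax_le => // -[i j] _; exact: H.
Qed.

Lemma mx_norm_mul m n p (A : 'M[R]_(m, n)) (B : 'M[R]_(n, p)) :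
  `|A *m B| <= n%:R * `|A| * `|B|.
Proof.
apply: mx_norm_le => [|i j]; first by rewrite !mulr_ge0.
rewrite mxE (le_trans (ler_norm_sum _ _ _))//.
apply: (@le_trans _ _ (\sum_(k < n) `|A| * `|B|)).
  by apply: ler_sum => k _; rewrite normrM ler_pM// mx_norm_entry.
by rewrite sumr_const card_ord -mulrA mulr_natl.
Qed.

Lemma line_lipschitz n (f : 'rV[R]_n -> R^o) (w e : 'rV[R]_n) (a C : R) :
  0 <= a -> (forall t, 0 <= t <= a -> derivable f (t *: e + w) e) ->
  (forall t, 0 <= t <= a -> `|'D_e f (t *: e + w)| <= C) ->
  `|f (a *: e + w) - f w| <= C * a.
Proof.
move=> a0 df dC; pose F := fun t : R => f (t *: e + w).
have FE (t : R) : (fun h : R => h^-1 *: ((F \o shift t) (h *: 1) - F t)) =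
    (fun h : R => h^-1 *: ((f \o shift (t *: e + w)) (h *: e) - f (t *: e + w))).
  by apply/funext => h /=; rewrite /F [h *: 1]mulr1 scalerDl addrA.
have dF (t : R) : 0 <= t <= a -> is_derive t 1 (F : R -> R^o) ('D_e f (t *: e + w)).
  move=> /df d; apply: DeriveDef; first by rewrite /derivable FE.
  by rewrite /derive FE.
have [c|x|c] := @MVT_segment R F (fun t => 'D_e f (t *: e + w)) 0 a a0.
- by rewrite in_itv/= => /andP[c0 ca]; apply: dF; rewrite !ltW.
- have : {within [set` `[0, a]], continuous (F : R -> R^o)}.
    apply: derivable_within_continuous => t; rewrite in_itv/= => ta.
    by have := dF t ta => /@ex_derive.
  exact.
- rewrite in_itv/= => ca; rewrite /F scale0r add0r subr0 => ->.
  by rewrite normrM (ger0_norm a0) ler_wpM2r// dC.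
Qed.

(** One coordinate is changed at a time on the way from [z] to [z']. A ball of the sup norm is a
    box, so it contains the intermediate points, and on each edge the mean value theorem needs a
    bound on one partial derivative only. *)
Lemma sm_lipschitz n (U : set 'rV[R]_n) (f : 'rV[R]_n -> R) z0 :
  open U -> sm U f -> U z0 -> exists e L : R, [/\ 0 < e, 0 <= L,
    ball z0 e `<=` U & forall z z', ball z0 e z -> ball z0 e z' ->
      `|f z - f z'| <= L * `|z - z'|].
Proof.
move=> oU fs Uz0; have [_ fd] := fs 1%N.
pose C : R := 1 + \sum_i `|'D_(delta_mx 0 i) (f : _ -> R^o) z0|.
have C0 : 0 <= C by rewrite addr_ge0// sumr_ge0.
have nC : \forall z \near z0, forall i, `|'D_(delta_mx 0 i) (f : _ -> R^o) z| <= C.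
  apply: (@filter_forall _ _ (fun i z => `|'D_(delta_mx 0 i) (f : _ -> R^o) z| <= C)
    (nbhs z0)) => i; have [_ [/(_ _ Uz0) + _]] := fd i.
  move=> /(@cvgrPdist_le _ _ _ (nbhs z0)) /(_ 1 ltr01); apply: filterS => z zC.
  rewrite -[X in `|X|](subrK ('D_(delta_mx 0 i) (f : _ -> R^o) z0)).
  rewrite (le_trans (ler_normD _ _))// lerD//; first by rewrite distrC.
  by rewrite (bigD1 i)//= lerDl sumr_ge0.
have [e /= e0 eP] : nbhs_ball z0 (U `&` [set z | forall i,
    `|'D_(delta_mx 0 i) (f : _ -> R^o) z| <= C]).
  apply/nbhs_ballP; apply: filterI => //; exact: open_nbhs_nbhs.
exists e, (n%:R * C); split=> //; first by rewrite mulr_ge0.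
  by move=> z /eP[].
move=> z z' bz bz'.
pose w (j : nat) : 'rV[R]_n := \row_i (if (i < j)%N then z' 0 i else z 0 i).
have bw (u : 'rV[R]_n) : (forall i, u 0 i = z 0 i \/ u 0 i = z' 0 i \/
    (z 0 i <= u 0 i <= z' 0 i \/ z' 0 i <= u 0 i <= z 0 i)) -> ball z0 e u.
  move=> H; split=> // a i; rewrite ord1 {a}.
  have := bz.2 0 i; have := bz'.2 0 i; rewrite /ball/= !ltr_distlC.
  by have := H i; case=> [->//|[->//|]]; case=> /andP[? ?] /andP[? ?] /andP[? ?];
    apply/andP; split; lra.
have step (j : 'I_n) : `|f (w j) - f (w j.+1)| <= C * `|z - z'|.
  apply: (@le_trans _ _ (C * `|z 0 j - z' 0 j|)); last first.
    by rewrite ler_wpM2l//; have := mx_norm_entry (z - z') 0 j; rewrite !mxE.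
  have wE (i : 'I_n) : w j.+1 0 i = if i == j then z' 0 i else w j 0 i.
    by rewrite !mxE ltnS leq_eqVlt -val_eqE; case: eqP => //= ->.
  have wj : w j 0 j = z 0 j by rewrite mxE ltnn.
  have wi (i : 'I_n) : w j 0 i = z 0 i \/ w j 0 i = z' 0 i.
    by rewrite mxE; case: ifP; [right|left].
  have [zz|/ltW zz] := leP (z 0 j) (z' 0 j).
    have -> : w j.+1 = (z' 0 j - z 0 j) *: delta_mx 0 j + w j.
      apply/rowP => i; rewrite wE !mxE eqxx/=; case: eqP => [->|_].
        by rewrite ltnn mulr1 subrK.
      by rewrite mulr0 add0r.
    rewrite distrC (distrC (z 0 j)) (ger0_norm (x := z' 0 j - _)) ?subr_ge0//.
    apply: line_lipschitz; rewrite ?subr_ge0// => t /andP[t0 t1].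
      have [+ _] := fd j; apply.
      apply: (eP _ _).1; apply: bw => i; rewrite !mxE eqxx/=.
      have [->|_] := eqVneq i j; last first.
        by rewrite mulr0 add0r; have := wi i; rewrite mxE; tauto.
      by rewrite ltnn mulr1; right; right; left; apply/andP; split; lra.
    apply: (eP _ _).2; apply: bw => i; rewrite !mxE eqxx/=.
    have [->|_] := eqVneq i j; last first.
      by rewrite mulr0 add0r; have := wi i; rewrite mxE; tauto.
    by rewrite ltnn mulr1; right; right; left; apply/andP; split; lra.
  have -> : w j = (z 0 j - z' 0 j) *: delta_mx 0 j + w j.+1.
    apply/rowP => i; rewrite [in RHS]mxE wE !mxE eqxx/=.
    have [->|_] := eqVneq i j; first by rewrite ltnn mulr1 subrK.
    by rewrite mulr0 add0r.
  rewrite (ger0_norm (x := z 0 j - _)) ?subr_ge0//.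
  have wi1 (i : 'I_n) : w j.+1 0 i = z 0 i \/ w j.+1 0 i = z' 0 i.
    by rewrite [_ 0 i]mxE; case: ifP; [right|left].
  have bt t : 0 <= t <= z 0 j - z' 0 j -> ball z0 e (t *: delta_mx 0 j + w j.+1).
    move=> /andP[t0 t1]; apply: bw => i.
    have -> : (t *: delta_mx 0 j + w j.+1) 0 i = t * (i == j)%:R + w j.+1 0 i.
      by rewrite mxE [X in X + _]mxE mxE eqxx.
    have := wi1 i; rewrite wE; have [->|_] := eqVneq i j; last first.
      by rewrite mulr0 add0r; tauto.
    by rewrite mulr1 => _; right; right; right; apply/andP; split; lra.
  apply: line_lipschitz; rewrite ?subr_ge0// => t /bt tb.
    by have [+ _] := fd j; apply; exact: (eP _ tb).1.
  exact: (eP _ tb).2.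
have -> : f z - f z' = \sum_(j < n) (f (w j) - f (w j.+1)).
  have -> : z = w 0%N by apply/rowP => i; rewrite mxE.
  have {1}-> : z' = w n by apply/rowP => i; rewrite mxE ltn_ord.
  rewrite -(big_mkord xpredT (fun j => f (w j) - f (w j.+1))).
  rewrite -[LHS]opprB -[RHS]opprK; congr (- _); rewrite -sumrN.
  rewrite -(telescope_sumr (fun j => f (w j)) (leq0n n)); apply: eq_bigr => j _.
  by rewrite opprB.
rewrite (le_trans (ler_norm_sum _ _ _))//.
apply: (@le_trans _ _ (\sum_(k < n) C * `|z - z'|)); first by apply: ler_sum.
by rewrite sumr_const card_ord -mulrA mulr_natl.
Qed.

End lipschitz.

Section generic_avoidance.
Context {R : realType} {m d D : nat}.
Implicit Types (A : 'rV[R]_m -> 'M[R]_(D, d)) (b : 'rV[R]_m -> 'rV[R]_d).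

(** The parameters for which the equation is solvable in [V] form a nowhere dense set: every ball
    contains a ball free of them. *)
Definition avoidable A b (V : set 'rV[R]_m) :=
  forall (P0 : 'rV[R]_D) (r : R), 0 < r -> exists (P1 : 'rV[R]_D) (s : R),
    [/\ 0 < s, `|P1 - P0| < r &
      forall P, `|P - P1| < s -> forall z, V z -> P *m A z != b z].

Lemma avoidableS A b V V' : V' `<=` V -> avoidable A b V -> avoidable A b V'.
Proof.
move=> VV H P0 r r0; have [P1 [s [s0 P10 HP]]] := H P0 r r0.
by exists P1, s; split=> // P PP z /VV; exact: HP.
Qed.

Lemma exists_nat_gt (x : R) : exists2 n : nat, (0 < n)%N & x < n%:R.
Proof. by exists (Num.truncn x).+1 => //; exact: truncnS_gt. Qed.

Lemma natr_dist_ge1 (a b : nat) : a != b -> 1 <= `|a%:R - b%:R| :> R.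
Proof.
wlog ab : a b / (a < b)%N => [H|_].
  rewrite neq_ltn => /orP[h|h]; first by rewrite H// neq_ltn h.
  by rewrite distrC H// neq_ltn h.
rewrite distrC ger0_norm ?subr_ge0 ?ler_nat 1?ltnW//.
by rewrite lerBrDl natr1 ler_nat.
Qed.

Lemma sm_lipschitz_fin (I : finType) (f : I -> 'rV[R]_m -> R) Z z0 :
  open Z -> (forall i, sm Z (f i)) -> Z z0 -> exists e L : R, [/\ 0 < e, 0 <= L &
    forall i z z', ball z0 e z -> ball z0 e z' -> `|f i z - f i z'| <= L * `|z - z'|].
Proof.
move=> oZ fs Zz0.
have /choice[p Hp] i : exists p : R * R, [/\ 0 < p.1, 0 <= p.2 &
    forall z z', ball z0 p.1 z -> ball z0 p.1 z' -> `|f i z - f i z'| <= p.2 * `|z - z'|].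
  by have [e [L [? ? _ ?]]] := sm_lipschitz oZ (fs i) Zz0; exists (e, L).
exists (\big[Num.min/1]_i (p i).1), (\sum_i (p i).2); split.
- by apply: lt_bigmin => // i _; have [] := Hp i.
- by apply: sumr_ge0 => i _; have [] := Hp i.
- move=> i z z' bz bz'; have [_ _ H] := Hp i.
  have eE : \big[Num.min/1]_i (p i).1 <= (p i).1.
    exact: (bigmin_le 1 i (fun i => (p i).1)).
  apply: le_trans (H z z' (le_ball eE bz) (le_ball eE bz')) _.
  rewrite ler_wpM2r// (bigD1 i)//= lerDl sumr_ge0// => j _.
  by have [] := Hp j.
Qed.

Lemma sm_lipschitz_mx p q (A : 'rV[R]_m -> 'M[R]_(p, q)) Z z0 :
  open Z -> (forall i j, sm Z (fun z => A z i j)) -> Z z0 ->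
  exists e L : R, [/\ 0 < e, 0 <= L &
    forall z z', ball z0 e z -> ball z0 e z' -> `|A z - A z'| <= L * `|z - z'|].
Proof.
move=> oZ As Zz0.
have [|e [L [e0 L0 H]]] := @sm_lipschitz_fin ('I_p * 'I_q)%type
  (fun ij z => A z ij.1 ij.2) Z z0 oZ _ Zz0.
  by move=> [i j].
exists e, L; split=> // z z' bz bz'; apply: mx_norm_le => [|i j].
  by rewrite mulr_ge0.
by rewrite !mxE; exact: (H (i, j)).
Qed.

Lemma cube_pigeonhole K Q (z0 : 'rV[R]_m) (e : R) (z : {ffun 'I_d -> 'I_K.+1} -> 'rV[R]_m) :
  (Q.+1 ^ m < K.+1 ^ d)%N -> 0 < e -> (forall k, ball z0 e (z k)) ->
  exists k k', k != k' /\ `|z k - z k'| <= 2 * e / Q.+1%:R.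
Proof.
move=> QK e0 bz; pose s k i := (z k 0 i - z0 0 i + e) / (2 * e) * Q.+1%:R.
have e2 : 0 < 2 * e by rewrite mulr_gt0.
have sb k i : 0 <= s k i < Q.+1%:R.
  have := (bz k).2 0 i; rewrite /ball/= ltr_distlC => /andP[h1 h2].
  rewrite /s mulr_ge0 ?divr_ge0 ?(ltW e2)//=; last lra.
  by rewrite -[ltRHS]mul1r ltr_pM2r// ltr_pdivrMr//; lra.
pose cell k : {ffun 'I_m -> 'I_Q.+1} := [ffun i => inord (Num.truncn (s k i))].
have [k [k' [kk' E]]] : exists k k', k != k' /\ cell k = cell k'.
  apply: contrapT => H.
  have /leq_card : injective cell.
    move=> k k' E; apply/eqP; rewrite -[_ == _]negbK; apply/negP => kk'.
    by apply: H; exists k, k'.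
  by rewrite !card_ffun !card_ord leqNgt QK.
exists k, k'; split=> //; apply: mx_norm_le => [|a i].
  by rewrite divr_ge0// ltW.
rewrite ord1 {a} !mxE.
have tr k1 : (Num.truncn (s k1 i) < Q.+1)%N.
  by have /andP[? ?] := sb k1 i; rewrite truncn_lt_nat.
have tE : Num.truncn (s k i) = Num.truncn (s k' i).
  by move/ffunP: E => /(_ i); rewrite !ffunE => /(congr1 (fun j : 'I_Q.+1 => j : nat)); rewrite !inordK.
have /andP[k0 _] := sb k i; have /andP[k0' _] := sb k' i.
have := truncn_itv k0; have := truncn_itv k0'; rewrite tE -natr1.
move: (Num.truncn _)%:R => t /andP[t1 t2] /andP[t3 t4].
have -> : z k 0 i - z k' 0 i = (s k i - s k' i) * (2 * e / Q.+1%:R).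
  rewrite /s; have : Q.+1%:R != 0 :> R by rewrite pnatr_eq0.
  by move: (Q.+1%:R) => q q0; field; rewrite q0 gt_eqF.
rewrite normrM (ger0_norm (x := 2 * e / _)) ?divr_ge0 ?(ltW e2)//.
rewrite -[leRHS]mul1r ler_wpM2r ?divr_ge0 ?(ltW e2)//.
by rewrite ler_norml; lra.
Qed.

(** Near [z0] the product [S *m A z] differs from the identity by an error that shrinks a vector by
    at most half its length. *)
Lemma mulmx_near_inverse A z0 (S : 'M[R]_(d, D)) e1 L : 0 < e1 -> 0 <= L ->
  (forall z z', ball z0 e1 z -> ball z0 e1 z' -> `|A z - A z'| <= L * `|z - z'|) ->
  S *m A z0 = 1%:M -> exists2 e, 0 < e <= e1 &
    forall z (y : 'rV[R]_d), ball z0 e z -> `|y| / 2 <= `|y *m S *m A z|.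
Proof.
move=> e10 L0 AL SA; pose cS := d%:R * (D%:R * `|S|) * L + 1.
have cS0 : 0 < cS by rewrite ltr_wpDl// !mulr_ge0.
exists (Num.min e1 (2 * cS)^-1).
  by rewrite lt_min e10/= invr_gt0 mulr_gt0//= ge_min lexx.
move=> z y bz; have zn : `|z - z0| < Num.min e1 (2 * cS)^-1.
  by move: bz; rewrite -ball_normE /= distrC.
have -> : y *m S *m A z = y + y *m (S *m (A z - A z0)).
  by rewrite mulmxBr SA mulmxBr mulmx1 mulmxA addrC subrK.
have H : `|y *m (S *m (A z - A z0))| <= `|y| / 2.
  apply: le_trans (mx_norm_mul _ _) _.
  apply: le_trans (ler_wpM2l _ (mx_norm_mul _ _)) _; first by rewrite mulr_ge0.
  have Aze : `|A z - A z0| <= L * (2 * cS)^-1.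
    have ee1 : Num.min e1 (2 * cS)^-1 <= e1 by rewrite ge_min lexx.
    apply: le_trans (AL _ _ (le_ball ee1 bz) (ballxx _ e10)) _.
    by rewrite ler_wpM2l// (le_trans (ltW zn))// ge_min lexx orbT.
  have q0 : 0 <= d%:R * (D%:R * `|S|) by rewrite !mulr_ge0.
  have E : d%:R * `|y| * (D%:R * `|S| * `|A z - A z0|) =
    `|y| * (d%:R * (D%:R * `|S|) * `|A z - A z0|) by ring.
  rewrite E ler_wpM2l//; apply: le_trans (ler_wpM2l q0 Aze) _.
  have -> : d%:R * (D%:R * `|S|) * (L / (2 * cS)) = (cS - 1) / cS / 2.
    by rewrite /cS; field; rewrite gt_eqF.
  by rewrite -[leRHS]mul1r ler_wpM2r// ler_pdivrMr// mul1r gerBl.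
have := lerB_normD y (y *m (S *m (A z - A z0))).
by move: H; move: (`|y|) (`|_ *m (_ *m _)|) (`|_ + _|) => p q r; lra.
Qed.

(* Pigeonhole: the parameters [P0 + y S], [y] in a grid of mesh [1/K] in
   dimension [d], outnumber the cells of size [1/(C K)] of a cube in dimension
   [m < d]; two parameters with bad points in the same cell would be too close. *)
Lemma avoidable_ball (Z : set 'rV[R]_m) A b z0 (S : 'M[R]_(d, D)) : (m < d)%N ->
  open Z -> (forall i j, sm Z (fun z => A z i j)) ->
  (forall j, sm Z (fun z => b z 0 j)) -> Z z0 -> S *m A z0 = 1%:M ->
  exists2 e, 0 < e & avoidable A b (ball z0 e).
Proof.
move=> md oZ As bs Zz0 SA.
have [eA [LA [eA0 LA0 HA]]] := sm_lipschitz_mx oZ As Zz0.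
have [|eb [Lb [eb0 Lb0 Hb]]] := @sm_lipschitz_mx 1 d b Z z0 oZ _ Zz0.
  by move=> i j; rewrite ord1.
have [eS /andP[eS0 eSA] lower] := mulmx_near_inverse eA0 LA0 HA SA.
pose e := Num.min eS eb; have e0 : 0 < e by rewrite lt_min eS0.
have eeb : e <= eb by rewrite ge_min lexx orbT.
have eeS : e <= eS by rewrite ge_min lexx.
have eeA := le_trans eeS eSA.
exists e => // P0 r r0; apply: contrapT => Hno.
pose r1 := r / (d%:R * `|S| + 1) / 2.
have dS0 : 0 < d%:R * `|S| + 1 by rewrite ltr_wpDl// mulr_ge0.
have r10 : 0 < r1 by rewrite !divr_gt0.
pose L1 := Lb + D%:R * (`|P0| + r) * LA.
have PR0 : 0 <= `|P0| + r by rewrite addr_ge0// ltW.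
have L10 : 0 <= L1 by rewrite addr_ge0// !mulr_ge0.
have [C C0 HC] := exists_nat_gt (16 * L1 * e / r1).
(* With this [K] the [(C * K) ^ m] cells number [K ^ m.+1 <= K ^ d], fewer than the [K.+1 ^ d]
   parameters of the grid. *)
pose K := (C ^ m)%N; have K0 : (0 < K)%N by rewrite expn_gt0 C0.
have K0R : 0 < K%:R :> R by rewrite ltr0n.
(* Two approximate solutions in one cell bound the image of [y k - y k'] by
   [2 * eta + r1 / (8 * K) = r1 / (4 * K)], whereas [lower] bounds it below by [r1 / (2 * K)]. *)
pose eta := r1 / (16 * K%:R); have eta0 : 0 < eta by rewrite divr_gt0// mulr_gt0.
pose y (k : {ffun 'I_d -> 'I_K.+1}) : 'rV[R]_d := \row_j ((r1 / K%:R) * (k j)%:R).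
pose P k := P0 + y k *m S.
have rK0 : 0 <= r1 / K%:R by rewrite divr_ge0// ltW.
have yn k : `|y k| <= r1.
  apply: mx_norm_le => [|i j]; first exact: ltW.
  rewrite mxE normrM (ger0_norm rK0) (ger0_norm (ler0n _ _)) mulrAC ler_pdivrMr//.
  by rewrite ler_wpM2l ?(ltW r10)// ler_nat -ltnS.
have yd k k' : k != k' -> r1 / K%:R <= `|y k - y k'|.
  move=> kk'; have [j kj] : exists j, k j != k' j.
    apply: contrapT => H; move/eqP: kk'; apply; apply/ffunP => j.
    by apply/eqP; rewrite -[_ == _]negbK; apply/negP => ?; apply: H; exists j.
  apply: le_trans (mx_norm_entry _ 0 j); rewrite !mxE -mulrBr normrM.
  rewrite (ger0_norm rK0) ler_peMr//.
  by rewrite natr_dist_ge1// (inj_eq val_inj).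
have Pn k : `|P k - P0| < r.
  rewrite /P addrC addKr (le_lt_trans (mx_norm_mul _ _))//.
  apply: (@le_lt_trans _ _ (d%:R * `|S| * r1)).
    by rewrite mulrAC ler_wpM2l// mulr_ge0.
  have -> : d%:R * `|S| * r1 = (d%:R * `|S|) / (d%:R * `|S| + 1) * (r / 2).
    by rewrite /r1; ring.
  apply: (@le_lt_trans _ _ (1 * (r / 2))); last lra.
  by rewrite ler_wpM2r ?divr_ge0 ?(ltW r0)// ler_pdivrMr// mul1r lerDl.
have PN k : `|P k| <= `|P0| + r.
  by rewrite -[P k](subrK P0) (le_trans (ler_normD _ _))// addrC lerD2l ltW.
(* A parameter of the grid without an [eta]-approximate solution would be the centre of an avoided
   ball, against [Hno]. *)
have /choice[z Hz] k : exists z, ball z0 e z /\ `|P k *m A z - b z| <= eta.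
  apply: contrapT => H; apply: Hno.
  pose CA := `|A z0| + LA * e; have CA0 : 0 <= CA by rewrite addr_ge0// mulr_ge0// ltW.
  exists (P k), (eta / (D%:R * CA + 1)); split=> //.
    by rewrite divr_gt0// ltr_wpDl// mulr_ge0.
  move=> P' P'P z bz; apply/eqP => E; apply: H; exists z; split=> //.
  rewrite -E -mulmxBl (le_trans (mx_norm_mul _ _))//.
  have AzC : `|A z| <= CA.
    rewrite -[A z](subrK (A z0)) (le_trans (ler_normD _ _))// addrC lerD2l.
    apply: le_trans (HA _ _ (le_ball eeA bz) (ballxx _ eA0)) _.
    by rewrite ler_wpM2l//; move: bz; rewrite -ball_normE /= distrC => /ltW.
  apply: (@le_trans _ _ (eta / (D%:R * CA + 1) * (D%:R * CA))).
    have -> : D%:R * `|P k - P'| * `|A z| = `|P k - P'| * (D%:R * `|A z|) by ring.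
    apply: ler_pM; rewrite ?mulr_ge0//; first by rewrite distrC ltW.
    exact: ler_wpM2l.
  by rewrite mulrAC ler_pdivrMr ?ltr_wpDl ?mulr_ge0// ler_wpM2l ?(ltW eta0)// lerDl.
have CK0 : (0 < C * K)%N by rewrite muln_gt0 C0.
have [||k [k' [kk' zz]]] := @cube_pigeonhole K (C * K).-1 z0 e z _ e0.
- rewrite prednK// expnMn -/K -expnS.
  apply: (@leq_ltn_trans (K ^ d)%N); first by rewrite leq_pexp2l.
  by rewrite ltn_exp2r// (leq_ltn_trans _ md).
- by move=> k; have [] := Hz k.
have [bz nz] := Hz k; have [bz' nz'] := Hz k'.
rewrite prednK// in zz.
have zz1 : L1 * `|z k - z k'| <= r1 / (8 * K%:R).
  apply: le_trans (ler_wpM2l L10 zz) _.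
  rewrite natrM; have C0R : 0 < C%:R :> R by rewrite ltr0n.
  have -> : L1 * (2 * e / (C%:R * K%:R)) = (16 * L1 * e / r1) * (r1 / (8 * K%:R)) / C%:R.
    by field; rewrite !gt_eqF.
  rewrite ler_pdivrMr// mulrC ler_wpM2l ?(ltW HC)//.
  by rewrite divr_ge0 ?(ltW r10)// mulr_ge0.
have := lower (z k) (y k - y k') (le_ball eeS bz).
have -> : (y k - y k') *m S *m A (z k) = (P k *m A (z k) - b (z k))
   - (P k' *m A (z k') - b (z k')) + (b (z k) - b (z k'))
   - P k' *m (A (z k) - A (z k')).
  have -> : (y k - y k') *m S = P k - P k'.
    by rewrite /P mulmxBl opprD addrACA subrr add0r.
  rewrite mulmxBl mulmxBr; move: (P k *m _) (P k' *m _) (P k' *m _) => a1 a2 a3.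
  by apply/rowP => j; rewrite !mxE; ring.
move=> H; have {H} := le_trans H (ler_normB _ _).
move=> H; have {H} := le_trans H (lerD (ler_normD _ _) (lexx _)).
move=> H; have {H} := le_trans H (lerD (lerD (ler_normB _ _) (lexx _)) (lexx _)).
have := yd k k' kk'; have := Hb _ _ (le_ball eeb bz) (le_ball eeb bz').
have := HA _ _ (le_ball eeA bz) (le_ball eeA bz').
have : `|P k' *m (A (z k) - A (z k'))| <= D%:R * (`|P0| + r) * `|A (z k) - A (z k')|.
  apply: le_trans (mx_norm_mul _ _) _; rewrite ler_wpM2r// ler_wpM2l//.
move: zz1 nz nz'; rewrite /L1 mulrDl.
have -> : eta = r1 / K%:R / 16 by rewrite /eta; field; rewrite gt_eqF.
have -> : r1 / (8 * K%:R) = r1 / K%:R / 8 by field; rewrite gt_eqF.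
have q0 : 0 < r1 / K%:R by rewrite divr_gt0.
have DP : 0 <= D%:R * (`|P0| + r) by rewrite mulr_ge0.
move: (`|P k *m _ - _|) (`|P k' *m _ - _|) (`|P k' *m _|) (`|b _ - _|) (`|y k - _|).
move=> a1 a2 a3 a4 a5 h1 h2 h3 h4 h5 h6 h7 h8.
have := ler_wpM2l DP h5.
move: h1 h2 h3 h4 h6 h7 h8 q0; rewrite mulrA.
move: (r1 / _) (Lb * _) (_ * LA * _) (_ * `|A _ - _|) => *; clear SA; lra.
Qed.

(** By [avoidable_ball] each point of [Z i] has a basic neighbourhood that is avoidable. There are
    countably many pairs of an index and a basic open set, each excludes a nowhere dense set of
    parameters, and Baire's theorem leaves a parameter outside all of them. *)
Theorem generic_avoidance (I : countType) (Z : I -> set 'rV[R]_m)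
    (A : I -> 'rV[R]_m -> 'M[R]_(D, d)) (b : I -> 'rV[R]_m -> 'rV[R]_d) :
  (m < d)%N -> (forall i, open (Z i)) ->
  (forall i k l, sm (Z i) (fun z => A i z k l)) ->
  (forall i l, sm (Z i) (fun z => b i z 0 l)) ->
  (forall i z, Z i z -> exists S : 'M[R]_(d, D), S *m A i z = 1%:M) ->
  exists P : 'rV[R]_D, forall i z, Z i z -> P *m A i z != b i z.
Proof.
move=> md oZ As bs HS.
have [B /countable_injP[f finj] [oB bB]] := @rV_second_countable R m.
pose bad i n : set 'rV[R]_D := [set P | exists V, [/\ B V, f V = n,
  avoidable (A i) (b i) V & exists2 z, V z & P *m A i z = b i z]].
(* Interiors are taken because Baire's theorem asks for dense open sets; numbers that code no pair
   impose no condition. *)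
pose F n : set 'rV[R]_D :=
  if unpickle n is Some (i, k) then interior (~` bad i k) else setT.
have oF n : open (F n) /\ dense (F n).
  rewrite /F; case: (unpickle n) => [[i k]|]; last first.
    by split; [exact: openT|move=> O [x Ox] _; exists x].
  split; first exact: open_interior.
  move=> O [P0 OP0] oO.
  have [[V [BV fV aV]]|noV] := pselect (exists V, [/\ B V, f V = k & avoidable (A i) (b i) V]).
    have [r /= r0 rO] : nbhs_ball P0 O by apply/nbhs_ballP; exact: open_nbhs_nbhs.
    have [P1 [s [s0 P10 HP]]] := aV P0 r r0.
    exists P1; split; first by apply: rO; rewrite -ball_normE /= distrC.
    apply/nbhs_ballP; exists s => // P; rewrite -ball_normE /= distrC => PP.
    move=> [V' [BV' fV' _ [z Vz E]]].
    have VV : V' = V by apply: finj; rewrite ?inE// fV' fV.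
    by rewrite VV in Vz; have := HP P PP z Vz; rewrite E eqxx.
  exists P0; split=> //; apply/nbhs_ballP; exists 1 => //= P _ [V [BV fV aV _]].
  by apply: noV; exists V.
have [|P [_ FP]] := Baire oF _ openT; first by exists 0.
exists P => i z Zz; apply/eqP => E.
have [S SA] := HS i z Zz.
have [e e0 He] := avoidable_ball md (oZ i) (As i) (bs i) Zz SA.
have [V [BV Vz Ve]] := bB z _ (nbhsx_ballx z e e0).
have := FP (pickle (i, f V)) Logic.I; rewrite /F pickleK => /interior_subset; apply.
exists V; split=> //; last by exists z.
exact: avoidableS He.
Qed.
End generic_avoidance.

(** * Trivialisation over the free locus *)


Section fmat.
Context {R : realType}.

(* Square matrices indexed by an arbitrary finite type; inverses are always
   carried along explicitly. *)
Definition fmat (I : finType) := I -> I -> R.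

Definition fmul {I : finType} (A B : fmat I) : fmat I :=
  fun i j => \sum_k A i k * B k j.

Definition fid {I : finType} : fmat I := fun i j => (i == j)%:R.

Definition finverse {I : finType} (A B : fmat I) := fmul A B = fid /\ fmul B A = fid.

Lemma fmul1m I (A : fmat I) : fmul fid A = A.
Proof.
apply/funext => i; apply/funext => j; rewrite /fmul (bigD1 i)//= /fid eqxx mul1r.
by rewrite big1 ?addr0// => k ki; rewrite eq_sym (negbTE ki) mul0r.
Qed.

Lemma fmulm1 I (A : fmat I) : fmul A fid = A.
Proof.
apply/funext => i; apply/funext => j; rewrite /fmul (bigD1 j)//= /fid eqxx mulr1.
by rewrite big1 ?addr0// => k ki; rewrite (negbTE ki) mulr0.
Qed.

Lemma fmulA I (A B C : fmat I) : fmul A (fmul B C) = fmul (fmul A B) C.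
Proof.
apply/funext => i; apply/funext => j; rewrite /fmul.
under eq_bigr do rewrite mulr_sumr.
rewrite exchange_big/=; apply: eq_bigr => k _; rewrite mulr_suml.
by apply: eq_bigr => l _; rewrite mulrA.
Qed.

Lemma finverseM I (A A' B B' : fmat I) : finverse A A' -> finverse B B' ->
  finverse (fmul A B) (fmul B' A').
Proof.
move=> [A1 A2] [B1 B2]; split.
  by rewrite -fmulA (fmulA B) B1 fmul1m.
by rewrite -fmulA (fmulA A') A2 fmul1m.
Qed.

Lemma finverse1 I : finverse (@fid I) fid.
Proof. by split; rewrite fmul1m. Qed.

Lemma finverseC I (A B : fmat I) : finverse A B -> finverse B A.
Proof. by case. Qed.

Lemma finverse_unique I (A B C : fmat I) : finverse A B -> finverse A C -> B = C.
Proof. by move=> [_ BA] [CA _]; rewrite -[B]fmulm1 -CA fmulA BA fmul1m. Qed.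

Lemma sm_fmul n (U : set 'rV[R]_n) I (A B : 'rV[R]_n -> fmat I) : open U ->
  (forall i j, sm U (fun z => A z i j)) -> (forall i j, sm U (fun z => B z i j)) ->
  forall i j, sm U (fun z => fmul (A z) (B z) i j).
Proof. by move=> oU sA sB i j; apply: sm_sum => // k _; apply: smM. Qed.

(** * Paths of invertible matrices from permutations to the identity *)

Section permutation_path.
Variable Q : finType.

(** Doubling by [bool] gives the matrix of a permutation determinant 1, so that it can be joined to
    the identity through invertible matrices. *)
Definition pmat (g : Q -> Q) : fmat (Q * bool)%type :=
  fun i j => (i == (g j.1, j.2))%:R.

Lemma pmatM g h : fmul (pmat g) (pmat h) = pmat (g \o h).
Proof.
apply/funext => i; apply/funext => j; rewrite /fmul /pmat.
rewrite (bigD1 (h j.1, j.2))//= eqxx mulr1 big1 ?addr0// => k kj.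
by rewrite (negbTE kj) mulr0.
Qed.

Lemma pmat1 : pmat id = fid.
Proof. by apply/funext => i; apply/funext => -[j1 j2]. Qed.

Definition rot (c s : R) : bool -> bool -> R :=
  fun b b' => if b == b' then c else if b then s else - s.

(** Let [v = e_a - e_b], of squared norm 2. On the plane of [v] tensored with R^2 this is
    multiplication by the complex number c + i s, and on the orthogonal complement it is the
    identity; the factor 1/2 normalises the projection onto [v]. *)
Definition twist (a b : Q) (c s : R) : fmat (Q * bool)%type := fun i j =>
  fid i j + 2^-1 * (((i.1 == a)%:R - (i.1 == b)%:R) * ((j.1 == a)%:R - (j.1 == b)%:R)) *
    (rot c s i.2 j.2 - (i.2 == j.2)%:R).

Lemma twistM a b c s c' s' : a != b ->
  fmul (twist a b c s) (twist a b c' s') = twist a b (c * c' - s * s') (s * c' + c * s').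
Proof.
move=> ab; apply/funext => -[i i']; apply/funext => -[j j']; rewrite /fmul /=.
pose e (q : Q) : R := (q == a)%:R - (q == b)%:R.
have e2 : \sum_q e q * e q = 2.
  rewrite (bigD1 a)//= (bigD1 b) 1?eq_sym//= big1 => [|q /andP[qa qb]].
    by rewrite /e !eqxx (eq_sym b) (negbTE ab) /= mulr1n mulr0n; ring.
  by rewrite /e (negbTE qa) (negbTE qb) /= mulr0n; ring.
pose X (c s : R) b b' := rot c s b b' - (b == b')%:R.
have -> : \sum_k twist a b c s (i, i') k * twist a b c' s' k (j, j') =
  fid (i, i') (j, j') + 2^-1 * (e i * e j) * X c s i' j' + 2^-1 * (e i * e j) * X c' s' i' j'
  + 2^-1 ^+ 2 * (e i * e j) * \sum_k (e k.1 * e k.1) * (X c s i' k.2 * X c' s' k.2 j').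
  transitivity (fmul fid fid (i, i') (j, j')
    + fmul (fun i j => 2^-1 * (e i.1 * e j.1) * X c s i.2 j.2) fid (i, i') (j, j')
    + fmul fid (fun i j => 2^-1 * (e i.1 * e j.1) * X c' s' i.2 j.2) (i, i') (j, j')
    + \sum_k (2^-1 * (e i * e k.1) * X c s i' k.2) * (2^-1 * (e k.1 * e j) * X c' s' k.2 j')).
    by rewrite /fmul -!big_split/=; apply: eq_bigr => k _; rewrite /twist /X /e /=; ring.
  rewrite !fmul1m !fmulm1; congr (_ + _); rewrite mulr_sumr; apply: eq_bigr => k _; ring.
have -> : \sum_k (e k.1 * e k.1) * (X c s i' k.2 * X c' s' k.2 j') =
    2 * \sum_k' X c s i' k' * X c' s' k' j'.
  rewrite -e2 big_distrlr/= (pair_big xpredT xpredT)/=; exact: eq_bigr.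
rewrite big_bool/= /twist -/(e i) -/(e j) /X /rot/=.
by case: i'; case: j' => /=; field.
Qed.

Lemma twist1 a b : twist a b 1 0 = fid.
Proof.
apply/funext => -[i i']; apply/funext => -[j j']; rewrite /twist /rot/=.
by case: i'; case: j' => /=; ring.
Qed.

Lemma twistN1 a b : a != b -> twist a b (-1) 0 = pmat (tperm a b).
Proof.
move=> ab; apply/funext => -[i i']; apply/funext => -[j j'].
rewrite /twist /pmat /fid /rot !xpair_eqE/=.
have E : (i == tperm a b j)%:R = (i == j)%:R -
    ((i == a)%:R - (i == b)%:R) * ((j == a)%:R - (j == b)%:R) :> R.
  case: tpermP => [->|->|/eqP ja /eqP jb].
  - by rewrite eqxx (negbTE ab) /= mulr1n mulr0n; ring.
  - by rewrite eqxx (eq_sym b) (negbTE ab) /= mulr1n mulr0n; ring.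
  - by rewrite (negbTE ja) (negbTE jb) /= mulr0n; ring.
by case: i'; case: j' => /=; rewrite ?andbT ?andbF/= ?E; field.
Qed.

Definition smooth_path (A : R -> fmat (Q * bool)%type) := forall i j n U s, open U ->
  @sm R n U s -> sm U (fun z => A (s z) i j).

Lemma perm_path (g : {perm Q}) : exists A A' : R -> fmat (Q * bool)%type,
  [/\ smooth_path A, smooth_path A', forall t, finverse (A t) (A' t),
      A 0 = pmat g & A 1 = fid].
Proof.
have [ts -> dts] := prod_tpermP g; elim: ts dts => [_|[a b] ts IH] /=.
  exists (fun=> fid), (fun=> fid); rewrite big_nil; split=> //.
  - by move=> i j n U s oU _; exact: sm_cst.
  - by move=> i j n U s oU _; exact: sm_cst.
  - by move=> _; exact: finverse1.
  - by rewrite -pmat1; congr pmat; apply/funext => x; rewrite perm1.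
move=> /andP[ab /IH[A [A' [sA sA' AA A0 A1]]]]; rewrite /dpair/= in ab.
(* An arc from -1 to 1 in the complex plane that avoids 0; the inverse is the conjugate divided by
   [q]. *)
pose c (t : R) := 2 * t - 1; pose s (t : R) := t * (1 - t).
pose q t := c t ^+ 2 + s t ^+ 2.
have q0 t : q t != 0.
  rewrite /q paddr_eq0 ?sqr_ge0// !sqrf_eq0; apply/negP => /andP[/eqP ct /eqP st].
  have tE : t = 2^-1 by move: ct; rewrite /c; lra.
  by move: st; rewrite /s tE; lra.
have smc n U (f : 'rV[R]_n -> R) : open U -> sm U f -> sm U (fun z => c (f z)).
  by move=> oU sf; apply: smB; rewrite //; [apply: smM|]; rewrite //; exact: sm_cst.
have sms n U (f : 'rV[R]_n -> R) : open U -> sm U f -> sm U (fun z => s (f z)).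
  by move=> oU sf; apply: smM; rewrite //; apply: smB; rewrite //; exact: sm_cst.
have smt n (U : set 'rV[R]_n) (f h : 'rV[R]_n -> R) i j : open U -> sm U f -> sm U h ->
    sm U (fun z => twist a b (f z) (h z) i j).
  move=> oU sf sh; apply: smD; rewrite //; first exact: sm_cst.
  apply: smM; rewrite //; first exact: sm_cst.
  apply: smB; rewrite //; last exact: sm_cst.
  rewrite /rot; case: (i.2 == j.2) => //; case: i.2 => //; exact: smN.
exists (fun t => fmul (A t) (twist a b (c t) (s t))).
exists (fun t => fmul (twist a b (c t / q t) (- s t / q t)) (A' t)); split.
- move=> i j n U f oU sf; apply: sm_fmul => //; first by move=> ? ?; exact: sA.
  by move=> i' j'; apply: smt => //; [exact: smc|exact: sms].
- move=> i j n U f oU sf; apply: sm_fmul => //; last by move=> ? ?; exact: sA'.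
  have sq : sm U (fun z => (q (f z))^-1).
    by apply: smV => //; apply: smD => //; apply: smX => //; [exact: smc|exact: sms].
  move=> i' j'; apply: smt => //; apply: smM => //; [exact: smc|apply: smN => //; exact: sms].
- move=> t; apply: finverseM => //; split; rewrite twistM// -(twist1 a b); congr twist.
  + by rewrite /q; field; exact: q0.
  + by rewrite /q; field; exact: q0.
  + by rewrite /q; field; exact: q0.
  + by rewrite /q; field; exact: q0.
- have -> : c 0 = -1 by rewrite /c; ring.
  have -> : s 0 = 0 by rewrite /s; ring.
  rewrite A0 twistN1// pmatM; congr pmat; apply/funext => x /=.
  by rewrite big_cons permM.
- have -> : c 1 = 1 by rewrite /c; ring.
  have -> : s 1 = 0 by rewrite /s; ring.
  by rewrite A1 twist1 fmul1m.
Qed.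

End permutation_path.
End fmat.

(* As in diffeology, smoothness on [X] is tested along plots, so that no chain
   rule is ever needed. *)
Record plots (R : realType) (X : Type) := Plots {
  plot : forall n, set 'rV[R]_n -> ('rV[R]_n -> X) -> Prop;
  plotS : forall n (U V : set 'rV[R]_n) xi, V `<=` U -> plot U xi -> plot V xi }.

Section plots.
Context {R : realType} {X : Type} (p : plots R X).

Definition psm (D : set X) (f : X -> R) := forall n (U : set 'rV[R]_n) xi,
  open U -> plot p U xi -> (forall z, U z -> D (xi z)) -> sm U (fun z => f (xi z)).

Definition psm2 (D : set X) (f : X -> R -> R) := forall n (U : set 'rV[R]_n) xi s,
  open U -> plot p U xi -> (forall z, U z -> D (xi z)) -> sm U s ->
  sm U (fun z => f (xi z) (s z)).

End plots.

(** * Block-diagonal matrices and matrices permuting the blocks *)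

Section block_diagonal.
Context {R : realType} {S K Q : finType}.

Definition base_idx (i : S * (K * Q)) : S * K := (i.1, i.2.1).
Definition fibre_idx (i : S * (K * Q)) : Q := i.2.2.

Lemma sum_base_fibre (F : S * (K * Q) -> R) :
  \sum_i F i = \sum_q \sum_p F (p.1, (p.2, q)).
Proof.
rewrite exchange_big pair_big/=.
rewrite (reindex (fun x : (S * K) * Q => (x.1.1, (x.1.2, x.2))))//=.
by exists (fun i : S * (K * Q) => ((i.1, i.2.1), i.2.2)) => [[[a b] c]|[a [b c]]] _.
Qed.

Definition bdiag (D : Q -> @fmat R (S * K)%type) : @fmat R (S * (K * Q))%type :=
  fun i j => (fibre_idx i == fibre_idx j)%:R * D (fibre_idx i) (base_idx i) (base_idx j).

Definition fibremx (A : @fmat R Q) : @fmat R (S * (K * Q))%type :=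
  fun i j => (base_idx i == base_idx j)%:R * A (fibre_idx i) (fibre_idx j).

Lemma idx_eq i j : (i == j) = (base_idx i == base_idx j) && (fibre_idx i == fibre_idx j).
Proof. by case: i j => a [b c] [a' [b' c']]; rewrite /base_idx /fibre_idx !xpair_eqE/= andbA. Qed.

Lemma bdiag_fibremx D A i j : fmul (bdiag D) (fibremx A) i j =
  D (fibre_idx i) (base_idx i) (base_idx j) * A (fibre_idx i) (fibre_idx j).
Proof.
rewrite /fmul sum_base_fibre (bigD1 (fibre_idx i))//= [X in _ + X]big1 ?addr0.
  rewrite (bigD1 (base_idx j))//= [X in _ + X]big1 ?addr0.
    by rewrite /bdiag /fibremx /fibre_idx /base_idx/= !eqxx !mul1r.
  move=> p pj; rewrite /fibremx /base_idx/= -surjective_pairing (negbTE pj).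
  by rewrite mul0r mulr0.
move=> q qi; rewrite big1// => p _; rewrite /bdiag /fibre_idx/= eq_sym (negbTE qi).
by rewrite !mul0r.
Qed.

Lemma fibremx_bdiag D A i j : fmul (fibremx A) (bdiag D) i j =
  A (fibre_idx i) (fibre_idx j) * D (fibre_idx j) (base_idx i) (base_idx j).
Proof.
rewrite /fmul sum_base_fibre (bigD1 (fibre_idx j))//= [X in _ + X]big1 ?addr0.
  rewrite (bigD1 (base_idx i))//= [X in _ + X]big1 ?addr0.
    by rewrite /bdiag /fibremx /fibre_idx /base_idx/= !eqxx !mul1r.
  move=> p pj; rewrite /fibremx /base_idx/= -surjective_pairing eq_sym (negbTE pj).
  by rewrite !mul0r.
move=> q qi; rewrite big1// => p _; rewrite /bdiag /fibre_idx/= (negbTE qi).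
by rewrite mul0r mulr0.
Qed.

Lemma bdiagM D D' : fmul (bdiag D) (bdiag D') = bdiag (fun q => fmul (D q) (D' q)).
Proof.
apply/funext => i; apply/funext => j.
rewrite {1}/fmul sum_base_fibre (bigD1 (fibre_idx i))//= [X in _ + X]big1 ?addr0.
  rewrite /bdiag /fibre_idx /base_idx/= /fmul mulr_sumr; apply: eq_bigr => -[a b] _ /=.
  by rewrite eqxx mul1r mulrCA.
move=> q qi; rewrite big1// => p _; rewrite /bdiag /fibre_idx/= eq_sym (negbTE qi).
by rewrite !mul0r.
Qed.

Lemma bdiag1 : bdiag (fun=> fid) = fid.
Proof.
by apply/funext => i; apply/funext => j; rewrite /bdiag /fid idx_eq -natrM mulnb andbC.
Qed.

Lemma fibremxM A A' : fmul (fibremx A) (fibremx A') = fibremx (fmul A A').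
Proof.
apply/funext => i; apply/funext => j.
rewrite {1}/fmul sum_base_fibre exchange_big/= (bigD1 (base_idx i))//=.
rewrite [X in _ + X]big1 ?addr0.
  rewrite /fibremx /fibre_idx /base_idx/= /fmul mulr_sumr; apply: eq_bigr => q _ /=.
  by rewrite eqxx mul1r mulrCA.
move=> q qi; rewrite big1// => q' _; rewrite /fibremx /base_idx/= -surjective_pairing.
by rewrite eq_sym (negbTE qi) !mul0r.
Qed.

Lemma fibremx1 : fibremx fid = fid.
Proof.
by apply/funext => i; apply/funext => j; rewrite /fibremx /fid idx_eq -natrM mulnb.
Qed.

Lemma fibremx_inverse A A' : finverse A A' -> finverse (fibremx A) (fibremx A').
Proof. by move=> [h1 h2]; split; rewrite fibremxM ?h1 ?h2 fibremx1. Qed.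

Lemma bdiag_inverse D D' : (forall q, finverse (D q) (D' q)) ->
  finverse (bdiag D) (bdiag D').
Proof.
move=> h; split; rewrite bdiagM -bdiag1; congr bdiag; apply/funext => q; by case: (h q).
Qed.

Lemma bdiag_comm M A : fmul (bdiag (fun=> M)) (fibremx A) = fmul (fibremx A) (bdiag (fun=> M)).
Proof.
by apply/funext => i; apply/funext => j; rewrite bdiag_fibremx fibremx_bdiag mulrC.
Qed.

End block_diagonal.

Lemma bdiag_pmat {R : realType} {S K T : finType} (D : T -> @fmat R (S * K)%type) (f : T -> T) :
  fmul (bdiag (fun q => D q.1)) (fibremx (pmat f)) =
  fmul (fibremx (pmat f)) (bdiag (fun q : T * bool => D (f q.1))).
Proof.
apply/funext => i; apply/funext => j; rewrite bdiag_fibremx fibremx_bdiag /pmat.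
by have [->|_] := eqVneq (fibre_idx i); rewrite ?mulr1 ?mul1r// mulr0 mul0r.
Qed.

(** * Induction over a cover by invariant open sets with equivariant maps to the group *)

Section equivariant_trivialisation.
Context {R : realType} {X : Type} (p : plots R X).
Context {T : finGroupType} (act : T -> X -> X).
Context {S : finType} (tact : T -> S -> S).
Variables (tau : nat -> X -> R) (g : nat -> X -> T).
Hypothesis actM : forall a b x, act (a * b)%g x = act a (act b x).
Hypothesis act_plot : forall a n (U : set 'rV[R]_n) xi,
  open U -> plot p U xi -> plot p U (fun z => act a (xi z)).
Hypothesis tact1 : forall s, tact 1%g s = s.
Hypothesis tactM : forall a b s, tact (a * b)%g s = tact a (tact b s).
Hypothesis tau_sm : forall r, psm p setT (tau r).
Hypothesis tau_ge0 : forall r x, 0 <= tau r x.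
Hypothesis tau_inv : forall r a x, tau r (act a x) = tau r x.
Hypothesis g_equiv : forall r a x, tau r x != 0 -> g r (act a x) = (a * g r x)%g.
Hypothesis g_loc : forall r n (U : set 'rV[R]_n) xi z, open U -> plot p U xi -> U z ->
  tau r (xi z) != 0 -> \forall z' \near z, g r (xi z') = g r (xi z).

Let dom (d : nat) : set X := [set x | exists2 r, (r < d)%N & tau r x != 0].
Let tsum d x := \sum_(r < d) tau r x.

Let tsum_neq0 d x : dom d x <-> tsum d x != 0.
Proof.
rewrite /tsum psumr_neq0//; split=> [[r rd h]|/hasP[r _ /= h]].
  by apply/hasP; exists (Ordinal rd); rewrite ?mem_index_enum//= lt_def h tau_ge0.
by exists r => //; rewrite gt_eqF.
Qed.

Let domS d x : dom d.+1 x <-> tau d x + tsum d x != 0.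
Proof. by rewrite tsum_neq0 /tsum big_ord_recr/= addrC. Qed.

Let dom_inv d a x : dom d x -> dom d (act a x).
Proof. by move=> [r rd h]; exists r; rewrite ?tau_inv. Qed.

Let tsum_inv d a x : tsum d (act a x) = tsum d x.
Proof. by apply: eq_bigr => r _; rewrite tau_inv. Qed.

Let ratio d x := tau d x / (tau d x + tsum d x).

Let tactK a : cancel (tact a) (tact a^-1%g).
Proof. by move=> s; rewrite -tactM mulVg. Qed.

Let tactKV a : cancel (tact a^-1%g) (tact a).
Proof. by move=> s; rewrite -tactM mulgV. Qed.

(** Translation of a frame by [h] through its row index; [rhoi] is the matching operation on inverse
    frames, through the column index. *)
Let rho {K : finType} (h : T) (M : @fmat R (S * K)%type) : fmat _ :=
  fun i j => M (tact h^-1%g i.1, i.2) j.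
Let rhoi {K : finType} (h : T) (M : @fmat R (S * K)%type) : fmat _ :=
  fun i j => M i (tact h^-1%g j.1, j.2).

Let rho_inverse (K : finType) h (M M' : @fmat R (S * K)%type) : finverse M M' ->
  finverse (rho h M) (rhoi h M').
Proof.
have inj : injective (fun i : S * K => (tact h^-1%g i.1, i.2)).
  move=> [s k] [s' k'] [] E ->; congr pair.
  by rewrite -[s](tactKV h) E tactKV.
move=> [MM' M'M]; split; apply/funext => i; apply/funext => j.
  have := congr1 (fun F => F (tact h^-1%g i.1, i.2) (tact h^-1%g j.1, j.2)) MM'.
  rewrite /fmul /fid /= => ->; congr (nat_of_bool _)%:R.
  exact: (inj_eq inj i j).
rewrite -M'M /fmul /rho /rhoi [RHS](reindex (fun i : S * K => (tact h^-1%g i.1, i.2)))//=.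
exists (fun i : S * K => (tact h i.1, i.2)) => -[s k] _ /=.
  by rewrite tactKV.
by rewrite tactK.
Qed.

Section conjugation.
Variables (d : nat) (K : finType) (N : X -> R -> T -> @fmat R (S * K)%type)
  (N0 : X -> @fmat R (S * K)%type) (C : T -> @fmat R (S * K)%type).
Variables (A A' : T -> R -> @fmat R (T * bool)%type).
Hypothesis N_sm : forall h i j, psm2 p (dom d) (fun x s => N x s h i j).
Hypothesis N_0 : forall h x, dom d x -> N x 0 h = N0 x.
Hypothesis N_1 : forall h x, N x 1 h = C h.
Hypothesis A_sm : forall a, smooth_path (A a).
Hypothesis A'_sm : forall a, smooth_path (A' a).
Hypothesis AA' : forall a t, finverse (A a t) (A' a t).
Hypothesis A_1 : forall a, A a 1 = fid.

Let sig x := st (ratio d x).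

(** The blocks are the translates of the given frame by all [h], and the conjugating path is to
    start at the permutation taking [h] to [g d x * h], which makes the result equivariant at
    [s = 0]. The two clocks do not overlap: [st (2 * s)] has reached 1 at [s = 1/3], before [st s]
    leaves 0. The parameter of [N] starts at [sig x], which is 0 where only the old frame is
    available and 1 where only [g d] is. *)
Definition conj_block (x : X) (s : R) : @fmat R (S * (K * (T * bool)))%type :=
  fmul (fibremx (A' (g d x) (st (2 * s))))
    (fmul (bdiag (fun q => N x (sig x + st s * (1 - sig x)) q.1))
          (fibremx (A (g d x) (st (2 * s))))).

(** Up to [s = 1/3] all blocks equal [N0 x], and such a matrix commutes with the conjugating one;
    afterwards the path is at the identity. Thus [g d x] disappears from the formula where nothing
    is known about it. *)
Lemma conj_block_near0 x s : dom d x -> sig x = 0 ->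
  conj_block x s = bdiag (fun q => N x (st s) q.1).
Proof.
move=> dx s0; rewrite /conj_block s0 subr0 mulr1 add0r.
have [hs|hs] := leP s 3^-1.
  rewrite (st_le hs).
  have -> : (fun q : T * bool => N x 0 q.1) = (fun=> N0 x).
    by apply/funext => q; rewrite N_0.
  rewrite bdiag_comm fmulA fibremxM.
  by have [_ ->] := AA' (g d x) (st (2 * s)); rewrite fibremx1 fmul1m.
have -> : st (2 * s) = 1 by apply: st_ge; lra.
rewrite A_1; have -> : A' (g d x) 1 = fid.
  by have [+ _] := AA' (g d x) 1; rewrite A_1 fmul1m.
by rewrite fibremx1 fmul1m fmulm1.
Qed.

Lemma conj_block_sm i j : psm2 p (dom d.+1) (fun x s => conj_block x s i j).
Proof.
move=> n U xi s oU pxi Dxi ss.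
have st' r : sm U (fun z => tau r (xi z)) by exact: (tau_sm r).
have sts : sm U (fun z => tsum d (xi z)) by apply: sm_sum => // r _; exact: st'.
have sr : sm U (fun z => ratio d (xi z)).
  apply: smM => //; apply: smV => // [z Uz|]; last exact: smD.
  exact/domS/Dxi.
have s2 : sm U (fun z => st (2 * s z)).
  by apply: sm_st => //; apply: smM => //; exact: sm_cst.
have oneq : open [set t : R | t != 0] by exact: open_neq.
apply: sm_local => z0 Uz0.
(* At a zero of [tau d] nothing controls [g d], but [sig] vanishes in a neighbourhood. *)
have [t0|t0] := eqVneq (tau d (xi z0)) 0.
  pose V := (U `&` (fun z => ratio d (xi z)) @^-1` [set t | t < 3^-1]) `&`
            (U `&` (fun z => tsum d (xi z)) @^-1` [set t | t != 0]).
  have oV : open V.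
    by apply: openI; apply: open_preim => //; exact: open_lt.
  have VU : V `<=` U by move=> z [[]].
  exists V; split=> //.
    split; split=> //=; first by rewrite /ratio t0 mul0r invr_gt0.
    by have /domS := Dxi _ Uz0; rewrite t0 add0r.
  apply: (@sm_ext _ _ _ oV
    (fun z => @bdiag R S K (T * bool)%type (fun q => N (xi z) (st (s z)) q.1) i j)).
    move=> z [[_ /= rz] [_ /= /tsum_neq0 dz]]; rewrite conj_block_near0//.
    by rewrite /sig st_le// ltW.
  apply: smM => //; first exact: sm_cst.
  apply: N_sm => //; first exact: plotS pxi.
    by move=> z [_ [_ /tsum_neq0]].
  by apply: sm_st => //; exact: sm_sub ss.
have [W [oW Wz0] Wg] : exists2 W, open_nbhs z0 W & W `<=` [set z | g d (xi z) = g d (xi z0)].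
  have : nbhs z0 [set z | g d (xi z) = g d (xi z0)] := g_loc oU pxi Uz0 t0.
  by rewrite nbhsE => -[W ? ?]; exists W.
have smA (V : set 'rV[R]_n) (D : 'rV[R]_n -> T * bool -> @fmat R (S * K)%type) :
    open V -> V `<=` U -> V `<=` W ->
    (forall q i j, sm V (fun z => D z q i j)) ->
    (forall z, V z -> bdiag (fun q => N (xi z) (sig (xi z) + st (s z) * (1 - sig (xi z))) q.1)
       = bdiag (D z)) -> sm V (fun z => conj_block (xi z) (s z) i j).
  move=> oV VU VW sD E.
  apply: (@sm_ext _ _ _ oV (fun z => fmul (fibremx (A' (g d (xi z0)) (st (2 * s z))))
    (fmul (bdiag (D z)) (fibremx (A (g d (xi z0)) (st (2 * s z))))) i j)).
    by move=> z Vz; rewrite /conj_block E// (Wg _ (VW _ Vz)).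
  apply: sm_fmul => // [i' j'|].
    apply: smM => //; first exact: sm_cst.
    by apply: A'_sm => //; exact: sm_sub s2.
  apply: sm_fmul => // i' j'.
    by apply: smM => //; first exact: sm_cst.
  apply: smM => //; first exact: sm_cst.
  by apply: A_sm => //; exact: sm_sub s2.
(* Here the old frame is missing, but [sig] is 1 nearby, so only the constant blocks [C] occur. *)
have [u0|u0] := eqVneq (tsum d (xi z0)) 0.
  pose V := (U `&` (fun z => ratio d (xi z)) @^-1` [set t | 2 / 3 < t]) `&` W.
  have oV : open V by apply: openI => //; apply: open_preim => //; exact: open_gt.
  exists V; split=> //.
    by split=> //; split=> //=; rewrite /ratio u0 addr0 divff//; lra.
  apply: (smA _ (fun _ q => C q.1)) => //.
  - by move=> z [[]].
  - by move=> z [].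
  - by move=> q i' j'; exact: sm_cst.
  - move=> z [[_ /= rz] _]; congr bdiag; apply/funext => q.
    by rewrite /sig st_ge ?ltW// subrr mulr0 addr0 N_1.
pose V := (U `&` (fun z => tsum d (xi z)) @^-1` [set t | t != 0]) `&` W.
have oV : open V by apply: openI => //; apply: open_preim.
have VU : V `<=` U by move=> z [[]].
exists V; split=> //.
apply: (smA _ (fun z q => N (xi z) (sig (xi z) + st (s z) * (1 - sig (xi z))) q.1)) => //.
  by move=> z [].
move=> q i' j'; apply: N_sm => //; first exact: plotS pxi.
  by move=> z [[_ /= /tsum_neq0]].
have ssig : sm V (fun z => sig (xi z)) by apply: sm_st => //; exact: sm_sub sr.
apply: smD => //; apply: smM => //.
  by apply: sm_st => //; exact: sm_sub ss.
by apply: smB => //; exact: sm_cst.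
Qed.

End conjugation.

(* [u x = nu x 0] trivialises the bundle [X x R^(S x K)]; [nu] contracts it,
   non-equivariantly, to the constant [C]. *)
Definition trivialised (d : nat) := exists (K : finType)
  (nu nu' : X -> R -> @fmat R (S * K)%type) (C C' : @fmat R (S * K)%type),
  [/\ (0 < #|K|)%N,
      forall i j, psm2 p (dom d) (fun x s => nu x s i j) /\
                  psm2 p (dom d) (fun x s => nu' x s i j),
      forall x s, dom d x -> finverse (nu x s) (nu' x s),
      (forall x, nu x 1 = C /\ nu' x 1 = C') /\ finverse C C' &
      forall t x s k j, dom d x ->
        nu (act t x) 0 (tact t s, k) j = nu x 0 (s, k) j].

Lemma trivialised0 : trivialised 0.
Proof.
exists unit, (fun _ _ => fid), (fun _ _ => fid), fid, fid; split=> //.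
- by rewrite card_unit.
- by move=> i j; split=> n U xi s oU _ _ _; exact: sm_cst.
- by move=> x s _; exact: finverse1.
- by split=> //; exact: finverse1.
- by move=> t x s k j [].
Qed.

Lemma trivialisedS d : trivialised d -> trivialised d.+1.
Proof.
move=> [K [nu [nu' [C [C' [K0 nus nuV [nuC CC'] nuE]]]]]].
have domC a x : dom d x -> dom d (act a x) by exact: dom_inv.
pose N x s h := rho h (nu (act h^-1%g x) s).
pose N' x s h := rhoi h (nu' (act h^-1%g x) s).
pose Cd h := rho h C; pose Cd' h := rhoi h C'.
have N_sm h i j : psm2 p (dom d) (fun x s => N x s h i j).
  move=> n U xi s oU pxi Dxi ss; apply: (nus _ _).1 => //; first exact: act_plot.
  by move=> z Uz; apply/domC/Dxi.
have N'_sm h i j : psm2 p (dom d) (fun x s => N' x s h i j).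
  move=> n U xi s oU pxi Dxi ss; apply: (nus _ _).2 => //; first exact: act_plot.
  by move=> z Uz; apply/domC/Dxi.
have N_0 h x : dom d x -> N x 0 h = nu x 0.
  move=> dx; apply/funext => -[s k]; apply/funext => j; rewrite /N /rho /=.
  by rewrite nuE.
have NN'0 h x s : dom d x -> finverse (N x s h) (N' x s h).
  by move=> dx; apply/rho_inverse/nuV/domC.
have N'_0 h x : dom d x -> N' x 0 h = nu' x 0.
  move=> dx; have := NN'0 h x 0 dx; rewrite N_0// => H.
  by apply: (finverse_unique H); exact: nuV.
have N_1 h x : N x 1 h = Cd h by rewrite /N (nuC _).1.
have N'_1 h x : N' x 1 h = Cd' h by rewrite /N' (nuC _).2.
have CdV h : finverse (Cd h) (Cd' h) by exact: rho_inverse.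
have inj a : injective (fun h : T => (a * h)%g) by exact: mulgI.
have /choice[A /choice[A' HA]] : forall a : T, exists A : R -> fmat (T * bool)%type,
    exists A' : R -> fmat (T * bool)%type, [/\ smooth_path A, smooth_path A',
      forall t, finverse (A t) (A' t), A 0 = pmat (fun h => (a * h)%g) & A 1 = fid].
  move=> a; have [A [A' [? ? ? A0 ?]]] := @perm_path R T (perm (@mulgI _ a)).
  exists A, A'; split=> //; rewrite A0; congr pmat; apply/funext => h.
  by rewrite permE.
have A_sm a : smooth_path (A a) by case: (HA a).
have A'_sm a : smooth_path (A' a) by case: (HA a).
have AA' a t : finverse (A a t) (A' a t) by case: (HA a).
have A_0 a : A a 0 = pmat (fun h => (a * h)%g) by case: (HA a).
have A_1 a : A a 1 = fid by case: (HA a).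
pose sig x := st (ratio d x).
have NN' x s h : dom d.+1 x ->
    finverse (N x (sig x + st s * (1 - sig x)) h) (N' x (sig x + st s * (1 - sig x)) h).
  move=> /domS dx; have [u0|/tsum_neq0/NN'0//] := eqVneq (tsum d x) 0.
  have -> : sig x = 1.
    rewrite /sig /ratio u0 addr0 divff ?st_ge//; first lra.
    by move: dx; rewrite u0 addr0.
  by rewrite subrr mulr0 addr0 N_1 N'_1.
(* One block for each translate, doubled so that the path of [perm_path] is available. *)
exists (K * (T * bool))%type, (@conj_block d K N A A'), (@conj_block d K N' A A').
exists (bdiag (fun q : T * bool => Cd q.1)), (bdiag (fun q : T * bool => Cd' q.1)).
split.
- by rewrite !card_prod card_bool !muln_gt0 K0/= andbT; apply/card_gt0P; exists 1%g.
- move=> i j; split.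
    exact: (@conj_block_sm d K N (fun x => nu x 0) Cd).
  exact: (@conj_block_sm d K N' (fun x => nu' x 0) Cd').
- move=> x s dx; rewrite /conj_block.
  set L := fibremx (A _ _); set L' := fibremx (A' _ _).
  have LL' : finverse L L' by apply: fibremx_inverse; exact: AA'.
  rewrite [X in finverse _ X]fmulA.
  apply: finverseM; first exact: finverseC.
  apply: finverseM => //; apply: bdiag_inverse => q; exact: NN'.
- split; last by apply: bdiag_inverse => q; exact: CdV.
  move=> x; rewrite /conj_block.
  have -> : st (1 : R) = 1 by apply: st_ge; lra.
  have -> : st (2 * 1 : R) = 1 by apply: st_ge; lra.
  rewrite mul1r addrCA subrr addr0 A_1.
  have -> : A' (g d x) 1 = fid.
    by have [+ _] := AA' (g d x) 1; rewrite A_1 fmul1m.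
  rewrite fibremx1 !fmul1m !fmulm1; split; congr bdiag; apply/funext => q.
    exact: N_1.
  exact: N'_1.
have conj0 x : @conj_block d K N A A' x 0 =
    bdiag (fun q : T * bool => N x (sig x) (g d x * q.1)%g).
  rewrite /conj_block mulr0 (@st_le _ 0) ?invr_ge0// mul0r addr0 A_0.
  rewrite (bdiag_pmat (N x (sig x))) -A_0 fmulA fibremxM.
  by have [_ ->] := AA' (g d x) 0; rewrite fibremx1 fmul1m.
move=> t x s k j dx; rewrite !conj0 /bdiag /fibre_idx /base_idx/=; congr (_ * _).
have sigt : sig (act t x) = sig x by rewrite /sig /ratio tau_inv tsum_inv.
rewrite sigt; have [t0|t0] := eqVneq (tau d x) 0.
  have dx' : dom d x by move/domS: dx; rewrite t0 add0r => /tsum_neq0.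
  have -> : sig x = 0 by rewrite /sig /ratio t0 mul0r st_le// invr_ge0.
  by rewrite !N_0// ?nuE//; exact: domC.
rewrite g_equiv// /N /rho/= -actM -tactM -mulgA invMg -mulgA mulVg mulg1.
by [].
Qed.

Lemma trivialised_all d : trivialised d.
Proof. by elim: d => [|d]; [exact: trivialised0|exact: trivialisedS]. Qed.

End equivariant_trivialisation.

(** * Equivariant maps to the group from separating functions *)

Section free_action.
Context {R : realType} {X : Type} (p : plots R X).
Context {T : finGroupType} (act : T -> X -> X).
Context {S : finType} (tact : T -> S -> S) {J : finType} (kap : J -> X -> R).
Hypothesis act1 : forall x, act 1%g x = x.
Hypothesis actM : forall a b x, act (a * b)%g x = act a (act b x).
Hypothesis act_plot : forall a n (U : set 'rV[R]_n) xi,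
  open U -> plot p U xi -> plot p U (fun z => act a (xi z)).
Hypothesis tact1 : forall s, tact 1%g s = s.
Hypothesis tactM : forall a b s, tact (a * b)%g s = tact a (tact b s).
Hypothesis kap_sm : forall j, psm p setT (kap j).
Hypothesis kap_sep : forall x y, (forall j, kap j x = kap j y) -> x = y.

Definition free_point (x : X) := forall t : T, act t x = x -> t = 1%g.

(* Points of the moment curve, any [#|J|] of which are independent. *)
Let lam (r : nat) x := \sum_j kap j x * r%:R ^+ enum_rank j.
Let tau r x := \prod_(t : T) \prod_(t' | t' != t)
  (lam r (act t x) - lam r (act t' x)) ^+ 2.
(** Where [tau r x != 0] the values of [lam r] on the orbit are distinct; the orbit is based at its
    point of largest value, and [g r x] is the element that carries this point to [x]. *)
Let g (r : nat) x : T := [arg max_(t > 1%g) lam r (act t^-1%g x)]%O.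

Let lam_sm r : psm p setT (lam r).
Proof.
move=> n U xi oU pxi _; apply: sm_sum => // j _; apply: smM => //; last exact: sm_cst.
exact: kap_sm.
Qed.

Let tau_neq0 r x : tau r x != 0 -> forall t t', t != t' ->
  lam r (act t x) != lam r (act t' x).
Proof.
move=> h t t' tt'; apply: contraNneq h => E; apply/eqP.
rewrite /tau (bigD1 t)//= (bigD1 t')/=; last by rewrite eq_sym.
by rewrite E subrr expr0n/= !mul0r.
Qed.

Let gP r x t : tau r x != 0 -> t != g r x ->
  lam r (act t^-1%g x) < lam r (act (g r x)^-1%g x).
Proof.
move=> h tg; rewrite lt_neqAle tau_neq0//=; last by rewrite (inj_eq invg_inj).
by rewrite /g; case: arg_maxP => //= i _; apply.
Qed.

Let g_unique r x a : (forall t, t != a -> lam r (act t^-1%g x) < lam r (act a^-1%g x)) ->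
  g r x = a.
Proof.
move=> h; apply/eqP; rewrite -[_ == _]negbK; apply/negP => /h; rewrite ltNge => /negP; apply.
by rewrite /g; case: arg_maxP => //= i _; apply.
Qed.

Lemma free_trivialisation : exists (K : finType)
  (nu nu' : X -> R -> @fmat R (S * K)%type) (C C' : @fmat R (S * K)%type),
  [/\ (0 < #|K|)%N,
      forall i j, psm2 p free_point (fun x s => nu x s i j) /\
                  psm2 p free_point (fun x s => nu' x s i j),
      forall x s, free_point x -> finverse (nu x s) (nu' x s),
      (forall x, nu x 0 = C /\ nu' x 0 = C') /\ finverse C C' &
      forall t x s k j, free_point x ->
        nu (act t x) 1 (tact t s, k) j = nu x 1 (s, k) j].
Proof.
(* At a free point the differences of [lam r] along the orbit are values at [r] of nonzero
   polynomials, whose product has size at most [R0]; hence one of the first [R0] integers is not a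
   root. *)
pose R0 := (#|T| * #|T| * #|J|).+1.
have tau_ge0 r x : 0 <= tau r x.
  by apply: prodr_ge0 => t _; apply: prodr_ge0 => t' _; exact: sqr_ge0.
have tau_sm r : psm p setT (tau r).
  move=> n U xi oU pxi _; apply: sm_prod => // t _; apply: sm_prod => // t' _.
  by apply: smX => //; apply: smB => //; apply: lam_sm => //; exact: act_plot.
have tau_inv r a x : tau r (act a x) = tau r x.
  rewrite /tau [RHS](reindex_inj (mulIg a))/=; apply: eq_bigr => t _.
  rewrite [RHS](reindex_inj (mulIg a))/=; apply: eq_big => [t'|t' _].
    by rewrite (inj_eq (mulIg a)).
  by rewrite !actM.
have g_equiv r a x : tau r x != 0 -> g r (act a x) = (a * g r x)%g.
  move=> h; apply: g_unique => t ht; rewrite -!actM invMg mulgKV.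
  rewrite -[t in lam _ (act (t^-1 * a)%g _)](mulKVg a) invMg mulgKV.
  by apply: gP => //; apply: contra ht => /eqP <-; rewrite mulKVg.
have g_loc r n (U : set 'rV[R]_n) xi z : open U -> plot p U xi -> U z ->
    tau r (xi z) != 0 -> \forall z' \near z, g r (xi z') = g r (xi z).
  move=> oU pxi Uz h; pose a := g r (xi z).
  have H (t : T) : \forall z' \near z, t != a ->
      lam r (act t^-1%g (xi z')) < lam r (act a^-1%g (xi z')).
    have [->|ta] := eqVneq t a; first by near=> z'.
    have s1 t' : sm U (fun z => lam r (act t' (xi z))).
      by apply: lam_sm => //; exact: act_plot.
    have s2 : sm U (fun z => lam r (act a^-1%g (xi z)) - lam r (act t^-1%g (xi z))).
      exact: smB.
    have o2 := open_preim oU s2 (@open_gt R 0).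
    have : nbhs z (U `&` [set z | 0 < lam r (act a^-1%g (xi z)) - lam r (act t^-1%g (xi z))]).
      by apply: open_nbhs_nbhs; split=> //; split=> //=; rewrite subr_gt0; exact: gP.
    by apply: filterS => z' [_ /=]; rewrite subr_gt0.
  have H' : \forall z' \near z, forall t : T, t != a ->
      lam r (act t^-1%g (xi z')) < lam r (act a^-1%g (xi z')).
    exact: (@filter_forall _ _ (fun t z' => t != a ->
      lam r (act t^-1%g (xi z')) < lam r (act a^-1%g (xi z'))) (nbhs z)).
  by near=> z'; apply: g_unique; near: z'.
have freeP x : free_point x -> exists2 r, (r < R0)%N & tau r x != 0.
  move=> fx; pose q t t' : {poly R} :=
    \sum_j (kap j (act t x) - kap j (act t' x)) *: 'X^(enum_rank j).
  have qE t t' r : (q t t').[r%:R] = lam r (act t x) - lam r (act t' x).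
    rewrite /q horner_sum -sumrB; apply: eq_bigr => j _.
    by rewrite hornerZ hornerXn mulrBl.
  have q0 t t' : t' != t -> q t t' != 0.
    move=> tt'; apply/eqP => q0; move/eqP: tt'; apply.
    have E : act t x = act t' x.
      apply: kap_sep => j; apply/eqP; rewrite -subr_eq0; apply/eqP.
      have := congr1 (fun q : {poly R} => q`_(enum_rank j)) q0.
      rewrite coef0 coef_sum (bigD1 j)//= big1 => [|i ij].
        by rewrite addr0 coefZ coefXn eqxx mulr1.
      rewrite coefZ coefXn; case: eqP => [/val_inj/enum_rank_inj ji|_].
        by rewrite ji eqxx in ij.
      by rewrite mulr0.
    have := fx (t^-1 * t')%g; rewrite actM -E -actM mulVg act1 => /(_ erefl) h.
    by rewrite -[t'](mulKVg t) h mulg1.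
  pose Q := \prod_(tt : T * T | tt.2 != tt.1) q tt.1 tt.2.
  have Q0 : Q != 0 by apply/prodf_neq0 => -[t t'] /=; exact: q0.
  have szq t t' : (size (q t t') <= #|J|)%N.
    apply/leq_sizeP => k kJ; rewrite coef_sum big1// => j _; rewrite coefZ coefXn.
    by rewrite gtn_eqF ?mulr0// (leq_trans (ltn_ord _) kJ).
  have szQ : (size Q <= R0)%N.
    apply: leq_trans (size_poly_prod_leq _ _) _.
    rewrite (leq_trans (leq_subr _ _))// ltnS.
    apply: (@leq_trans (\sum_(tt : T * T | tt.2 != tt.1) #|J|)).
      exact: leq_sum.
    by rewrite sum_nat_const leq_mul2r -card_prod max_card orbT.
  apply: contrapT => H.
  suff : (size [seq r%:R : R | r <- iota 0 R0] < size Q)%N.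
    by rewrite size_map size_iota ltnNge szQ.
  apply: max_poly_roots => //; last first.
    by rewrite map_inj_uniq ?iota_uniq//; exact: (mulrIn (oner_neq0 R)).
  apply/allP => _ /mapP[r + ->]; rewrite mem_iota /= add0n => rR.
  have : tau r x = 0 by apply/eqP; rewrite -[_ == _]negbK; apply/negP => ?; apply: H; exists r.
  rewrite /root /Q horner_prod /tau pair_big_dep/= => /eqP.
  by rewrite !prodf_seq_eq0 => /hasP[[t t'] _ /= /andP[tt]]; rewrite sqrf_eq0 => h;
    apply/hasP; exists (t, t'); rewrite ?mem_index_enum//= tt qE.
have [K [nu [nu' [C [C' [K0 nus nuV [nuC CC'] nuE]]]]]] :=
  @trivialised_all R X p T act S tact tau g actM act_plot tact1 tactM
    tau_sm tau_ge0 tau_inv g_equiv g_loc R0.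
(* The homotopy is reversed: constant at 0, equivariant at 1. *)
exists K, (fun x s => nu x (1 - s)), (fun x s => nu' x (1 - s)), C, C'; split=> //.
- move=> i j; have [h h'] := nus i j.
  split=> n U xi s oU pxi Dxi ss; [apply: (h _ _ _ (fun z => 1 - s z)) => //
      |apply: (h' _ _ _ (fun z => 1 - s z)) => //].
  + by move=> z /Dxi/freeP.
  + by apply: smB => //; exact: sm_cst.
  + by move=> z /Dxi/freeP.
  + by apply: smB => //; exact: sm_cst.
- by move=> x s /freeP; exact: nuV.
- by rewrite subr0.
- by move=> t x s k j /freeP dx; rewrite subrr nuE.
Unshelve. all: by end_near. Qed.

End free_action.

(** * Frames of kernels *)


Section kernel_frame.
Context {R : realType}.

Lemma mul_tr_sqnorm n (x : 'rV[R]_n) : x *m x^T = (sqnorm x)%:M.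
Proof.
apply/matrixP => i j; rewrite !ord1 mxE [RHS]mxE eqxx mulr1n.
by apply: eq_bigr => k _; rewrite mxE expr2.
Qed.

Lemma sqnorm_eq0 n (x : 'rV[R]_n) : (sqnorm x == 0) = (x == 0).
Proof.
rewrite /sqnorm psumr_eq0 => [|i _]; last exact: sqr_ge0.
apply/idP/eqP => [/allP h|->]; last by apply/allP => i _; rewrite mxE expr0n eqxx.
apply/rowP => i; have := h i (mem_index_enum i).
by rewrite /= sqrf_eq0 mxE => /eqP.
Qed.

Section one_row.
Context {d : nat} (Q : 'M[R]_(1 + d)) (f : 'rV[R]_(1 + d)).

Let h := f *m Q.
Let g0 : R := h 0 (lshift d ord0).
Let g := rsubmx h.
Let beta := (1 + g0) / sqnorm g.

(** In the coordinates given by [Q] the row is [(g0 | g)]. The map from [y] to the pair of [g y] and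
    [y - beta (g y) g^T] lands in its kernel because [beta * sqnorm g = 1 + g0], and the row of
    blocks [(beta g^T | 1)] undoes it. The formula is global and smooth as long as [g] does not
    vanish. *)
Definition row_ker : 'M[R]_(1 + d, d) :=
  Q *m col_mx g (1%:M - beta *: (g^T *m g)).
Definition row_ker_inv : 'M[R]_(d, 1 + d) :=
  row_mx (beta *: g^T) 1%:M *m invmx Q.

Hypothesis Qu : Q \in unitmx.
Hypothesis gn0 : g != 0.

Let hE : h = row_mx (g0%:M) g.
Proof.
rewrite -[LHS]hsubmxK; congr row_mx; apply/rowP => i; rewrite ord1 !mxE eqxx mulr1n.
by rewrite /g0 /h !mxE.
Qed.

Let betaE : beta * sqnorm g = 1 + g0.
Proof. by rewrite divfK// sqnorm_eq0. Qed.

Lemma row_kerP : f *m row_ker = 0.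
Proof.
rewrite /row_ker mulmxA -/h hE mul_row_col mulmxBr mulmx1 -scalemxAr mulmxA.
rewrite mul_tr_sqnorm !mul_scalar_mx scalerA betaE scalerDl scale1r.
by rewrite opprD (addrA g) subrr add0r subrr.
Qed.

Lemma row_ker_invK : row_ker_inv *m row_ker = 1%:M.
Proof.
rewrite /row_ker_inv /row_ker mulmxA mulmxKV// mul_row_col mul1mx.
by rewrite -scalemxAl addrC subrK.
Qed.

Lemma row_kerK k (y : 'M[R]_(1 + d, k)) : f *m y = 0 ->
  row_ker *m (row_ker_inv *m y) = y.
Proof.
move=> fy; rewrite /row_ker /row_ker_inv -!mulmxA.
set x := invmx Q *m y; have yE : y = Q *m x by rewrite mulKVmx.
rewrite [RHS]yE; congr (Q *m _).
have : row_mx g0%:M g *m x = 0 by rewrite -hE /h -mulmxA -yE.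
rewrite -[x]vsubmxK; move: (usubmx x) (dsubmx x) => x0 x1.
rewrite !mul_row_col mul1mx mul_scalar_mx => gx.
have e1 : g *m (beta *: g^T *m x0 + x1) = x0.
  rewrite mulmxDr -scalemxAl -scalemxAr mulmxA mul_tr_sqnorm mul_scalar_mx scalerA.
  by rewrite betaE scalerDl scale1r -addrA gx addr0.
rewrite mul_col_mx e1; congr col_mx.
set q := (X in _ *m X); rewrite -/q in e1.
rewrite mulmxBl mul1mx -scalemxAl -mulmxA e1 /q scalemxAl.
by rewrite addrAC subrr add0r.
Qed.

End one_row.

Lemma sm_row_ker d (Q : 'M[R]_(1 + d)) n (U : set 'rV[R]_n) (f : 'rV[R]_n -> 'rV[R]_(1 + d)) :
  open U -> (forall j, sm U (fun z => f z 0 j)) ->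
  (forall z, U z -> rsubmx (f z *m Q) != 0) ->
  (forall i j, sm U (fun z => row_ker Q (f z) i j)) /\
  (forall i j, sm U (fun z => row_ker_inv Q (f z) i j)).
Proof.
move=> oU fs fn0.
have cs (p q : nat) (A : 'M[R]_(p, q)) i j : sm U (fun=> A i j) by exact: sm_cst.
have hs i j : sm U (fun z => (f z *m Q) i j).
  by apply: sm_mulmx => // i' j'; rewrite ord1.
have gs i j : sm U (fun z => rsubmx (f z *m Q) i j).
  by apply: sm_ext (hs i (rshift 1 j)) => // z _; rewrite [RHS]mxE.
have gts i j : sm U (fun z => (rsubmx (f z *m Q))^T i j).
  by apply: sm_ext (gs j i) => // z _; rewrite [RHS]mxE.
have bs : sm U (fun z => (1 + (f z *m Q) 0 (lshift d ord0)) / sqnorm (rsubmx (f z *m Q))).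
  apply: smM => //; first by apply: smD => //; exact: sm_cst.
  apply: smV => // [z /fn0|]; first by rewrite sqnorm_eq0.
  by apply: sm_sqnorm.
split.
  apply: sm_mulmx => // i j; case: (split_ordP i) => i' ->.
    by apply: sm_ext (gs i' j) => // z _; rewrite col_mxEu.
  apply: (@sm_ext _ _ _ oU (fun z => (1%:M : 'M[R]_d) i' j -
      (1 + (f z *m Q) 0 (lshift d ord0)) / sqnorm (rsubmx (f z *m Q)) *
      ((rsubmx (f z *m Q))^T *m rsubmx (f z *m Q)) i' j)).
    by move=> z _; rewrite col_mxEd [RHS]mxE [X in _ = _ + X]mxE [X in _ = _ - X]mxE.
  by apply: smB => //; apply: smM => //; apply: sm_mulmx.
apply: sm_mulmx => // i j; case: (split_ordP j) => j' ->; last first.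
  by apply: sm_ext (cs _ _ (1%:M : 'M[R]_d) i j') => // z _; rewrite row_mxEr.
apply: sm_ext (smM oU bs (gts i j')) => // z _.
by rewrite row_mxEl [RHS]mxE.
Qed.

(** A vector [J] outside all the lines spanned by the [f z] is found by avoiding [t *: f z] over the
    [N + 1] parameters [(z, t)]. The matrix [Q] then brings [J] to the first axis, so that
    [rsubmx (f z *m Q) = 0] would make [f z] proportional to [J]. *)
Lemma generic_direction N d (Z : set 'rV[R]_N) (f : 'rV[R]_N -> 'rV[R]_(1 + d)) :
  (N < d)%N -> open Z -> (forall j, sm Z (fun z => f z 0 j)) ->
  (forall z, Z z -> f z != 0) -> exists2 Q : 'M[R]_(1 + d), Q \in unitmx &
  forall z, Z z -> rsubmx (f z *m Q) != 0.
Proof.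
move=> Nd oZ fs f0.
have [Zn|Ze] := pselect (Z !=set0); last first.
  by exists 1%:M; rewrite ?unitmx1// => z Zz; case: Ze; exists z.
pose Z' : set 'rV[R]_(N + 1) := lsubmx @^-1` Z.
have oZ' : open Z' by apply: open_comp => // x _; exact: continuous_lsubmx.
have [|||||J HJ] := @generic_avoidance R (N + 1) (1 + d) (1 + d) unit (fun=> Z')
    (fun _ _ => 1%:M) (fun _ w => rsubmx w 0 0 *: f (lsubmx w)).
- by rewrite addn1 add1n.
- by [].
- by move=> _ i j; exact: sm_cst.
- move=> _ l; apply: (@sm_ext _ _ _ oZ' (fun w => rsubmx w 0 0 * f (lsubmx w) 0 l)).
    by move=> w _; rewrite [RHS]mxE.
  apply: smM => //; last exact: (sm_lsub (fs l)).
  by apply: sm_ext (sm_coord (rshift N 0)) => // w _; rewrite [RHS]mxE.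
- by move=> _ w _; exists 1%:M; rewrite mulmx1.
have {}HJ z t : Z z -> J != t *: f z.
  move=> Zz; have := HJ tt (row_mx z (t%:M)).
  by rewrite /Z' /= !row_mxKl !row_mxKr mulmx1 mxE eqxx mulr1n; apply.
have J0 : J != 0 by have [z Zz] := Zn; have := HJ z 0 Zz; rewrite scale0r.
have rJ : \rank J = 1%N by rewrite rank_rV J0.
pose Q := invmx (row_ebase J).
have Qu : Q \in unitmx by rewrite unitmx_inv row_ebase_unit.
exists Q => //.
pose a := col_ebase J 0 0.
have JQ : J *m Q = a *: row_mx 1%:M 0.
  rewrite -{1}(mulmx_ebase J) /Q -!mulmxA mulmxV ?row_ebase_unit// mulmx1 rJ.
  rewrite [col_ebase J]mx11_scalar -/a mul_scalar_mx; congr (_ *: _).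
  apply/rowP => i; rewrite mxE; case: (split_ordP i) => j ->.
    by rewrite row_mxEl !mxE !ord1.
  by rewrite row_mxEr !mxE.
have a0 : a != 0.
  apply: contra J0 => /eqP a0; rewrite -(mulmxK Qu J).
  by rewrite JQ a0 scale0r mul0mx.
move=> z Zz; apply/negP => /eqP g0.
pose t := (f z *m Q) 0 (lshift d ord0).
have fQ : f z *m Q = (t / a) *: (J *m Q).
  rewrite JQ scalerA divfK// -[LHS]hsubmxK g0 scale_row_mx scaler0; congr row_mx.
  by apply/rowP => i; rewrite ord1 [LHS]mxE [RHS]mxE [1%:M _ _]mxE eqxx mulr1.
have fJ : f z = (t / a) *: J.
  apply: (can_inj (mulmxK Qu)).
  by rewrite fQ scalemxAl.
have t0 : t != 0 by apply: contraNneq (f0 z Zz) => t0; rewrite fJ t0 mul0r scale0r.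
have := HJ z (a / t) Zz; rewrite fJ scalerA.
have -> : a / t * (t / a) = 1 by field; rewrite t0 a0.
by rewrite scale1r eqxx.
Qed.

(* The dimension of the kernel exceeds that of the parameter space, so the
   kernel bundle is trivialised one row at a time. *)
Lemma kernel_frame N c n (Z : set 'rV[R]_N) (F : 'rV[R]_N -> 'M[R]_(c, c + n)) :
  (N < n)%N -> open Z -> (forall i j, sm Z (fun z => F z i j)) ->
  (forall z (v : 'rV[R]_c), Z z -> v *m F z = 0 -> v = 0) ->
  exists (Y : 'M[R]_(c, c + n) -> 'M[R]_(c + n, n))
         (L : 'M[R]_(c, c + n) -> 'M[R]_(n, c + n)),
  (forall z, Z z -> [/\ F z *m Y (F z) = 0, L (F z) *m Y (F z) = 1%:M &
     forall k (y : 'M[R]_(c + n, k)), F z *m y = 0 -> Y (F z) *m (L (F z) *m y) = y]) /\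
  (forall m (U : set 'rV[R]_m) (Phi : 'rV[R]_m -> 'M[R]_(c, c + n)), open U ->
     (forall i j, sm U (fun z => Phi z i j)) ->
     (forall z, U z -> (F @` Z) (Phi z)) ->
     (forall i j, sm U (fun z => Y (Phi z) i j)) /\
     (forall i j, sm U (fun z => L (Phi z) i j))).
Proof.
move=> Nn oZ; elim: c F => [|c IH] F Fs Finj.
  exists (fun=> 1%:M), (fun=> 1%:M); split=> [z _|m U Phi oU _ _].
    split=> [||k y _]; [by apply/matrixP => -[]|by rewrite mul1mx|by rewrite !mul1mx].
  by split=> i j; exact: sm_cst.
pose f z : 'rV[R]_(1 + (c + n)) := usubmx (F z : 'M[R]_(1 + c, 1 + (c + n))).
pose F2 z : 'M[R]_(c, 1 + (c + n)) := dsubmx (F z : 'M[R]_(1 + c, 1 + (c + n))).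
have FE z : F z = col_mx (f z) (F2 z) by rewrite vsubmxK.
have FM z k (y : 'M[R]_(1 + (c + n), k)) :
    F z *m y = col_mx (f z *m y) (F2 z *m y) :> 'M[R]_(1 + c, k).
  by rewrite -mul_col_mx -FE.
have fs j : sm Z (fun z => f z 0 j).
  apply: (@sm_ext _ _ _ oZ (fun z => (F z : 'M[R]_(1 + c, 1 + (c + n))) (lshift c 0) j)).
    by move=> z _; rewrite [RHS]mxE.
  exact: Fs.
have F2s i j : sm Z (fun z => F2 z i j).
  apply: (@sm_ext _ _ _ oZ (fun z => (F z : 'M[R]_(1 + c, 1 + (c + n))) (rshift 1 i) j)).
    by move=> z _; rewrite [RHS]mxE.
  exact: Fs.
have f0 z : Z z -> f z != 0.
  move=> Zz; apply/eqP => fz; have := Finj z (row_mx 1%:M 0) Zz.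
  rewrite FE (mul_row_col (1%:M : 'M[R]_1)) mul1mx mul0mx addr0 fz => /(_ erefl).
  move/(congr1 (fun P : 'rV[R]_(1 + c) => lsubmx P 0 0)); rewrite row_mxKl !mxE eqxx.
  by move/eqP; rewrite oner_eq0.
have [|Q Qu Qf] := generic_direction _ oZ fs f0.
  by rewrite (leq_trans Nn)// leq_addl.
pose F' z := F2 z *m row_ker Q (f z).
have [Ks Ls] := sm_row_ker oZ fs Qf.
have F's i j : sm Z (fun z => F' z i j) by exact: sm_mulmx.
(* If [v *m F' z = 0], then [v *m F2 z] vanishes on the kernel of [f z], hence is a multiple of
   [f z]: a linear relation between the rows of [F z]. *)
have F'inj z (v : 'rV[R]_c) : Z z -> v *m F' z = 0 -> v = 0.
  move=> Zz vF; pose w := v *m F2 z.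
  have wK : w *m row_ker Q (f z) = 0 by rewrite -mulmxA.
  have fz0 : sqnorm (f z) != 0 by rewrite sqnorm_eq0 f0.
  pose y0 := (sqnorm (f z))^-1 *: (f z)^T.
  have fy0 : f z *m y0 = 1%:M.
    by rewrite -scalemxAr mul_tr_sqnorm scale_scalar_mx mulVf.
  have wE : w = (w *m y0) *m f z.
    apply/eqP; rewrite -subr_eq0; apply/eqP.
    have fB : f z *m (1%:M - y0 *m f z) = 0.
      by rewrite mulmxBr mulmx1 mulmxA fy0 mul1mx subrr.
    have := row_kerK Qu (Qf z Zz) fB => E.
    have : w *m (1%:M - y0 *m f z) = 0 by rewrite -E mulmxA wK mul0mx.
    by rewrite mulmxBr mulmx1 mulmxA.
  have := Finj z (row_mx (- (w *m y0)) v) Zz.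
  rewrite FE (mul_row_col (- (w *m y0) : 'M[R]_1)) mulNmx -wE addNr => /(_ erefl).
  by move/(congr1 (fun P : 'rV[R]_(1 + c) => rsubmx P)); rewrite row_mxKr => ->; apply/rowP => i; rewrite !mxE.
have [Y [L [YL YLs]]] := IH F' F's F'inj.
pose u (P : 'M[R]_(c.+1, c.+1 + n)) : 'rV[R]_(1 + (c + n)) := usubmx (P : 'M[R]_(1 + c, 1 + (c + n))).
pose dn (P : 'M[R]_(c.+1, c.+1 + n)) : 'M[R]_(c, 1 + (c + n)) := dsubmx (P : 'M[R]_(1 + c, 1 + (c + n))).
(* The frame is a function of the matrix [P] and not of the point [z], so equal matrices receive
   equal frames. *)
exists (fun P => row_ker Q (u P) *m Y (dn P *m row_ker Q (u P))).
exists (fun P => L (dn P *m row_ker Q (u P)) *m row_ker_inv Q (u P)); split.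
  move=> z Zz; rewrite -/(f z) -/(F2 z) -/(F' z) /u /dn -/(f z) -/(F2 z) -/(F' z).
  have [Y1 Y2 Y3] := YL z Zz; have g0 := Qf z Zz; split.
  - by rewrite FM mulmxA row_kerP// mul0mx mulmxA Y1 (@col_mx0 _ 1 c).
  - by rewrite -mulmxA (mulmxA (row_ker_inv _ _)) row_ker_invK// mul1mx.
  - move=> k y Fy; have [fy F2y] : f z *m y = 0 /\ F2 z *m y = 0.
      by apply: (@eq_col_mx R 1 c); rewrite -FM Fy (@col_mx0 _ 1 c).
    have yE := row_kerK Qu g0 fy.
    have Ly : Y (F' z) *m (L (F' z) *m (row_ker_inv Q (f z) *m y)) = row_ker_inv Q (f z) *m y.
      by apply: Y3; rewrite /F' -mulmxA yE.
    by rewrite -[RHS]yE -[in RHS]Ly !mulmxA.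
move=> m U P oU Ps PZ.
have us j : sm U (fun z => u (P z) 0 j).
  apply: (@sm_ext _ _ _ oU (fun z => (P z : 'M[R]_(1 + c, 1 + (c + n))) (lshift c 0) j)).
    by move=> z _; rewrite [RHS]mxE.
  exact: Ps.
have ds i j : sm U (fun z => dn (P z) i j).
  apply: (@sm_ext _ _ _ oU (fun z => (P z : 'M[R]_(1 + c, 1 + (c + n))) (rshift 1 i) j)).
    by move=> z _; rewrite [RHS]mxE.
  exact: Ps.
have uQ z : U z -> rsubmx (u (P z) *m Q) != 0.
  by move=> /PZ[w Zw <-]; exact: Qf.
have [Ks' Ls'] := sm_row_ker oU us uQ.
have [||Ys' Lis'] := YLs m U (fun z => dn (P z) *m row_ker Q (u (P z))) oU.
- by apply: sm_mulmx.
- by move=> z /PZ[w Zw <-]; exists w.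
by split; apply: sm_mulmx.
Qed.

End kernel_frame.

(** * Linear actions and configurations *)


Section multiplicity.
Context {R : realType} {S K K' Q : finType} (b : K' -> K * Q).
Hypothesis bb : bijective b.

(* [fext M] is [M] tensored with the identity of [R^Q]. *)
Definition fext (M : @fmat R (S * K)%type) : @fmat R (S * K')%type := fun i j =>
  ((b i.2).2 == (b j.2).2)%:R * M (i.1, (b i.2).1) (j.1, (b j.2).1).

Lemma fextM M M' : fmul (fext M) (fext M') = fext (fmul M M').
Proof.
have [b' bK b'K] := bb.
apply/funext => i; apply/funext => j; rewrite /fmul.
rewrite (reindex (fun x : (S * K) * Q => (x.1.1, b' (x.1.2, x.2))))/=; last first.
  exists (fun x : S * K' => ((x.1, (b x.2).1), (b x.2).2)) => [[[s k] q]|[s k]] _ /=.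
    by rewrite b'K.
  by rewrite -surjective_pairing bK.
rewrite -(pair_bigA _ (fun p q => fext M i (p.1, b' (p.2, q)) * fext M' (p.1, b' (p.2, q)) j))/=.
rewrite exchange_big/= (bigD1 (b i.2).2)//= [X in _ + X]big1 ?addr0.
  rewrite /fext mulr_sumr; apply: eq_bigr => -[s k] _ /=; rewrite b'K/= eqxx mul1r.
  by rewrite mulrCA.
move=> q qi; rewrite big1// => p _; rewrite /fext/= b'K/= eq_sym (negbTE qi).
by rewrite !mul0r.
Qed.

Lemma fext1 : fext fid = fid.
Proof.
apply/funext => -[s k]; apply/funext => -[s' k']; rewrite /fext /fid -natrM mulnb/=.
congr (nat_of_bool _)%:R; rewrite !xpair_eqE -(inj_eq (bij_inj bb)).
by rewrite andbC -andbA -xpair_eqE -!surjective_pairing.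
Qed.

Lemma fext_inverse M M' : finverse M M' -> finverse (fext M) (fext M').
Proof. by move=> [h1 h2]; split; rewrite fextM ?h1 ?h2 fext1. Qed.

End multiplicity.

(** Every multiple of [K] serves as well as [K]; this is what allows the multiplicities of two
    different trivialisations to be made equal. *)
Lemma free_trivialisation_mult {R : realType} {X : Type} (p : plots R X)
    {T : finGroupType} (act : T -> X -> X) {S : finType} (tact : T -> S -> S)
    {J : finType} (kap : J -> X -> R) :
  (forall x, act 1%g x = x) -> (forall a b x, act (a * b)%g x = act a (act b x)) ->
  (forall a n (U : set 'rV[R]_n) xi, open U -> plot p U xi ->
    plot p U (fun z => act a (xi z))) ->
  (forall s, tact 1%g s = s) -> (forall a b s, tact (a * b)%g s = tact a (tact b s)) ->
  (forall j, psm p setT (kap j)) -> (forall x y, (forall j, kap j x = kap j y) -> x = y) ->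
  exists2 K : finType, (0 < #|K|)%N & forall (K' Q : finType) (b : K' -> K * Q),
    bijective b -> exists (nu nu' : X -> R -> @fmat R (S * K')%type)
      (C C' : @fmat R (S * K')%type),
  [/\ forall i j, psm2 p (free_point act) (fun x s => nu x s i j) /\
                  psm2 p (free_point act) (fun x s => nu' x s i j),
      forall x s, free_point act x -> finverse (nu x s) (nu' x s),
      (forall x, nu x 0 = C /\ nu' x 0 = C') /\ finverse C C' &
      forall t x s k j, free_point act x ->
        nu (act t x) 1 (tact t s, k) j = nu x 1 (s, k) j].
Proof.
move=> h1 h2 h3 h4 h5 h6 h7.
have [K [nu [nu' [C [C' [K0 nus nuV [nuC CC'] nuE]]]]]] :=
  free_trivialisation h1 h2 h3 h4 h5 h6 h7.
exists K => // K' Q b bb.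
exists (fun x s => fext b (nu x s)), (fun x s => fext b (nu' x s)), (fext b C), (fext b C').
split.
- move=> i j; split=> n U xi s oU pxi Dxi ss; apply: smM => //; try exact: sm_cst.
    exact: (nus _ _).1.
  exact: (nus _ _).2.
- by move=> x s fx; apply: fext_inverse => //; exact: nuV.
- split; last exact: fext_inverse.
  by move=> x; have [-> ->] := nuC x.
- by move=> t x s k j fx; rewrite /fext/= nuE.
Qed.

(** * Stabilisers, averages and orbits of a linear action *)

Section linear_action.
Context {R : realType} {gT : finGroupType} {N : nat} (A : gT -> 'M[R]_N).
Hypothesis A1 : A 1%g = 1%:M.
Hypothesis AM : forall g h, A (g * h)%g = A h *m A g.

Definition lact (g : gT) (x : 'rV[R]_N) := x *m A g.
Definition stab (x : 'rV[R]_N) : {set gT} := [set g | lact g x == x]%SET.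

Lemma lact1 x : lact 1%g x = x. Proof. by rewrite /lact A1 mulmx1. Qed.
Lemma lactM g h x : lact (g * h)%g x = lact g (lact h x).
Proof. by rewrite /lact AM mulmxA. Qed.
Lemma lactK g : cancel (lact g) (lact g^-1%g).
Proof. by move=> x; rewrite -lactM mulVg lact1. Qed.
Lemma lactB g x y : lact g (x - y) = lact g x - lact g y.
Proof. by rewrite /lact mulmxBl. Qed.

Lemma stab_group_set x : group_set (stab x).
Proof.
apply/group_setP; split=> [|g h]; rewrite !inE ?lact1// => /eqP gx /eqP hx.
by rewrite lactM hx gx.
Qed.

Canonical stab_group x := Group (stab_group_set x).

Lemma stab_lact g x h : (h \in stab (lact g x)) = ((g^-1 * h * g)%g \in stab x).
Proof.
rewrite !inE !lactM; apply/eqP/eqP => [->|]; first by rewrite lactK.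
by move=> /(congr1 (lact g)); rewrite -lactM mulgV lact1.
Qed.

Lemma card_stab_lact g x : #|stab (lact g x)| = #|stab x|.
Proof.
have -> : stab (lact g x) = (stab x :^ g^-1)%g.
  by apply/setP => h; rewrite stab_lact mem_conjgV conjgE mulgA.
exact: cardJg.
Qed.

Definition lin_plots : plots R 'rV[R]_N := @Plots R 'rV[R]_N
  (fun n (U : set 'rV[R]_n) xi => forall j, sm U (fun z => xi z 0 j))
  (fun n (U V : set 'rV[R]_n) xi VU h j => sm_sub VU (h j)).

Lemma sm_lact n (U : set 'rV[R]_n) xi g : open U -> plot lin_plots U xi ->
  plot lin_plots U (fun z => lact g (xi z)).
Proof.
move=> oU pxi j; apply: sm_mulmx => // [i k|i k]; first by rewrite ord1; exact: pxi.
exact: sm_cst.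
Qed.

Lemma sm_lact_sub n (U : set 'rV[R]_n) xi g : open U -> plot lin_plots U xi ->
  sm U (fun z => sqnorm (lact g (xi z) - xi z)).
Proof.
move=> oU pxi; apply: sm_sqnorm => // j.
have gs := sm_lact g oU pxi.
by apply: sm_ext (smB oU (gs j) (pxi j)) => // z _; rewrite !mxE.
Qed.

Lemma mem_stab g x : (g \in stab x) = (sqnorm (lact g x - x) == 0).
Proof. by rewrite inE sqnorm_eq0 subr_eq0. Qed.

Definition mobility (B : {set gT}) x := \prod_(g | g \notin B) sqnorm (lact g x - x).

Lemma mobility_neq0 B x : (mobility B x != 0) = (stab x \subset B).
Proof.
apply/prodf_neq0/fintype.subsetP => [h g gx|h g gB].
  by apply: contraTT gx => /h; rewrite mem_stab.
by rewrite -mem_stab; apply: contra gB => /h.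
Qed.

Lemma sm_mobility B n (U : set 'rV[R]_n) xi : open U -> plot lin_plots U xi ->
  sm U (fun z => mobility B (xi z)).
Proof. by move=> oU pxi; apply: sm_prod => // g _; exact: sm_lact_sub. Qed.

Lemma plot_id (U : set 'rV[R]_N) : plot lin_plots U id.
Proof. by move=> j; exact: sm_coord. Qed.

Lemma open_mobility (B : {set gT}) : open [set x : 'rV[R]_N | stab x \subset B].
Proof.
have := open_preim (@openT _) (sm_mobility B (@openT _) (@plot_id setT)) (@open_neq R 0).
congr open; apply/seteqP; split=> x /=; first by rewrite mobility_neq0 => -[].
by rewrite mobility_neq0.
Qed.

Lemma free_lact x : free_point lact x <-> stab x = 1%g.
Proof.
split=> [h|h g gx].
  by apply/setP => g; rewrite !inE; apply/eqP/eqP => [/h|->]; rewrite ?lact1.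
by have : g \in stab x by [rewrite inE gx]; rewrite h inE => /eqP.
Qed.

Lemma free_mobility x : free_point lact x <-> mobility 1%g x != 0.
Proof.
rewrite free_lact mobility_neq0; split=> [->//|h].
by apply/eqP; rewrite finset.eqEsubset h finset.sub1set group1.
Qed.

Definition avg (E : {set gT}) x : 'rV[R]_N := (#|E|%:R)^-1 *: \sum_(e in E) lact e x.

Lemma avg_id (E : {group gT}) x : E \subset stab x -> avg E x = x.
Proof.
move=> /fintype.subsetP Ex; rewrite /avg (eq_bigr (fun=> x)) => [|e /Ex]; last first.
  by rewrite inE => /eqP.
rewrite big_const iter_addr addr0 -(scaler_nat _ x) scalerA mulVf ?scale1r//.
by rewrite pnatr_eq0 -lt0n cardG_gt0.
Qed.

Lemma avg_stab (E : {group gT}) x : E \subset stab (avg E x).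
Proof.
apply/fintype.subsetP => e eE; rewrite inE; apply/eqP.
rewrite /avg /lact -scalemxAl mulmx_suml; congr (_ *: _).
rewrite [RHS](reindex_inj (mulgI e))/=; apply: eq_big => [h|h _].
  by rewrite groupMl.
exact/esym/lactM.
Qed.

Lemma sm_avg E n (U : set 'rV[R]_n) xi : open U -> plot lin_plots U xi ->
  plot lin_plots U (fun z => avg E (xi z)).
Proof.
move=> oU pxi j.
apply: (@sm_ext _ _ _ oU (fun z => (#|E|%:R)^-1 * \sum_(e in E) lact e (xi z) 0 j)).
  by move=> z _; rewrite mxE summxE.
apply: smM => //; first exact: sm_cst.
by apply: sm_sum => // e _; exact: sm_lact.
Qed.

Definition spread (E : {set gT}) x := sqnorm (avg E x - x).

Lemma spread_eq0 (E : {group gT}) x : (spread E x == 0) = (E \subset stab x).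
Proof.
rewrite /spread sqnorm_eq0 subr_eq0; apply/eqP/idP => [<-|]; first exact: avg_stab.
exact: avg_id.
Qed.

Lemma sm_spread E n (U : set 'rV[R]_n) xi : open U -> plot lin_plots U xi ->
  sm U (fun z => spread E (xi z)).
Proof.
move=> oU pxi; apply: sm_sqnorm => // j.
have gs := sm_avg E oU pxi.
by apply: sm_ext (smB oU (gs j) (pxi j)) => // z _; rewrite !mxE.
Qed.

Lemma mobility_ge0 B x : 0 <= mobility B x.
Proof. by apply: prodr_ge0 => g _; exact: sqnorm_ge0. Qed.

Section orbits.
Variables (a m : nat).
Hypothesis cardG : (a * m)%N = #|gT|.

Definition coset_rep (E : {group gT}) (i : 'I_a) : gT :=
  repr (nth finset.set0 (enum (lcosets E [set: gT]%G)) i).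

Let size_enum (E : {group gT}) : #|E| = m -> size (enum (lcosets E [set: gT]%G)) = a.
Proof.
move=> Em; rewrite -cardE card_lcosets -divgS ?finset.subsetT// cardsT -cardG Em.
by rewrite mulnK// -Em cardG_gt0.
Qed.

Lemma coset_repE (E : {group gT}) (i : 'I_a) : #|E| = m ->
  nth finset.set0 (enum (lcosets E [set: gT]%G)) i = (coset_rep E i *: E)%g.
Proof.
move=> Em; have : nth finset.set0 (enum (lcosets E [set: gT]%G)) i \in lcosets E [set: gT]%G.
  by rewrite -mem_enum mem_nth// size_enum.
rewrite /coset_rep; case/lcosetsP => g _ ->; apply/lcoset_eqP.
by rewrite lcoset_sym; exact: mem_repr (lcoset_refl _ _).
Qed.

Lemma coset_rep_inj (E : {group gT}) i j : #|E| = m ->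
  ((coset_rep E j)^-1 * coset_rep E i)%g \in E -> i = j.
Proof.
move=> Em; rewrite -mem_lcoset => /lcoset_eqP H.
have : nth finset.set0 (enum (lcosets E [set: gT]%G)) i =
       nth finset.set0 (enum (lcosets E [set: gT]%G)) j by rewrite !coset_repE.
move/eqP; rewrite nth_uniq ?size_enum ?enum_uniq// => /eqP; exact: val_inj.
Qed.

Lemma coset_rep_cover (E : {group gT}) g : #|E| = m ->
  exists i, ((coset_rep E i)^-1 * g)%g \in E.
Proof.
move=> Em; have gE : (g *: E)%g \in lcosets E [set: gT]%G by apply/lcosetsP; exists g; rewrite ?inE.
have iE : (index (g *: E)%g (enum (lcosets E [set: gT]%G)) < a)%N.
  by rewrite -(size_enum Em) index_mem mem_enum.
exists (Ordinal iE); rewrite -mem_lcoset -coset_repE//= nth_index ?mem_enum//.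
exact: lcoset_refl.
Qed.

Definition enumerates (z : 'I_a -> 'rV[R]_N) x :=
  injective z /\ forall y, (exists g, y = lact g x) <-> exists i, y = z i.

Lemma coset_enumerates (E : {group gT}) x : #|E| = m -> stab x = E ->
  enumerates (fun i => lact (coset_rep E i) x) x.
Proof.
move=> Em Ex; split=> [i j E0|y].
  apply: (coset_rep_inj Em); rewrite -Ex inE lactM E0 lactK.
  by [].
split=> [[g ->]|[i ->]]; last by exists (coset_rep E i).
have [i gi] := coset_rep_cover g Em; exists i; move: gi; rewrite -Ex inE lactM.
by move=> /eqP/(congr1 (lact (coset_rep E i))); rewrite -lactM mulgV lact1.
Qed.

Lemma enumerates_perm z z' x : enumerates z x -> enumerates z' x ->
  exists t : {perm 'I_a}, z' = z \o t.
Proof.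
move=> [zi zx] [zi' zx'].
have /choice[f Hf] i : exists j, z' i = z j.
  by apply/(zx (z' i)); apply/zx'; exists i.
have fi : injective f by move=> i j E; apply: zi'; rewrite !Hf E.
by exists (perm fi); apply/funext => i /=; rewrite permE.
Qed.

Lemma enumerates_lact z x g : enumerates z (lact g x) <-> enumerates z x.
Proof.
split=> -[zi zx]; split=> // y; rewrite -zx; split=> -[h ->].
- by exists (h * g^-1)%g; rewrite lactM lactK.
- by exists (h * g)%g; rewrite lactM.
- by exists (h * g)%g; rewrite lactM.
- by exists (h * g^-1)%g; rewrite lactM lactK.
Qed.

End orbits.

End linear_action.

Section configurations.
Context {R : realType} {N a : nat}.

Definition conf_plots : plots R ('I_a -> 'rV[R]_N) := @Plots R ('I_a -> 'rV[R]_N)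
  (fun n (U : set 'rV[R]_n) xi => forall i j, sm U (fun z => xi z i 0 j))
  (fun n (U V : set 'rV[R]_n) xi VU h i j => sm_sub VU (h i j)).

(** Permutations act freely on injective configurations, and the coordinates separate points. By the
    last clause the row [(i, k)] of [u z] depends on the point [z i] and on the set of all the
    points, but not on their numbering, so an orbit may be numbered arbitrarily. *)
Lemma configuration_trivialisation : exists2 K : finType, (0 < #|K|)%N &
  forall (K' Q : finType) (b : K' -> K * Q), bijective b ->
  exists u u' : ('I_a -> 'rV[R]_N) -> @fmat R ('I_a * K')%type,
  [/\ forall i j, psm conf_plots [set z : 'I_a -> 'rV[R]_N | injective z] (fun z => u z i j),
      forall z : 'I_a -> 'rV[R]_N, injective z -> finverse (u z) (u' z) &
      forall (t : {perm 'I_a}) (z : 'I_a -> 'rV[R]_N) i k j, injective z ->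
        u (z \o t) (i, k) j = u z (t i, k) j].
Proof.
pose act (t : {perm 'I_a}) (z : 'I_a -> 'rV[R]_N) := z \o t.
(* Products of permutations compose from left to right, so precomposition by [t] is a left action on
   configurations and the action on indices takes the inverse. *)
pose tact (t : {perm 'I_a}) (i : 'I_a) := t^-1%g i.
pose kap (ij : 'I_a * 'I_N) (z : 'I_a -> 'rV[R]_N) := z ij.1 0 ij.2.
have [|||||||K K0 HK] := @free_trivialisation_mult R _ conf_plots _ act _ tact _ kap.
- by move=> z; apply/funext => i; rewrite /act /= perm1.
- by move=> s t z; apply/funext => i; rewrite /act /= permM.
- by move=> t n U xi _ h i j; exact: h.
- by move=> i; rewrite /tact invg1 perm1.
- by move=> s t i; rewrite /tact invMg permM.
- by move=> [i j] n U xi oU pxi _; exact: pxi.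
- by move=> y z H; apply/funext => i; apply/rowP => j; exact: (H (i, j)).
exists K => // K' Q b bb.
have [nu [nu' [C [C' [nus nuV _ nuE]]]]] := HK K' Q b bb.
have fr z : injective z -> free_point act z.
  move=> zi t tz; apply/permP => i; rewrite perm1; apply: zi.
  by have := congr1 (fun f => f i) tz.
exists (fun z => nu z 1), (fun z => nu' z 1); split.
- move=> i j n U xi oU pxi Dxi; apply: ((nus i j).1 n U xi (fun=> 1)) => //.
    by move=> z /Dxi; exact: fr.
  exact: sm_cst.
- by move=> z zi; apply/nuV/fr.
- move=> t z i k j zi; have := nuE t z (t i) k j (fr z zi).
  by rewrite /tact permK.
Qed.

End configurations.

(** * Frames adapted to the orbits of a prime *)


(** The difference of two distinct vectors is a nonzero polynomial of size at most [N]; the product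
    over all pairs cannot vanish at all the candidate integers. *)
Lemma separating_slope {R : realType} {N L : nat} (y : 'I_L -> 'rV[R]_N) :
  injective y -> exists2 r, (r < (L * L * N).+1)%N &
    injective (fun i => (rVpoly (y i)).[r%:R]).
Proof.
move=> yi; pose P (ij : 'I_L * 'I_L) := ij.1 != ij.2.
pose q (ij : 'I_L * 'I_L) := rVpoly (y ij.1 - y ij.2).
have q0 : \prod_(ij | P ij) q ij != 0.
  apply/prodf_neq0 => -[i j] ij; apply: contra ij => /eqP.
  move=> /(congr1 (@poly_rV R N)); rewrite rVpolyK linear0 => /eqP.
  by rewrite subr_eq0 => /eqP/yi ->; exact: eqxx.
have sq : (size (\prod_(ij | P ij) q ij)%R <= (L * L * N).+1)%N.
  apply: leq_trans (size_poly_prod_leq _ _) _; apply: leq_trans (leq_subr _ _) _; rewrite ltnS.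
  apply: (@leq_trans (\sum_(ij : 'I_L * 'I_L) N)).
    rewrite big_mkcond/=; apply: leq_sum => ij _; case: ifP => // _; exact: size_poly.
  by rewrite big_const iter_addn_0 mulnC card_prod card_ord.
have [/existsP[r rq]|] := boolP [exists r : 'I_(L * L * N).+1, ~~ root (\prod_(ij | P ij) q ij) r%:R].
  exists r => // i j ij; apply: contraNeq rq => ij0.
  rewrite (bigD1 (i, j))//= rootM rootE /q linearB/= hornerD hornerN ij subrr eqxx //.
rewrite negb_exists => /forallP rq; have rs := max_poly_roots q0 (rs := [seq r%:R | r <- iota 0 (L * L * N).+1]).
move: sq; rewrite leqNgt -{1}(size_iota 0 (L * L * N).+1) -(size_map (fun r : nat => r%:R : R)).
rewrite rs//.
  apply/allP => _ /mapP[r + ->]; rewrite mem_iota add0n => /andP[_ rL].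
  by have := rq (Ordinal rL); rewrite negbK.
by rewrite map_inj_uniq ?iota_uniq// => i j /eqP; rewrite eqr_nat => /eqP.
Qed.

Section prime_points.
Context {R : realType} {gT : finGroupType} {N : nat} (A : gT -> 'M[R]_N).
Hypothesis A1 : A 1%g = 1%:M.
Hypothesis AM : forall g h, A (g * h)%g = A h *m A g.
Variables (p k a : nat).
Hypothesis p_prime : prime p.
Hypothesis cardG : (a * p ^ k)%N = #|gT|.

Local Notation lact := (lact A).
Local Notation stab := (stab A).
Local Notation avg := (avg A).
Local Notation spread := (spread A).
Local Notation mobility := (mobility A).
Local Notation lplots := (@lin_plots R N).

Definition prime_point (x : 'rV[R]_N) := exists2 r, (r <= k)%N & #|stab x| = (p ^ r)%N.

Lemma prime_point_lact g x : prime_point x -> prime_point (lact g x).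
Proof. by move=> [r rk xr]; exists r; rewrite ?card_stab_lact. Qed.

(** Stabilisers can only shrink at nearby points, and the order of a subgroup divides [p ^ r]. *)
Lemma open_prime_point : open prime_point.
Proof.
rewrite openE => x [r rk xr].
have : nbhs x [set y | stab y \subset stab x].
  by apply: open_nbhs_nbhs; split; [exact: open_mobility|exact: fintype.subxx].
apply: filterS => y /= yx.
have : (#|stab_group A1 AM y| %| p ^ r)%N.
  have := @cardSg _ (stab_group A1 AM x) (stab_group A1 AM y) yx.
  by rewrite /= xr.
by case/(dvdn_pfactor _ _ p_prime) => r' r'r E; exists r' => //; exact: leq_trans rk.
Qed.

Lemma prime_point_stab (E : {group gT}) x : prime_point x -> #|E| = (p ^ k)%N ->
  E \subset stab x -> stab x = E.
Proof.
move=> [r rk xr] Ek Ex; apply/eqP; rewrite eq_sym finset.eqEcard Ex Ek xr.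
by rewrite leq_pexp2l// prime_gt0.
Qed.

(* [avg E] projects onto the points fixed by [E]; the first factor vanishes unless
   the projection of [x] has stabiliser exactly [E] and is close to [x]. *)
Definition bump (E : {group gT}) x := flat 1 (mobility E (avg E x) - spread E x) *
  \prod_(E' : {group gT} | (E' != E) && (#|E'| == p ^ k)%N) spread E' x.

Definition orbit_at (E : {group gT}) x : 'I_a -> 'rV[R]_N :=
  fun i => lact (coset_rep E i) (avg E x).

Lemma bump_eq0 (E E0 : {group gT}) x : stab x = E0 -> #|E0| = (p ^ k)%N -> E != E0 ->
  bump E x = 0.
Proof.
move=> xE E0k EE0; apply/eqP; rewrite /bump mulf_eq0; apply/orP; right.
apply/prodf_eq0; exists E0; first by rewrite E0k eqxx eq_sym EE0.
by rewrite spread_eq0// xE.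
Qed.

Lemma bump_gt0 (E : {group gT}) x : stab x = E -> #|E| = (p ^ k)%N -> 0 < bump E x.
Proof.
move=> xE Ek; have Ex : E \subset stab x by rewrite xE.
apply: mulr_gt0.
  rewrite flat_gt0// avg_id// subr_gt0.
  have /eqP -> : spread E x == 0 by rewrite spread_eq0.
  by rewrite lt0r mobility_ge0 mobility_neq0 xE fintype.subxx.
apply: prodr_gt0 => E' /andP[E'E /eqP E'k].
rewrite lt0r sqnorm_ge0 andbT spread_eq0// xE; apply: contra E'E => E'E.
by apply/eqP/val_inj/eqP => /=; rewrite finset.eqEcard E'E Ek E'k leqnn.
Qed.

Section frame.
Variables (K : finType) (u u' : ('I_a -> 'rV[R]_N) -> @fmat R ('I_a * K)%type).
Hypothesis us : forall i j, psm conf_plots [set z : 'I_a -> 'rV[R]_N | injective z] (fun z => u z i j).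
Hypothesis uV : forall z : 'I_a -> 'rV[R]_N, injective z -> finverse (u z) (u' z).
Hypothesis uE : forall (t : {perm 'I_a}) (z : 'I_a -> 'rV[R]_N) i k j, injective z ->
  u (z \o t) (i, k) j = u z (t i, k) j.

(** The inner sum has one term, for the coset [E] itself: when [E] is the stabiliser of [x], this
    index is the position of [x] in its own orbit. *)
Definition frame0 x (j : 'I_a * K) (q : K) : R :=
  \sum_(E : {group gT} | #|E| == (p ^ k)%N) bump E x *
    \sum_(i : 'I_a | coset_rep E i \in E) u (orbit_at E x) (i, q) j.

Lemma sm_frame0 j q : psm lplots prime_point (fun x => frame0 x j q).
Proof.
move=> n U xi oU pxi Uxi; apply: sm_sum => // E /eqP Ek.
have mE : sm U (fun z => mobility E (avg E (xi z))).
  by apply: sm_mobility => //; exact: sm_avg.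
have sE : sm U (fun z => spread E (xi z)) by exact: sm_spread.
apply: sm_local => z Uz.
(* In the first case the stabiliser of the average is larger than [E], so its translates are not [a]
   distinct points; then [spread E] is positive and the bump vanishes nearby. *)
have [m0|m0] := eqVneq (mobility E (avg E (xi z))) 0.
  exists (U `&` (fun z => mobility E (avg E (xi z)) - spread E (xi z)) @^-1` [set t | t < 0]).
  have oV : open (U `&` (fun z => mobility E (avg E (xi z)) - spread E (xi z)) @^-1` [set t | t < 0]).
    by apply: open_preim => //; exact: smB.
  split=> //.
    split=> //=; rewrite m0 sub0r oppr_lt0 lt0r sqnorm_ge0 andbT.
    apply/negP => s0; have := s0; rewrite spread_eq0// => Ex.
    have xE := prime_point_stab (Uxi _ Uz) Ek Ex.
    by move/eqP: m0; apply/negP; rewrite avg_id// mobility_neq0 xE fintype.subxx.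
  apply: sm_ext (@sm_cst _ _ _ 0) => // y [_ /= my].
  by rewrite /bump flat_le0 ?mul0r// ltW.
pose V := U `&` (fun z => mobility E (avg E (xi z))) @^-1` [set t | t != 0].
have oV : open V by apply: open_preim => //; exact: open_neq.
have VU : V `<=` U by move=> ? [].
exists V; split=> //.
apply: smM => //.
  apply: smM => //.
    by apply: sm_flat => //; exact: sm_sub VU (smB oU mE sE).
  by apply: sm_prod => // E' _; apply: sm_spread => //; apply: plotS pxi.
apply: sm_sum => // i _; apply: us => //.
  by move=> i' j'; apply: sm_lact => //; apply: sm_avg => //; apply: plotS pxi.
move=> y [Uy /= my].
have aE : stab (avg E (xi y)) = E.
  by apply/eqP; rewrite finset.eqEsubset -mobility_neq0 my avg_stab.
by have [] := coset_enumerates A1 AM cardG Ek aE.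
Qed.

(** Each point of the orbit comes with its own subgroup and its own numbering of cosets; by [uE]
    they all agree with a single numbering [z], up to positive factors. *)
Lemma frame0E x : #|stab x| = (p ^ k)%N -> exists (z : 'I_a -> 'rV[R]_N) (w : 'rV[R]_N -> R),
  [/\ enumerates A z x, forall h, 0 < w (lact h x) &
      forall h i j q, lact h x = z i -> frame0 (lact h x) j q = w (lact h x) * u z (i, q) j].
Proof.
move=> xk; pose gE y := stab_group A1 AM y.
exists (orbit_at (gE x) x), (fun y => bump (gE y) y).
have hk h : #|stab (lact h x)| = (p ^ k)%N by rewrite card_stab_lact.
have enx y : #|stab y| = (p ^ k)%N -> enumerates A (orbit_at (gE y) y) y.
  move=> yk; have -> : orbit_at (gE y) y = fun i => lact (coset_rep (gE y) i) y.
    by apply/funext => i; rewrite /orbit_at avg_id.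
  exact: (coset_enumerates A1 AM cardG yk).
split=> [|h|h i j q hi]; [exact: enx|by apply: bump_gt0 => //; exact: hk|].
set y := lact h x in hi *; have yk : #|stab y| = (p ^ k)%N by exact: hk.
rewrite /frame0 (bigD1 (gE y))/= ?yk ?eqxx//.
rewrite [X in _ + X]big1 ?addr0; last first.
  by move=> E /andP[_ EE]; rewrite (bump_eq0 (E0 := gE y))// mul0r.
have [t Et] := enumerates_perm (enx _ xk) ((enumerates_lact A1 AM _ _ h).1 (enx _ yk)).
have [zi _] := enx _ xk; have [yi _] := enx _ yk.
have HE i' : (coset_rep (gE y) i' \in gE y) = (orbit_at (gE y) y i' == y).
  by rewrite inE /orbit_at avg_id.
have Ei : orbit_at (gE y) y (t^-1%g i) = y by rewrite Et /= permKV -hi.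
congr (_ * _); rewrite (bigD1 (t^-1%g i))/= ?HE ?Ei ?eqxx// [X in _ + X]big1 ?addr0.
  by rewrite Et uE// permKV.
move=> i' /andP[+ /eqP ii']; rewrite HE => /eqP i'y; case: ii'; apply: yi.
by rewrite i'y Ei.
Qed.

Let L := (p * a)%N.
Let Q := (L * L * N).+1.
Let D := #|{: ('I_L * 'I_Q) * (('I_a * K) * K)}|.

Definition level x := \prod_(E : {group gT} | #|E| == (p ^ k)%N) spread E x.

Lemma sm_level n (U : set 'rV[R]_n) xi : open U -> plot lplots U xi ->
  sm U (fun z => level (xi z)).
Proof. by move=> oU pxi; apply: sm_prod => // E _; exact: sm_spread. Qed.

Lemma level_eq0 x : prime_point x -> (level x == 0) = (#|stab x| == (p ^ k)%N).
Proof.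
move=> xp; apply/prodf_eq0/eqP => [[E /eqP Ek]|xk].
  by rewrite spread_eq0// => /(prime_point_stab xp Ek) ->.
by exists (stab_group A1 AM x); [rewrite xk|rewrite spread_eq0].
Qed.

(** The perturbation carries the factor [level x] and so leaves the points with [#|stab x| = p ^ k]
    untouched. It contains the powers of the values at every slope below [Q], since any [L] given
    points are separated by one of these slopes. *)
Definition frame (P : 'rV[R]_D) x j q := frame0 x j q + level x *
  \sum_(s : 'I_L * 'I_Q) (rVpoly x).[s.2%:R] ^+ s.1 * P 0 (enum_rank (s, (j, q))).

Lemma sm_slope n (U : set 'rV[R]_n) xi t : open U -> plot lplots U xi ->
  sm U (fun z => (rVpoly (xi z)).[t]).
Proof.
move=> oU pxi; apply: (@sm_ext _ _ _ oU (fun z => \sum_(j < N) xi z 0 j * t ^+ j)).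
  move=> z _; rewrite (@horner_coef_wide _ N) ?size_poly//; apply: eq_bigr => i _.
  by rewrite coef_rVpoly_ord.
by apply: sm_sum => // j _; apply: smM => //; exact: sm_cst.
Qed.

Lemma sm_frame P j q : psm lplots prime_point (fun x => frame P x j q).
Proof.
move=> n U xi oU pxi Uxi; apply: smD => //; first exact: sm_frame0.
apply: smM => //; first exact: sm_level.
apply: sm_sum => // s _; apply: smM => //; last exact: sm_cst.
by apply: smX => //; exact: sm_slope.
Qed.

(* Outside of the points with [#|stab x| = p ^ k] the orbit of [x] contains [p a]
   distinct points, hence, by a Vandermonde determinant, [p a |K|] independent
   conditions on [v] as the parameter [P] varies: more than the [N + a |K|]
   coordinates of [(x, v)]. *)
Lemma generic_frame : (N < a * #|K|)%N -> exists P, forall x v,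
  prime_point x -> #|stab x| != (p ^ k)%N ->
  (forall h q, \sum_j v j * frame P (lact h x) j q = 0) -> v =1 (fun=> 0).
Proof.
move=> NK; pose c := #|{: 'I_a * K}|; pose d := #|{: 'I_L * K}|.
have Nd : (N + c < d)%N.
  rewrite /c /d !card_prod !card_ord -mulnA; apply: (@leq_trans (2 * (a * #|K|))).
    by rewrite mul2n -addnn ltn_add2r.
  by rewrite leq_mul2r prime_gt1// orbT.
pose X (z : 'rV[R]_(N + c)) : 'rV[R]_N := lsubmx z.
pose v (z : 'rV[R]_(N + c)) j := rsubmx z 0 (enum_rank j).
(* A choice [e] is a slope and [L] group elements. Where [Del e] is nonzero, they give [L] points of
   the orbit with distinct values at the slope and nonzero level, and the vector [v] is nonzero. *)
pose I := ('I_Q * {ffun 'I_L -> gT})%type.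
pose y (e : I) i z := lact (e.2 i) (X z).
pose lam (e : I) i z := (rVpoly (y e i z)).[e.1%:R].
pose Del (e : I) z := (\prod_i level (y e i z)) *
  (\prod_(i < L) \prod_(j < L | (i < j)%N) (lam e j z - lam e i z)) * sqnorm (rsubmx z).
pose U := X @^-1` prime_point.
have oU : open U.
  by apply: open_comp => [z _|]; [exact: continuous_lsubmx|exact: open_prime_point].
have pX : plot lplots U X.
  by move=> j; apply: (sm_ext oU) (sm_coord (lshift c j)) => z _; rewrite mxE.
have vs j : sm U (fun z => v z j).
  by apply: (sm_ext oU) (sm_coord (rshift N (enum_rank j))) => z _; rewrite /v mxE.
have py e i : plot lplots U (y e i) by exact: sm_lact.
have lams e i : sm U (lam e i) by exact: sm_slope.
have Dels e : sm U (Del e).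
  apply: smM => //; last by apply: sm_sqnorm => // j; have := vs (enum_val j); rewrite /v enum_valK.
  apply: smM => //; first by apply: sm_prod => // i _; exact: sm_level.
  by apply: sm_prod => // i _; apply: sm_prod => // j _; exact: smB.
pose Z e := U `&` Del e @^-1` [set t | t != 0].
have oZ e : open (Z e) by apply: open_preim => //; exact: open_neq.
have ZU e : Z e `<=` U by move=> ? [].
pose rs (s : 'I_D) : ('I_L * 'I_Q) * (('I_a * K) * K) := enum_val s.
pose rt (t : 'I_d) : 'I_L * K := enum_val t.
pose B (e : I) z : 'M[R]_(D, d) := \matrix_(s, t) (((rs s).2.2 == (rt t).2)%:R *
  (v z (rs s).2.1 * level (y e (rt t).1 z) *
   (rVpoly (y e (rt t).1 z)).[(rs s).1.2%:R] ^+ (rs s).1.1)).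
pose b (e : I) z : 'rV[R]_d := \row_t (- \sum_j v z j * frame0 (y e (rt t).1 z) j (rt t).2).
have [||||P HP] := @generic_avoidance R _ _ _ _ Z B b Nd.
- exact: oZ.
- move=> e s t; apply: (sm_sub (@ZU e)).
  apply: (@sm_ext _ _ _ oU (fun z => ((rs s).2.2 == (rt t).2)%:R *
    (v z (rs s).2.1 * level (y e (rt t).1 z) *
   (rVpoly (y e (rt t).1 z)).[(rs s).1.2%:R] ^+ (rs s).1.1))).
    by move=> z _; rewrite [RHS]mxE.
  apply: smM => //; first exact: sm_cst.
  apply: smM => //; first by apply: smM => //; exact: sm_level.
  by apply: smX => //; exact: sm_slope.
- move=> e t; apply: (sm_sub (@ZU e)).
  apply: (@sm_ext _ _ _ oU (fun z => - \sum_j v z j * frame0 (y e (rt t).1 z) j (rt t).2)).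
    by move=> z _; rewrite [RHS]mxE.
  apply: smN => //; apply: sm_sum => // j _; apply: smM => //.
  by apply: sm_frame0 => // z Uz; exact: prime_point_lact.
- move=> e z [Uz /=]; rewrite !mulf_eq0 !negb_or -andbA => /and3P[/prodf_neq0 lev0 Van v0].
  have [j0 vj0] : exists j, v z j != 0.
    apply/existsP; rewrite -negb_forall; apply: contra v0 => /forallP v0.
    rewrite sqnorm_eq0; apply/eqP/rowP => j; rewrite [RHS]mxE.
    by have /eqP := v0 (enum_val j); rewrite /v enum_valK.
  (* The left inverse of [B e z] uses only the parameters attached to the slope of [e] and to an
     index [j0] with [v z j0 != 0]; there [B] is a Vandermonde matrix up to nonzero factors. *)
  pose W := invmx (Vandermonde L (\row_i lam e i z)).
  have WV i1 i2 : \sum_i W i1 i * lam e i2 z ^+ i = (i1 == i2)%:R.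
    have : W *m Vandermonde L (\row_i lam e i z) = 1%:M.
      rewrite mulVmx// unitmxE unitfE det_Vandermonde.
      by under eq_bigr do under eq_bigr do rewrite !mxE.
    by move/matrixP/(_ i1 i2); rewrite !mxE => <-; apply: eq_bigr => i _; rewrite !mxE.
  exists (\matrix_(t, s) (((rs s).2 == (j0, (rt t).2))%:R * ((rs s).1.2 == e.1)%:R *
    ((v z j0)^-1 * (level (y e (rt t).1 z))^-1 * W (rt t).1 (rs s).1.1))).
  apply/matrixP => t1 t2; rewrite mxE (reindex _ (onW_bij _ (@enum_rank_bij _)))/=.
  under eq_bigr do rewrite !mxE /rs enum_rankK.
  rewrite -(pair_bigA _ (fun s1 s2 => (s2 == (j0, (rt t1).2))%:R * (s1.2 == e.1)%:R *
    ((v z j0)^-1 * (level (y e (rt t1).1 z))^-1 * W (rt t1).1 s1.1) *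
    ((s2.2 == (rt t2).2)%:R *
      (v z s2.1 * level (y e (rt t2).1 z) *
     (rVpoly (y e (rt t2).1 z)).[s1.2%:R] ^+ s1.1))))/=.
  under eq_bigr => s1 _.
    rewrite (big_only1 (j0, (rt t1).2))//=; last first.
      by move=> s2 s20 _; rewrite (negbTE s20) !mul0r.
    over.
  rewrite -(pair_bigA _ (fun i r => ((j0, (rt t1).2) == (j0, (rt t1).2))%:R * (r == e.1)%:R *
    ((v z j0)^-1 * (level (y e (rt t1).1 z))^-1 * W (rt t1).1 i) *
    (((rt t1).2 == (rt t2).2)%:R *
      (v z j0 * level (y e (rt t2).1 z) *
     (rVpoly (y e (rt t2).1 z)).[r%:R] ^+ i))))/=.
  under eq_bigr => i _.
    rewrite (big_only1 e.1)//=; last first.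
      by move=> r r0 _; rewrite (negbTE r0) mulr0 !mul0r.
    rewrite !eqxx !mul1r.
    rewrite (_ : _ * _ = ((rt t1).2 == (rt t2).2)%:R *
      (level (y e (rt t1).1 z))^-1 * level (y e (rt t2).1 z) *
      (W (rt t1).1 i * lam e (rt t2).1 z ^+ i)); last by rewrite /lam; field; rewrite vj0 lev0.
    over.
  rewrite -mulr_sumr WV mxE -(inj_eq enum_val_inj) -/(rt t1) -/(rt t2).
  case: (rt t1) (rt t2) (lev0) => [i1 q1] [i2 q2] /= l0; rewrite xpair_eqE andbC.
  have [_|_] := eqVneq q1 q2; rewrite ?mul0r//= mul1r.
  have [<-|_] := eqVneq i1 i2; rewrite ?mulr0//= mulr1 mulVf// /y; exact: l0.
exists P => x w xp xk Hw.
have [//|w0] := pselect (w =1 (fun=> 0)); exfalso.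
have [r rk xr] := xp; have {}rk : (r < k)%N.
  by rewrite ltn_neqAle rk andbT; apply: contraNneq xk => <-; rewrite xr.
have cardG' : (a * p ^ (k - r) * p ^ r)%N = #|gT|.
  by rewrite -mulnA -expnD subnK ?(ltnW rk).
(* The right-hand side is the size of the orbit; its first [L] cosets provide the required
   points. *)
have La' : (L <= a * p ^ (k - r))%N.
  have : (p ^ 1 <= p ^ (k - r))%N by rewrite leq_pexp2l ?subn_gt0// prime_gt0.
  by rewrite /L mulnC leq_mul2l expn1 => ->; rewrite orbT.
pose gb (i : 'I_L) := coset_rep (stab_group A1 AM x) (widen_ord La' i).
have gbi : injective (fun i => lact (gb i) x).
  move=> i j ij; suff : widen_ord La' i = widen_ord La' j.
    by move=> /(congr1 (@nat_of_ord _))/= E; exact: val_inj.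
  by apply: (coset_rep_inj cardG' xr); rewrite inE lactM// ij lactK.
have [r0 r0Q slo] := separating_slope gbi.
pose e : I := (Ordinal r0Q, finfun gb).
pose z : 'rV[R]_(N + c) := row_mx x (\row_s w (enum_val s)).
have Xz : X z = x by rewrite /X row_mxKl.
have vz j : v z j = w j by rewrite /v row_mxKr mxE enum_rankK.
have yz i : y e i z = lact (gb i) x by rewrite /y ffunE Xz.
have Zz : Z e z.
  split; first by rewrite /U /= Xz.
  rewrite /= !mulf_neq0//.
  - by apply/prodf_neq0 => i _; rewrite yz level_eq0 ?card_stab_lact//; exact: prime_point_lact.
  - apply/prodf_neq0 => i _; apply/prodf_neq0 => j ij; rewrite subr_eq0 /lam !yz.
    by rewrite (inj_eq slo) gt_eqF.
  - rewrite sqnorm_eq0; apply/eqP => /rowP v0; apply: w0 => j.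
    by rewrite -vz /v v0 mxE.
move/eqP: (HP _ _ Zz); apply; apply/rowP => t; rewrite !mxE.
rewrite (reindex _ (onW_bij _ (@enum_rank_bij _)))/=.
under eq_bigr do rewrite !mxE /rs enum_rankK.
case: (rt t) => i q /=.
under eq_bigr => s _.
  rewrite [in enum_rank _](_ : s = (s.1, (s.2.1, s.2.2))); last by case: s => [? []].
  over.
rewrite -(pair_bigA _ (fun s1 s2 => P 0 (enum_rank (s1, (s2.1, s2.2))) * ((s2.2 == q)%:R *
  (v z s2.1 * level (y e i z) * (rVpoly (y e i z)).[s1.2%:R] ^+ s1.1))))/=.
rewrite exchange_big/= -(pair_bigA _ (fun j q' => \sum_s1 P 0 (enum_rank (s1, (j, q'))) * ((q' == q)%:R *
  (v z j * level (y e i z) * (rVpoly (y e i z)).[s1.2%:R] ^+ s1.1))))/=.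
apply/eqP; rewrite -addr_eq0 -big_split/= -[X in _ == X](Hw (gb i) q); apply/eqP/eq_bigr => j _.
rewrite (big_only1 q)//= => [|q' q'q _]; last first.
  by rewrite big1// => s1 _; rewrite (negbTE q'q) mul0r mulr0.
rewrite /frame mulrDr addrC vz yz; congr (_ + _); rewrite !mulr_sumr.
by apply: eq_bigr => s1 _; rewrite eqxx mul1r mulrC -!mulrA.
Qed.

Lemma frame_level0 P x : #|stab x| = (p ^ k)%N -> frame P x = frame0 x.
Proof.
move=> xk; have /eqP l0 : level x == 0 by rewrite level_eq0 ?xk//; exists k.
by apply/funext => j; apply/funext => q; rewrite /frame l0 mul0r addr0.
Qed.

Lemma frame_rows P x v : #|stab x| = (p ^ k)%N ->
  (forall h q, \sum_j v j * frame P (lact h x) j q = 0) -> v =1 (fun=> 0).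
Proof.
move=> xk Hv; have [z [w [zx w0 fE]]] := frame0E xk; have [zi zy] := zx.
have [uu _] := uV zi; move=> j.
have vu (iq : 'I_a * K) : \sum_j v j * u z iq j = 0.
  case: iq => i q; have [h hi] : exists h, z i = lact h x by apply/zy; exists i.
  apply/eqP; have := Hv h q; rewrite frame_level0 ?card_stab_lact//.
  under eq_bigr do rewrite (fE _ _ _ _ (esym hi)) mulrCA.
  by rewrite -mulr_sumr => /eqP; rewrite mulf_eq0 gt_eqF//= w0.
transitivity (\sum_l v l * fmul (u' z) (u z) j l).
  rewrite (uV zi).2 (bigD1 j)//= /fid eqxx mulr1 big1 ?addr0// => l lj.
  by rewrite eq_sym (negbTE lj) mulr0.
rewrite /fmul; under eq_bigr do rewrite mulr_sumr; rewrite exchange_big big1// => l _.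
under eq_bigr do rewrite mulrCA.
by rewrite -mulr_sumr vu mulr0.
Qed.

(** An invariant [y] is a function on the orbit. Summing over the elements [h] with the same
    [lact h x] gives a vector [Y] killed by the invertible matrix [u z]; as the weights in [Y] are
    positive, [y] vanishes with it. *)
Lemma frame_columns P x (y : gT -> K -> R) : #|stab x| = (p ^ k)%N ->
  (forall h h', lact h x = lact h' x -> y h = y h') ->
  (forall j, \sum_h \sum_q frame P (lact h x) j q * y h q = 0) -> forall h q, y h q = 0.
Proof.
move=> xk yst Hy; have [z [w [[zi zy] w0 fE]]] := frame0E xk.
pose Y (iq : 'I_a * K) := \sum_(h | lact h x == z iq.1) w (lact h x) * y h iq.2.
have Y0 j : \sum_iq Y iq * u z iq j = 0.
  have -> : \sum_iq Y iq * u z iq j = \sum_i \sum_q Y (i, q) * u z (i, q) j.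
    by rewrite pair_big/=; apply: eq_bigr => -[].
  rewrite -[RHS](Hy j).
  rewrite exchange_big [RHS]exchange_big/=; apply: eq_bigr => q _.
  under eq_bigr do rewrite mulr_suml.
  rewrite (exchange_big_dep xpredT)//=; apply: eq_bigr => h _.
  have [i hi] : exists i, lact h x = z i by apply/zy; exists h.
  rewrite (big_pred1 i) => [|i'].
    by rewrite frame_level0 ?card_stab_lact// (fE _ _ _ _ hi); ring.
  by rewrite hi (inj_eq zi) eq_sym.
have {}Y0 iq : Y iq = 0.
  transitivity (\sum_l Y l * fmul (u z) (u' z) l iq).
    rewrite (uV zi).1 (bigD1 iq)//= /fid eqxx mulr1 big1 ?addr0// => l lj.
    by rewrite (negbTE lj) mulr0.
  rewrite /fmul; under eq_bigr do rewrite mulr_sumr; rewrite exchange_big big1// => l _.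
  under eq_bigr do rewrite mulrA.
  by rewrite -mulr_suml Y0 mul0r.
move=> h q; have [i hi] : exists i, lact h x = z i by apply/zy; exists h.
have := Y0 (i, q); rewrite /Y /= (eq_bigr (fun h' => w (lact h' x) * y h q)) => [|h' /eqP h'i].
  rewrite -mulr_suml => /eqP; rewrite mulf_eq0 => /orP[|/eqP//].
  rewrite gt_eqF// (bigD1 h)/= ?hi ?eqxx// ltr_pwDl -?hi ?w0//.
  by apply: sumr_ge0 => h' _; rewrite ltW.
by rewrite (yst h' h)// hi.
Qed.

End frame.

Lemma orbit_frame : exists2 K0 : finType, (0 < #|K0|)%N &
  forall (K Q : finType) (b : K -> K0 * Q), bijective b -> (N < a * #|K|)%N ->
  exists F : 'rV[R]_N -> 'I_a * K -> K -> R,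
  [/\ forall j q, psm lplots prime_point (fun x => F x j q),
      forall x v, prime_point x ->
        (forall h q, \sum_j v j * F (lact h x) j q = 0) -> v =1 (fun=> 0) &
      forall x (y : gT -> K -> R), #|stab x| = (p ^ k)%N ->
        (forall h h', lact h x = lact h' x -> y h = y h') ->
        (forall j, \sum_h \sum_q F (lact h x) j q * y h q = 0) -> forall h q, y h q = 0].
Proof.
have [K0 K00 HK] := @configuration_trivialisation R N a.
exists K0 => // K Q b bb NK; have [u [u' [us uV uE]]] := HK K Q b bb.
have [P HP] := generic_frame us NK.
exists (frame u P); split.
- by move=> j q; exact: sm_frame.
- move=> x v xp Hv; have [xk|xk] := eqVneq #|stab x| (p ^ k)%N.
    exact: (frame_rows uV uE xk Hv).
  exact: (HP x v xp xk Hv).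
- by move=> x y xk yst Hy; exact: (frame_columns uV uE xk yst Hy).
Qed.

End prime_points.

(** * The cocycle of a prime *)


Section prime_cocycle.
Context {R : realType} {gT : finGroupType} {N : nat} (A : gT -> 'M[R]_N).
Hypothesis A1 : A 1%g = 1%:M.
Hypothesis AM : forall g h, A (g * h)%g = A h *m A g.
Variables (p k a : nat).
Hypothesis p_prime : prime p.
Hypothesis k_gt0 : (0 < k)%N.
Hypothesis cardG : (a * p ^ k)%N = #|gT|.

Local Notation lact := (lact A).
Local Notation stab := (stab A).
Local Notation lplots := (@lin_plots R N).
Local Notation U := (prime_point A p k).

Section kernel_cocycle.
Variables (K : finType) (F : 'rV[R]_N -> 'I_a * K -> K -> R).
Hypothesis Fs : forall j q, psm lplots U (fun x => F x j q).
Hypothesis F_rows : forall x v, U x ->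
  (forall h q, \sum_j v j * F (lact h x) j q = 0) -> v =1 (fun=> 0).
Hypothesis F_columns : forall x (y : gT -> K -> R), #|stab x| = (p ^ k)%N ->
  (forall h h', lact h x = lact h' x -> y h = y h') ->
  (forall j, \sum_h \sum_q F (lact h x) j q * y h q = 0) -> forall h q, y h q = 0.
Variables (nu nu' : 'rV[R]_N -> R -> @fmat R (gT * K)%type) (C C' : @fmat R (gT * K)%type).
Hypothesis nus : forall i j, psm2 lplots (free_point lact) (fun x s => nu x s i j) /\
                  psm2 lplots (free_point lact) (fun x s => nu' x s i j).
Hypothesis nuV : forall x s, free_point lact x -> finverse (nu x s) (nu' x s).
Hypothesis nuC : forall x, nu x 0 = C /\ nu' x 0 = C'.
Hypothesis CC' : finverse C C'.
Hypothesis nuE : forall g x s q j, free_point lact x ->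
  nu (lact g x) 1 ((s * g^-1)%g, q) j = nu x 1 (s, q) j.
Variables (c n : nat) (e : 'I_(c + n) -> gT * K) (ec : 'I_c -> 'I_a * K).
Hypothesis eb : bijective e.
Hypothesis ecb : bijective ec.
Hypothesis Nn : (N + 1 < n)%N.
Variable sg : 'rV[R]_N -> R.
Hypothesis sgs : psm lplots U sg.
Hypothesis sgE : forall g x, sg (lact g x) = sg x.
Hypothesis sg0 : forall x, U x -> ~ free_point lact x -> sg x = 0.

Let e_inj : injective e := bij_inj eb.

Definition mxf (M : @fmat R (gT * K)%type) : 'M[R]_(c + n) := \matrix_(i, j) M (e i) (e j).

Lemma mxf_inverse M M' : finverse M M' -> mxf M *m mxf M' = 1%:M.
Proof.
move=> [MM' _]; apply/matrixP => i j; rewrite !mxE -(inj_eq e_inj).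
transitivity (fmul M M' (e i) (e j)); last by rewrite MM'.
rewrite /fmul [RHS](reindex e)/=; last exact: onW_bij.
by apply: eq_bigr => l _; rewrite !mxE.
Qed.

(** The regular representation by right translation, [y (h, q)] becoming [y (h * g, q)], with
    multiplicity [K]. *)
Definition shift_mx (g : gT) : 'M[R]_(c + n) :=
  \matrix_(i, j) (e j == ((e i).1 * g, (e i).2)%g)%:R.

Lemma mul_shift_mx g q (y : 'M[R]_(c + n, q)) i l j : e l = ((e i).1 * g, (e i).2)%g ->
  (shift_mx g *m y) i j = y l j.
Proof.
move=> il; rewrite mxE (big_only1 l)// ?mxE ?il ?eqxx ?mul1r// => l' l'l _.
by rewrite mxE -il (inj_eq e_inj) (negbTE l'l) mul0r.
Qed.

Lemma shift_mxM g h : shift_mx g *m shift_mx h = shift_mx (g * h)%g.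
Proof.
have [e' eK e'K] := eb.
apply/matrixP => i j; rewrite (mul_shift_mx _ _ (l := e' ((e i).1 * g, (e i).2)%g)) ?e'K//.
by rewrite !mxE e'K/= mulgA.
Qed.

Lemma shift_mx1 : shift_mx 1%g = 1%:M.
Proof.
by apply/matrixP => i j; rewrite !mxE mulg1 -surjective_pairing (inj_eq e_inj) eq_sym.
Qed.

Definition orbit_mx x : 'M[R]_(c, c + n) := \matrix_(i, j) F (lact (e j).1 x) (ec i) (e j).2.

Lemma orbit_mx_shift g x : orbit_mx (lact g x) *m shift_mx g = orbit_mx x.
Proof.
have [e' eK e'K] := eb.
apply/matrixP => i j; rewrite !mxE (big_only1 (e' ((e j).1 * g^-1, (e j).2)%g))//.
  by rewrite !mxE e'K/= mulgKV -surjective_pairing eqxx mulr1 -lactM// mulgKV.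
move=> l lj _; rewrite !mxE; case: eqP => [E|]; last by rewrite mulr0.
by case/eqP: lj; apply: e_inj; rewrite e'K E /= mulgK -surjective_pairing.
Qed.

(* The parameter [s] interpolates between the constant trivialisation [C], which
   makes sense at the non-free points, and the equivariant one. *)
Definition hat x s := orbit_mx x *m mxf (nu x (st s)).

(** Below 1/3 the step [st] vanishes and [hat] uses the constant trivialisation, which exists at
    every point; a bound on [s], rather than [s = 0], makes the domain open. *)
Definition frame_ok (x : 'rV[R]_N) (s : R) := U x /\ (free_point lact x \/ s < 3^-1).

Definition hat_dom : set 'rV[R]_(N + 1) :=
  [set z | frame_ok (lsubmx z : 'rV[R]_N) ((rsubmx z : 'rV[R]_1) 0 0)].

Lemma lsub_plot W : open W -> plot lplots W (lsubmx : 'rV[R]_(N + 1) -> 'rV_N).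
Proof.
by move=> oW j; apply: (sm_ext oW) (sm_coord (lshift 1 j)) => z _; rewrite [RHS]mxE.
Qed.

Lemma sm_rsub0 W : open W -> sm W (fun z : 'rV[R]_(N + 1) => (rsubmx z : 'rV[R]_1) 0 0).
Proof.
by move=> oW; apply: (sm_ext oW) (sm_coord (rshift N 0)) => z _; rewrite [RHS]mxE.
Qed.

Lemma open_hat_dom : open hat_dom.
Proof.
have -> : hat_dom = lsubmx @^-1` U `&`
    ((setT `&` (fun z => mobility A 1%g (lsubmx z)) @^-1` [set t | t != 0]) `|`
     (setT `&` (fun z : 'rV[R]_(N + 1) => (rsubmx z : 'rV[R]_1) 0 0) @^-1` [set t | t < 3^-1])).
  apply/seteqP; split=> z /= [zU zf]; split=> //.
    by case: zf => zf; [left|right]; split=> //; exact/(free_mobility A1).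
  by case: zf => -[_ zf]; [left; apply/(free_mobility A1)|right].
apply: openI.
  by apply: open_comp => [z _|]; [exact: continuous_lsubmx|exact: open_prime_point].
apply: openU; apply: open_preim => //; try exact: openT.
- by apply: sm_mobility; [exact: openT|exact/lsub_plot/openT].
- exact/sm_rsub0/openT.
Qed.

Lemma nu_inverse x s : free_point lact x \/ s < 3^-1 ->
  finverse (nu x (st s)) (nu' x (st s)).
Proof.
move=> [fx|s3]; first exact: nuV.
by rewrite st_le ?ltW//; have [-> ->] := nuC x.
Qed.

Lemma sm_nu m (W : set 'rV[R]_m) xi s : open W -> plot lplots W xi -> sm W s ->
  (forall z, W z -> frame_ok (xi z) (s z)) -> forall i j,
  sm W (fun z => nu (xi z) (st (s z)) i j) /\ sm W (fun z => nu' (xi z) (st (s z)) i j).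
Proof.
move=> oW pxi ss Wok i j.
have H (f : 'rV[R]_N -> R -> R) (f0 : R) : psm2 lplots (free_point lact) f ->
    (forall x, f x 0 = f0) -> sm W (fun z => f (xi z) (st (s z))).
  move=> fs ff0; apply: sm_local => z Wz; have [_ [fz|sz]] := Wok z Wz.
    pose V := W `&` (fun z => mobility A 1%g (xi z)) @^-1` [set t | t != 0].
    have oV : open V by apply: open_preim => //; exact: sm_mobility.
    have VW : V `<=` W by move=> ? [].
    exists V; split=> //; first by split=> //; exact/(free_mobility A1).
    apply: fs => //; first exact: plotS pxi.
      by move=> y [_ /= ?]; exact/(free_mobility A1).
    by apply: sm_st => //; exact: sm_sub ss.
  pose V := W `&` s @^-1` [set t | t < 3^-1].
  have oV : open V by apply: open_preim.
  exists V; split=> //; apply: sm_ext (sm_cst f0) => // y [_ /= y3].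
  by rewrite st_le ?ff0// ltW.
split; [apply: (H (fun x s => nu x s i j) (C i j))|apply: (H (fun x s => nu' x s i j) (C' i j))].
- exact: (nus i j).1.
- by move=> x; have [-> _] := nuC x.
- exact: (nus i j).2.
- by move=> x; have [_ ->] := nuC x.
Qed.

Lemma sm_orbit_mx m (W : set 'rV[R]_m) xi : open W -> plot lplots W xi ->
  (forall z, W z -> U (xi z)) -> forall i j, sm W (fun z => orbit_mx (xi z) i j).
Proof.
move=> oW pxi WU i j.
apply: (@sm_ext _ _ _ oW (fun z => F (lact (e j).1 (xi z)) (ec i) (e j).2)).
  by move=> z _; rewrite [RHS]mxE.
by apply: Fs => //; [exact: sm_lact|move=> z Wz; apply: prime_point_lact => //; exact: WU].
Qed.

Lemma sm_hat m (W : set 'rV[R]_m) xi s : open W -> plot lplots W xi -> sm W s ->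
  (forall z, W z -> frame_ok (xi z) (s z)) -> forall i j, sm W (fun z => hat (xi z) (s z) i j).
Proof.
move=> oW pxi ss Wok i j; apply: sm_mulmx => // {}i {}j.
  by apply: sm_orbit_mx => // z /Wok[].
apply: (@sm_ext _ _ _ oW (fun z => nu (xi z) (st (s z)) (e i) (e j))).
  by move=> z _; rewrite [RHS]mxE.
by apply: (sm_nu oW pxi ss Wok _ _).1.
Qed.

Lemma hat_inj x s (v : 'rV[R]_c) : frame_ok x s -> v *m hat x s = 0 -> v = 0.
Proof.
move=> [xU ok]; rewrite mulmxA => /(congr1 (mulmx^~ (mxf (nu' x (st s))))).
rewrite mul0mx -mulmxA mxf_inverse ?mulmx1; last exact: nu_inverse.
have [e' eK e'K] := eb; have [ec' ecK ec'K] := ecb.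
move=> vx; apply/rowP => i; rewrite [RHS]mxE -(ecK i).
apply: (F_rows (v := fun j => v 0 (ec' j)) xU) => h q.
have /rowP/(_ (e' (h, q))) := vx; rewrite !mxE => E.
rewrite -[RHS]E (reindex ec)/=; last exact: onW_bij.
by apply: eq_bigr => j _; rewrite mxE e'K ecK.
Qed.

(** The columns of [YY x] form a frame of the kernel of [orbit_mx x], with left inverse [LL x], and
    the cocycle is the matrix of [shift_mx g] in the frames at [x] and at [lact g x]. The frame is
    constructed for [hat] over the pairs [(x, s)], whence the dimension [N + 1], and then taken at
    [s = sg x]. *)
Lemma kernel_cocycle : exists cc : gT -> 'rV[R]_N -> 'M[R]_n,
  [/\ forall g i j, psm lplots U (fun x => cc g x i j),
      forall x, U x -> cc 1%g x = 1%:M /\ forall g h, cc (g * h)%g x = cc g (lact h x) *m cc h x,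
      forall g x, U x -> sg x = 1 -> cc g x = 1%:M &
      forall x (v : 'cV[R]_n), #|stab x| = (p ^ k)%N ->
        (forall g, g \in stab x -> cc g x *m v = v) -> v = 0].
Proof.
pose Fz (z : 'rV[R]_(N + 1)) := hat (lsubmx z) ((rsubmx z : 'rV[R]_1) 0 0).
have [||Y [L [YL YLs]]] := @kernel_frame R _ c n hat_dom Fz Nn open_hat_dom.
- by move=> i j; apply: sm_hat => //; [exact: open_hat_dom|exact/lsub_plot/open_hat_dom|
    exact/sm_rsub0/open_hat_dom].
- by move=> z v zok; exact: hat_inj.
have okU x : U x -> frame_ok x (sg x).
  move=> xU; split=> //; have [fx|/sg0 ->//] := pselect (free_point lact x); first by left.
  by right; rewrite invr_gt0.
have hatZ x : U x -> (Fz @` hat_dom) (hat x (sg x)).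
  move=> /okU xok; exists (row_mx x (sg x)%:M).
    by rewrite /hat_dom /= row_mxKl row_mxKr mxE eqxx mulr1n.
  by rewrite /Fz row_mxKl row_mxKr mxE eqxx mulr1n.
pose Vm x := mxf (nu x (st (sg x))); pose Vm' x := mxf (nu' x (st (sg x))).
have VV' x : U x -> Vm x *m Vm' x = 1%:M /\ Vm' x *m Vm x = 1%:M.
  move=> /okU[_ /nu_inverse xV]; split; apply: mxf_inverse => //; exact: finverseC.
pose YY x := Vm x *m Y (hat x (sg x)); pose LL x := L (hat x (sg x)) *m Vm' x.
have Y0 x : U x -> orbit_mx x *m YY x = 0.
  by move=> xU; have [z /YL[+ _ _] Ez] := hatZ x xU; rewrite Ez /YY mulmxA.
have LY x : U x -> LL x *m YY x = 1%:M.
  move=> xU; have [z /YL[_ + _] Ez] := hatZ x xU; rewrite Ez => LY.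
  by rewrite /LL /YY mulmxA -(mulmxA _ (Vm' x)) (VV' x xU).2 mulmx1.
have YLy x q (y : 'M[R]_(c + n, q)) : U x -> orbit_mx x *m y = 0 -> YY x *m (LL x *m y) = y.
  move=> xU y0; have [z /YL[_ _ H] Hz] := hatZ x xU.
  rewrite /YY /LL -!mulmxA -Hz H ?mulmxA ?(VV' x xU).1 ?mul1mx//.
  by rewrite Hz /hat -!mulmxA (mulmxA (Vm x)) (VV' x xU).1 mul1mx.
have kershift g x q (y : 'M[R]_(c + n, q)) : orbit_mx x *m y = 0 ->
    orbit_mx (lact g x) *m (shift_mx g *m y) = 0.
  by move=> y0; rewrite mulmxA orbit_mx_shift.
have Ug g x : U x -> U (lact g x) by exact: prime_point_lact.
exists (fun g x => LL (lact g x) *m (shift_mx g *m YY x)); split.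
- move=> g i j m W xi oW pxi Wxi.
  have smooth_at g' : (forall i j, sm W (fun z => YY (lact g' (xi z)) i j)) /\
      (forall i j, sm W (fun z => LL (lact g' (xi z)) i j)).
    have pg : plot lplots W (fun z => lact g' (xi z)) by exact: sm_lact.
    have sgg : sm W (fun z => sg (lact g' (xi z))).
      by apply: sgs => // z Wz; apply/Ug/Wxi.
    have okg z : W z -> frame_ok (lact g' (xi z)) (sg (lact g' (xi z))).
      by move=> Wz; apply/okU/Ug/Wxi.
    have [Ys Ls] := YLs _ _ _ oW (sm_hat oW pg sgg okg) (fun z Wz => hatZ _ (Ug g' _ (Wxi z Wz))).
    have Vs i' j' : sm W (fun z => Vm (lact g' (xi z)) i' j') /\ sm W (fun z => Vm' (lact g' (xi z)) i' j').
      have [h1 h2] := sm_nu oW pg sgg okg (e i') (e j').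
      by split; [apply: sm_ext h1|apply: sm_ext h2] => // z _; rewrite [RHS]mxE.
    split=> i' j'; apply: sm_mulmx => // i'' j''.
      exact: (Vs _ _).1.
    exact: (Vs _ _).2.
  have [Ys _] := smooth_at 1%g; have [_ Ls] := smooth_at g.
  apply: sm_mulmx => // i' j'; apply: sm_mulmx => // i'' j''; first exact: sm_cst.
  by apply: sm_ext (Ys i'' j'') => // z _; rewrite lact1.
- move=> x xU; split; first by rewrite lact1// shift_mx1 mul1mx LY.
  move=> g h; rewrite lactM// -[RHS]mulmxA -[in RHS](mulmxA (shift_mx g)) YLy.
  - by rewrite -shift_mxM -(mulmxA (shift_mx g)).
  - exact: Ug.
  - by apply: kershift; exact: Y0.
- move=> g x xU sx.
  have fx : free_point lact x.
    apply: contrapT => /(sg0 xU) /eqP; rewrite sx oner_eq0//.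
  have st1 : st (1 : R) = 1 by rewrite st_ge//; lra.
  have VE : Vm (lact g x) = shift_mx g *m Vm x.
    have [e' eK e'K] := eb; apply/matrixP => i j.
    rewrite (mul_shift_mx _ _ (l := e' ((e i).1 * g, (e i).2)%g)) ?e'K//.
    rewrite !mxE e'K sgE sx st1 -(nuE g _ _ _ fx)/= mulgK.
    by rewrite -surjective_pairing.
  (* The trivialisation is equivariant where [sg] is 1, so [hat] is constant along the orbit; the
     frame depends on this matrix alone and is therefore carried along by the shift. *)
  have hatE : hat (lact g x) (sg (lact g x)) = hat x (sg x).
    by rewrite /hat -/(Vm _) -/(Vm x) VE mulmxA orbit_mx_shift.
  rewrite -[RHS](LY (lact g x) (Ug g x xU)); congr (_ *m _).
  by rewrite /YY VE hatE mulmxA.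
- move=> x v xk vfix; have xU : U x by exists k.
  have [e' eK e'K] := eb.
  (* A vector fixed by the cocycle gives a kernel vector invariant under right translation by the
     stabiliser, that is, a function on the orbit. *)
  have yfix g : g \in stab x -> shift_mx g *m (YY x *m v) = YY x *m v.
    move=> gx; have gxx : lact g x = x by move: gx; rewrite inE => /eqP.
    rewrite -[in RHS](vfix g gx) gxx -[in RHS](mulmxA (LL x)) -[in RHS](mulmxA (shift_mx g)) YLy//.
    by rewrite -{1}gxx; apply: kershift; rewrite mulmxA Y0// mul0mx.
  have y0 : YY x *m v = 0.
    apply/colP => i; rewrite [RHS]mxE -(eK i) [e i]surjective_pairing.
    apply: (F_columns xk (y := fun h q => (YY x *m v) (e' (h, q)) 0)).
      move=> h h' hh'; apply/funext => q.
      have hx : (h^-1 * h')%g \in stab x by rewrite inE lactM// -hh' lactK.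
      rewrite -[in LHS](yfix _ hx) (mul_shift_mx _ _ (l := e' (h', q)))//.
      by rewrite !e'K/= mulKVg.
    move=> j; have [ec' ecK ec'K] := ecb.
    have : (orbit_mx x *m (YY x *m v)) (ec' j) 0 = 0 by rewrite mulmxA Y0// mul0mx mxE.
    rewrite mxE => E; rewrite -[RHS]E pair_big/= (reindex e)/=; last exact: onW_bij.
    by apply: eq_bigr => l _; rewrite [orbit_mx _ _ _]mxE ec'K -surjective_pairing eK.
  by rewrite -[v]mul1mx -(LY x xU) -mulmxA y0 mulmx0.
Qed.

End kernel_cocycle.

Lemma prime_cocycle : exists n0 l0, (0 < n0)%N /\ forall l, (l0 <= l)%N ->
  forall sg : 'rV[R]_N -> R, psm lplots U sg -> (forall g x, sg (lact g x) = sg x) ->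
  (forall x, U x -> ~ free_point lact x -> sg x = 0) ->
  exists cc : gT -> 'rV[R]_N -> 'M[R]_(n0 * l),
  [/\ forall g i j, psm lplots U (fun x => cc g x i j),
      forall x, U x -> cc 1%g x = 1%:M /\ forall g h, cc (g * h)%g x = cc g (lact h x) *m cc h x,
      forall g x, U x -> sg x = 1 -> cc g x = 1%:M &
      forall x (v : 'cV[R]_(n0 * l)), #|stab x| = (p ^ k)%N ->
        (forall g, g \in stab x -> cc g x *m v = v) -> v = 0].
Proof.
have [KS KS0 HS] := orbit_frame A1 AM p_prime cardG.
pose tact (g s : gT) := (s * g^-1)%g.
have [|||||||KG KG0 HG] := @free_trivialisation_mult R _ lplots gT lact gT tact 'I_N (fun i x => x 0 i).
- by move=> x; exact: lact1.
- by move=> g h x; exact: lactM.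
- by move=> g m W xi; exact: sm_lact.
- by move=> s; rewrite /tact invg1 mulg1.
- by move=> g h s; rewrite /tact invMg mulgA.
- by move=> j m W xi oW pxi _; exact: pxi.
- by move=> x y xy; apply/rowP.
have G0 : (0 < #|gT|)%N by rewrite -cardsT cardG_gt0.
have a0 : (0 < a)%N by move: G0; rewrite -cardG muln_gt0 => /andP[].
have aG : (a < #|gT|)%N.
  rewrite -cardG -[X in (X < _)%N]muln1 ltn_pmul2l//.
  by rewrite -{1}(expn0 p) ltn_exp2l// prime_gt1.
(* For [K = KS * KG * 'I_l] the kernel has rank [(#|gT| - a) * #|K|], where [KS] and [KG] are the
   multiplicities demanded by the configurations and by the free locus. The bound [N.+2] puts this
   rank above the [N + 1] parameters. *)
exists ((#|gT| - a) * (#|KS| * #|KG|))%N, N.+2; split.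
  by rewrite !muln_gt0 subn_gt0 aG KS0 KG0.
move=> l lN sg sgs sgE sg0.
pose K := ((KS * KG) * 'I_l)%type.
have cardK : #|{: K}| = (#|KS| * #|KG| * l)%N by rewrite !card_prod card_ord.
have lK : (l <= #|{: K}|)%N by rewrite cardK leq_pmull// muln_gt0 KS0.
have bS : bijective (fun q : K => (q.1.1, (q.1.2, q.2))).
  by exists (fun q : KS * (KG * 'I_l) => ((q.1, q.2.1), q.2.2)) => [[[]]|[? []]].
have bG : bijective (fun q : K => (q.1.2, (q.1.1, q.2))).
  by exists (fun q : KG * (KS * 'I_l) => ((q.2.1, q.1), q.2.2)) => [[[]]|[? []]].
have NK : (N < a * #|{: K}|)%N.
  by apply: leq_trans (leq_pmull _ a0); apply: leq_trans lK; exact: ltnW.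
have [F [Fs F_rows F_columns]] := HS _ _ _ bS NK.
have [nu [nu' [C [C' [nus nuV [nuC CC'] nuE]]]]] := HG _ _ _ bG.
have E : (#|{: 'I_a * K}| + (#|gT| - a) * (#|KS| * #|KG|) * l)%N = #|{: gT * K}|.
  by rewrite !card_prod !card_ord -(mulnA (#|gT| - a)%N) -mulnDl subnKC// ltnW.
apply: (kernel_cocycle Fs F_rows F_columns nus nuV nuC CC' _
  (e := fun i => enum_val (cast_ord E i)) (ec := enum_val) _ _ _ sgs sgE sg0).
- by move=> g x s q j fx; exact: nuE.
- exists (fun x => cast_ord (esym E) (enum_rank x)) => x /=.
    by rewrite enum_valK cast_ordK.
  by rewrite cast_ordKV enum_rankK.
- exact: enum_val_bij.
- rewrite addn1; apply: leq_trans lN _.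
  by rewrite leq_pmull// !muln_gt0 subn_gt0 aG KS0 KG0.
Qed.

End prime_cocycle.

(** * Gluing the primes *)


Section all_primes.
Context {R : realType} {gT : finGroupType} {N : nat} (A : gT -> 'M[R]_N).
Hypothesis A1 : A 1%g = 1%:M.
Hypothesis AM : forall g h, A (g * h)%g = A h *m A g.
Hypothesis A_iso : forall g x, sqnorm (x *m A g) = sqnorm x.
Variable k : nat.
Hypothesis k_gt0 : (0 < k)%N.

Local Notation lact := (lact A).
Local Notation stab := (stab A).
Local Notation lplots := (@lin_plots R N).
Local Notation U := (fun p => prime_point A p k).

Definition prime_power_point (x : 'rV[R]_N) := exists2 p, prime p & U p x.

(** Scaled to values at most 1, so that a product of such functions is at most each of its
    factors. *)
Definition displacement g x := sqnorm (lact g x - x) / (1 + sqnorm (lact g x - x)).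

Lemma displacement_ge0 g x : 0 <= displacement g x.
Proof. by rewrite divr_ge0 ?addr_ge0 ?sqnorm_ge0. Qed.

Lemma displacement_le1 g x : displacement g x <= 1.
Proof.
rewrite ler_pdivrMr ?mul1r ?ler_wpDl//.
by rewrite ltr_pwDl ?sqnorm_ge0.
Qed.

Lemma displacement_eq0 g x : (displacement g x == 0) = (g \in stab x).
Proof.
rewrite mem_stab mulf_eq0 invr_eq0 [1 + _ == 0]gt_eqF ?orbF//.
by rewrite ltr_pwDl ?sqnorm_ge0.
Qed.

Lemma displacement_conj g h x : displacement g (lact h x) = displacement (g ^ h)%g x.
Proof.
rewrite /displacement; suff -> : sqnorm (lact g (lact h x) - lact h x) =
    sqnorm (lact (g ^ h)%g x - x) by [].
rewrite -[RHS](A_iso h) -/(lact h _) lactB -!lactM//.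
by rewrite conjgE !mulgA mulgV mul1g.
Qed.

Lemma sm_displacement g n (W : set 'rV[R]_n) xi : open W -> plot lplots W xi ->
  sm W (fun z => displacement g (xi z)).
Proof.
move=> oW pxi; apply: smM => //; first exact: sm_lact_sub.
apply: smV => //; last by apply: smD => //; [exact: sm_cst|exact: sm_lact_sub].
by move=> z _; rewrite gt_eqF// ltr_pwDl ?sqnorm_ge0.
Qed.

Definition torsion (p : nat) x := \prod_(g | #[g]%g == p) displacement g x.

Lemma torsion_ge0 p x : 0 <= torsion p x.
Proof. by apply: prodr_ge0 => g _; exact: displacement_ge0. Qed.

Lemma torsion_le1 p x : torsion p x <= 1.
Proof.
by apply: prodr_ile1 => g _; rewrite displacement_ge0 displacement_le1.
Qed.

Lemma torsion_lact p h x : torsion p (lact h x) = torsion p x.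
Proof.
rewrite /torsion [RHS](reindex_inj (conjg_inj h))/=; apply: eq_big => g.
  by rewrite orderJ.
by move=> _; rewrite displacement_conj.
Qed.

Lemma torsion_eq0 p x : prime p -> (torsion p x == 0) = (p %| #|stab x|)%N.
Proof.
move=> pp; apply/prodf_eq0/idP => [[g /eqP gp]|/(pgroup.Cauchy (G := stab_group A1 AM x) pp)[g gx gp]].
  rewrite displacement_eq0 => gx; rewrite -gp.
  by apply: (@cardSg _ (stab_group A1 AM x) <[g]>%G); rewrite cycle_subG.
by exists g; rewrite ?gp// displacement_eq0.
Qed.

Let I := 'I_#|gT|.+1.

Definition cotorsion (p : nat) x := \prod_(q : I | prime q && (q != p :> nat)) torsion q x.

Lemma cotorsion_ge0 p x : 0 <= cotorsion p x.
Proof. by apply: prodr_ge0 => q _; exact: torsion_ge0. Qed.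

Lemma cotorsion_lact p h x : cotorsion p (lact h x) = cotorsion p x.
Proof. by apply: eq_bigr => q _; exact: torsion_lact. Qed.

Lemma cotorsion_le p (q : I) x : prime q -> q != p :> nat -> cotorsion p x <= torsion q x.
Proof.
move=> qp qnp; rewrite /cotorsion (bigD1 q) ?qp//=.
rewrite ler_piMr ?torsion_ge0// prodr_ile1// => q' _.
by rewrite torsion_ge0 torsion_le1.
Qed.

Lemma stab_lt x : (#|stab x| < #|gT|.+1)%N.
Proof. by rewrite ltnS max_card. Qed.

Lemma cotorsion_prime p x : prime p -> prime_power_point x -> 0 < cotorsion p x -> U p x.
Proof.
move=> pp [q qq [r rk xr]] Bx; case: r => [|r] in rk xr; first by exists 0%N.
have qx : (q %| #|stab x|)%N by rewrite xr dvdn_exp.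
have [<-|qp] := eqVneq q p; first by exists r.+1.
have qI : (q < #|gT|.+1)%N by apply: leq_ltn_trans (stab_lt x); exact: (dvdn_leq (cardG_gt0 (stab_group A1 AM x))).
have := lt_le_trans Bx (cotorsion_le (q := Ordinal qI) x qq qp).
by move=> /= ; rewrite lt0r torsion_eq0// qx.
Qed.

Lemma torsionD_gt0 p x : prime p -> prime_power_point x -> 0 < torsion p x + cotorsion p x.
Proof.
move=> pp [q qq [r rk xr]].
have [qp|qp] := eqVneq q p.
  rewrite ltr_wpDl ?torsion_ge0// prodr_gt0// => l /andP[lp lnp].
  rewrite lt0r torsion_ge0 torsion_eq0// xr andbT; apply: contra lnp; rewrite Euclid_dvdX// => /andP[lq _].
  by move: lq; rewrite dvdn_prime2// -qp.
rewrite ltr_pwDl ?cotorsion_ge0// lt0r torsion_ge0 torsion_eq0// xr andbT.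
apply: contra qp; rewrite Euclid_dvdX// => /andP[lq _].
by move: lq; rewrite dvdn_prime2// eq_sym.
Qed.

Lemma sm_torsion p n (W : set 'rV[R]_n) xi : open W -> plot lplots W xi ->
  sm W (fun z => torsion p (xi z)) /\ sm W (fun z => cotorsion p (xi z)).
Proof.
move=> oW pxi; have H q : sm W (fun z => torsion q (xi z)).
  by apply: sm_prod => // g _; exact: sm_displacement.
by split=> //; apply: sm_prod => // q _.
Qed.

(** It equals 1 as soon as [2 * torsion p x >= cotorsion p x]. This overlaps with the region
    [torsion p x < cotorsion p x], and the gluing takes place in the overlap. *)
Definition cutoff p x := st (2 * (torsion p x / (torsion p x + cotorsion p x))).

Lemma prime_cocycle_dim p : prime p -> exists n0 l0, (0 < n0)%N /\ forall n l, n = (n0 * l)%N ->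
  (l0 <= l)%N -> exists cc : gT -> 'rV[R]_N -> 'M[R]_n,
  [/\ forall g i j, psm lplots (U p) (fun x => cc g x i j),
      forall x, U p x -> cc 1%g x = 1%:M /\ forall g h, cc (g * h)%g x = cc g (lact h x) *m cc h x,
      forall g x, U p x -> cutoff p x = 1 -> cc g x = 1%:M &
      forall x (v : 'cV[R]_n), #|stab x| = (p ^ k)%N ->
        (forall g, g \in stab x -> cc g x *m v = v) -> v = 0].
Proof.
move=> pp; have UP x : U p x -> prime_power_point x by exists p.
have [/dvdnP[a aG]|npk] := boolP (p ^ k %| #|gT|)%N.
  have [n0 [l0 [n00 H]]] := prime_cocycle A1 AM pp k_gt0 (esym aG).
  exists n0, l0; split=> // n l -> lk; apply: H => //.
  - move=> n' W xi oW pxi Wxi; have [h1 h2] := sm_torsion p oW pxi.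
    apply: sm_st => //; apply: smM => //; first exact: sm_cst.
    apply: smM => //; apply: smV => //; last exact: smD.
    by move=> z /Wxi/UP xp; rewrite gt_eqF// torsionD_gt0.
  - by move=> g x; rewrite /cutoff torsion_lact cotorsion_lact.
  - move=> x xU nfx; have [[|r] rk xr] := xU.
      case: nfx; apply/(free_lact A1 x)/eqP; rewrite eq_sym finset.eqEcard finset.sub1set xr cards1.
      by rewrite inE lact1// eqxx.
    have /eqP t0 : torsion p x == 0 by rewrite torsion_eq0// xr dvdn_exp.
    by rewrite /cutoff t0 mul0r mulr0 st_le// invr_ge0.
(* When [p ^ k] does not divide the order of the group, no stabiliser has that order and the trivial
   cocycle is enough. *)
exists 1%N, 0%N; split=> // n l _ _; exists (fun _ _ => 1%:M); split=> //.
- by move=> g i j n' W xi oW _ _; exact: sm_cst.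
- by move=> x _; split=> // g h; rewrite mulmx1.
- move=> x v xk; case/negP: npk; rewrite -xk -cardsT.
  exact: (cardSg (G := [set: gT]%G) (H := stab_group A1 AM x) (finset.subsetT _)).
Qed.

(** The regions [torsion p x < cotorsion p x] are disjoint for distinct primes and contain the
    points with stabiliser of order [p ^ k]. The cocycle of [p] is used on its own region and the
    identity elsewhere; both agree near the boundary by the choice of [cutoff]. *)
Lemma smooth_cocycle : exists2 n, (1 < n)%N & exists cc : gT -> 'rV[R]_N -> 'M[R]_n,
  [/\ forall g i j, psm lplots prime_power_point (fun x => cc g x i j),
      forall x, prime_power_point x -> cc 1%g x = 1%:M /\
        forall g h, cc (g * h)%g x = cc g (lact h x) *m cc h x &
      forall x p (v : 'cV[R]_n), prime p -> #|stab x| = (p ^ k)%N ->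
        (forall g, g \in stab x -> cc g x *m v = v) -> v = 0].
Proof.
have /choice[n0 /choice[l0 H]] : forall p : I, exists n0 l0, (0 < n0)%N /\ (prime p ->
  forall n l, n = (n0 * l)%N ->
  (l0 <= l)%N -> exists cc : gT -> 'rV[R]_N -> 'M[R]_n,
  [/\ forall g i j, psm lplots (U p) (fun x => cc g x i j),
      forall x, U p x -> cc 1%g x = 1%:M /\ forall g h, cc (g * h)%g x = cc g (lact h x) *m cc h x,
      forall g x, U p x -> cutoff p x = 1 -> cc g x = 1%:M &
      forall x (v : 'cV[R]_n), #|stab x| = (p ^ k)%N ->
        (forall g, g \in stab x -> cc g x *m v = v) -> v = 0]).
  move=> p; have [/prime_cocycle_dim[n0 [l0 [? ?]]]|] := boolP (prime p).
    by exists n0, l0.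
  by exists 1%N, 0%N.
(* For each prime [p], the product [D * T] is [n0 p] times an integer that is at least [l0 p]. The
   summand 2 makes the dimension exceed 1, so that the spheres have positive dimension. *)
pose D := (\prod_p n0 p)%N; pose T := (2 + \sum_p l0 p)%N.
have D0 : (0 < D)%N by apply: prodn_gt0 => p; exact: (H p).1.
have /choice[cp Hcp] : forall p : I, exists cc : gT -> 'rV[R]_N -> 'M[R]_(D * T), prime p ->
  [/\ forall g i j, psm lplots (U p) (fun x => cc g x i j),
      forall x, U p x -> cc 1%g x = 1%:M /\ forall g h, cc (g * h)%g x = cc g (lact h x) *m cc h x,
      forall g x, U p x -> cutoff p x = 1 -> cc g x = 1%:M &
      forall x (v : 'cV[R]_(D * T)), #|stab x| = (p ^ k)%N ->
        (forall g, g \in stab x -> cc g x *m v = v) -> v = 0].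
  move=> p; have [pp|_] := boolP (prime p); last by exists (fun _ _ => 0).
  have [n00 Hp] := H p.
  have [||cc Hcc] := Hp pp (D * T)%N ((\prod_(q | q != p) n0 q) * T)%N.
  - by rewrite mulnA /D (bigD1 p).
  - apply: (@leq_trans T); first by rewrite /T (bigD1 p)//= addnCA leq_addr.
    by rewrite leq_pmull// prodn_cond_gt0// => q _; exact: (H q).1.
  by exists cc.
exists (D * T)%N; first by apply: (@leq_trans T) => //; rewrite leq_pmull.
pose on p x := torsion p x < cotorsion p x.
have onU (p : I) x : prime p -> prime_power_point x -> on p x -> U p x.
  move=> pp xP px; apply: cotorsion_prime => //.
  exact: le_lt_trans (torsion_ge0 p x) px.
have on1 (p q : I) x : prime p -> prime q -> on p x -> on q x -> p = q.
  (* Two distinct primes would give the cycle [torsion p < cotorsion p <= torsion q < cotorsion q <=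
     torsion p]. *)
  move=> pp qq px qx; apply/eqP; apply: contraT => pq.
  have pq' : q != p :> nat by rewrite eq_sym.
  have h1 := lt_le_trans px (cotorsion_le x qq pq').
  have h2 := lt_le_trans qx (cotorsion_le (p := q) x pp pq).
  by have := lt_trans h1 h2; rewrite ltxx.
pose cc g x := 1%:M + \sum_(p : I | prime p) (if on p x then cp p g x - 1%:M else 0).
have ccE (p : I) g x : prime p -> on p x -> cc g x = cp p g x.
  move=> pp px; rewrite /cc (bigD1 p)//= px big1 ?addr0 ?subrKC//.
  move=> q /andP[qq qp]; case: ifP => // qx.
  by move: qp; rewrite (on1 q p x qq pp qx px) eqxx.
have cc1 g x : (forall p : I, prime p -> ~~ on p x) -> cc g x = 1%:M.
  by move=> no; rewrite /cc big1 ?addr0// => p pp; rewrite (negbTE (no p pp)).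
have on_lact p g x : on p (lact g x) = on p x.
  by rewrite /on torsion_lact cotorsion_lact.
exists cc; split.
- move=> g i j n W xi oW pxi Wxi.
  apply: (@sm_ext _ _ _ oW (fun z => (1%:M : 'M[R]_(D * T)) i j +
      \sum_(p : I | prime p) (if on p (xi z) then cp p g (xi z) i j - (1%:M : 'M[R]_(D * T)) i j else 0))).
    move=> z _; rewrite [RHS]mxE summxE; congr (_ + _); apply: eq_bigr => p _.
    by case: ifP => _; rewrite ?mxE//; rewrite !mxE.
  apply: smD => //; first exact: sm_cst.
  apply: sm_sum => // p pp; have [Hs Hc Hc1 _] := Hcp p pp.
  have [ts cs] := sm_torsion p oW pxi.
  apply: sm_local => z Wz.
  have [px|px] := boolP (on p (xi z)).
    pose V := W `&` (fun z => torsion p (xi z) - cotorsion p (xi z)) @^-1` [set t | t < 0].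
    have oV : open V by apply: open_preim => //; exact: smB.
    exists V; split=> //; first by split=> //=; rewrite subr_lt0.
    apply: (@sm_ext _ _ _ oV (fun z => cp p g (xi z) i j - (1%:M : 'M[R]_(D * T)) i j)).
      by move=> y [_ /=]; rewrite subr_lt0 -/(on p _) => ->.
    apply: smB => //; last exact: sm_cst.
    apply: Hs => //; first by apply: plotS pxi => ? [].
    by move=> y [Wy /=]; rewrite subr_lt0 => py; apply: onU => //; exact: Wxi.
  (* At this point [cotorsion p <= torsion p] and the sum is positive, so
     [cotorsion p < 2 * torsion p] nearby; there the cocycle of [p] is already trivial. *)
  pose V := W `&` (fun z => cotorsion p (xi z) - 2 * torsion p (xi z)) @^-1` [set t | t < 0].
  have oV : open V.
    by apply: open_preim => //; apply: smB => //; apply: smM => //; exact: sm_cst.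
  have xD := torsionD_gt0 pp (Wxi z Wz).
  exists V; split=> //.
    split=> //=; move: px xD; rewrite /on -leNgt.
    have := torsion_ge0 p (xi z); lra.
  apply: sm_ext (@sm_cst _ _ _ 0) => // y [Wy /= y2].
  case: ifP => // py; rewrite (Hc1 g) ?subrr//; first exact/onU/py/Wxi.
  have yD := torsionD_gt0 pp (Wxi y Wy).
  by rewrite /cutoff st_ge// mulrA ler_pdivlMr//; move: y2 => /=; lra.
- move=> x xP; have [[p /andP[pp px]]|no] := pselect (exists p : I, prime p && on p x).
    have [_ Hc _ _] := Hcp p pp; have [c1 cM] := Hc x (onU p x pp xP px).
    split; first by rewrite (ccE p).
    by move=> g h; rewrite !(ccE p) ?on_lact.
  have {}no (p : I) : prime p -> ~~ on p x.
    by move=> pp; apply/negP => px; apply: no; exists p; rewrite pp.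
  split=> [|g h]; first exact: cc1.
  by rewrite !cc1 ?mulmx1// => p pp; rewrite on_lact no.
- move=> x p v pp xk Hv.
  have pI : (p < #|gT|.+1)%N.
    apply: leq_ltn_trans (stab_lt x); rewrite xk -[X in (X <= _)%N]expn1.
    by rewrite leq_exp2l// prime_gt1.
  have xP : prime_power_point x by exists p => //; exists k.
  have px : on p x.
    have /eqP t0 : torsion p x == 0 by rewrite torsion_eq0// xk dvdn_exp.
    by have := torsionD_gt0 pp xP; rewrite /on t0 add0r.
  have [_ _ _ Hf] := Hcp (Ordinal pI) pp; apply: Hf xk _ => g /Hv.
  by rewrite (ccE (Ordinal pI)).
Qed.

End all_primes.

(** * Embedding the manifold *)


(** Each basic open set lying in some [O x] selects one such [x]; the remaining indices yield
    [None]. *)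
Lemma lindelof {T : topologicalType} (O : T -> set T) : @second_countable T ->
  (forall x, nbhs x (O x)) ->
  exists s : nat -> option T, forall y, exists l x, s l = Some x /\ O x y.
Proof.
move=> [B /countable_injP[f fi] [oB bB]] Ox.
have /choice[s Hs] l : exists o : option T,
    (exists x P, [/\ B P, f P = l & P `<=` O x]) ->
    exists x P, o = Some x /\ [/\ B P, f P = l & P `<=` O x].
  have [[x [P xP]]|no] := pselect (exists x P, [/\ B P, f P = l & P `<=` O x]).
    by exists (Some x) => _; exists x, P.
  by exists None.
exists s => y; have [P [BP Py] PO] := bB y _ (Ox y).
have [x [P' [sx [BP' fP' P'O]]]] : exists x P', s (f P) = Some x /\ [/\ B P', f P' = f P & P' `<=` O x].
  by apply: Hs; exists y, P.
exists (f P), x; split=> //; apply: P'O.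
by rewrite (fi P' P)//; exact/mem_set.
Qed.

Lemma entry_lt_sqnorm {R : realType} m (w : 'rV[R]_m) j (d : R) : 0 < d -> sqnorm w < d ^+ 2 ->
  `|w 0 j| < d.
Proof.
move=> d0 wd; rewrite -(@ltr_sqr _ `|w 0 j|) ?nnegrE ?(ltW d0)// real_normK ?num_real//.
apply: le_lt_trans wd; rewrite /sqnorm (bigD1 j)//= lerDl; apply: sumr_ge0 => l _.
exact: sqr_ge0.
Qed.

Section manifold_plots.
Context {R : realType} {gT : finGroupType} {M : manifold R} (act : gT -> M -> M).
Hypothesis actS : smooth_action act.

Local Notation m := (Defs.dim M).

Let act1 x : act 1%g x = x. Proof. exact: actS.1.1. Qed.
Let actM g h x : act (g * h)%g x = act g (act h x). Proof. exact: actS.1.2. Qed.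
Let act_cts g : continuous (act g). Proof. exact: (actS.2 g).1. Qed.

Lemma open_preimage_plot n (U : set 'rV[R]_n) (xi : 'rV[R]_n -> M) (V : set M) :
  open U -> (forall z, U z -> {for z, continuous xi}) -> open V -> open (U `&` xi @^-1` V).
Proof.
move=> oU xic oV; rewrite openE => z [Uz Vz].
apply: filterI; first exact: open_nbhs_nbhs.
by apply: (xic z Uz); exact: open_nbhs_nbhs.
Qed.

Lemma atlas_chart c : atlas M c -> is_chart c.
Proof. by have [H _ _] := manifold_atlas M; exact: H. Qed.

(* The whole action is part of the definition of a plot, which makes plots
   stable under it without composing smooth maps. *)
Definition man_plots : plots R M := @Plots R M
  (fun n (U : set 'rV[R]_n) xi => (forall z, U z -> {for z, continuous xi}) /\
    forall g c, atlas M c -> forall j,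
      sm (U `&` (fun z => act g (xi z)) @^-1` chart_dom c) (fun z => chart_map c (act g (xi z)) 0 j))
  (fun n (U V : set 'rV[R]_n) xi VU h => conj (fun z Vz => h.1 z (VU z Vz))
    (fun g c Mc j => sm_sub (@setSI _ _ _ _ VU) (h.2 g c Mc j))).

Lemma act_plot g n (U : set 'rV[R]_n) xi : plot man_plots U xi ->
  plot man_plots U (fun z => act g (xi z)).
Proof.
move=> [xic xis]; split=> [z Uz|h c Mc j].
  by apply: continuous_comp; [exact: xic|exact: act_cts].
have := xis (h * g)%g c Mc j; congr (sm (_ `&` _) _).
  by apply/seteqP; split=> z /=; rewrite actM.
by apply/funext => z; rewrite actM.
Qed.

Lemma chart_plot c : atlas M c -> plot man_plots (chart_img c) (chart_inv c).
Proof.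
move=> Mc; have [[oD oI] [di id] [ci ic] [cc cic]] := atlas_chart Mc.
split=> // g b Mb j.
have := (actS.2 g).2 c b Mc Mb => H.
have [[oDb _] _ _ _] := atlas_chart Mb.
have oV : open (chart_map c @` (chart_dom c `&` act g @^-1` chart_dom b)).
  apply: open_chart_map; first exact: atlas_chart.
  by apply: open_comp => // x _; exact: act_cts.
apply: (@sm_sub _ _ _ _ (fun z => (chart_map b \o act g \o chart_inv c) z 0 j) _ (sm_mxE oV 0 j H)) => z [Iz /= bz].
by exists (chart_inv c z); [split=> //; exact: id|exact: ic].
Qed.

Lemma chart_plot_lsub c n : atlas M c ->
  plot man_plots (lsubmx @^-1` chart_img c) (chart_inv c \o (lsubmx : 'rV[R]_(m + n) -> _)).
Proof.
move=> Mc; have [xic xis] := chart_plot Mc; split=> [z Iz|g b Mb j].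
  by apply: continuous_comp; [exact: continuous_lsubmx|exact: xic].
exact: (sm_lsub (xis g b Mb j)).
Qed.

Definition extend (c : chart R M m) (G : 'rV[R]_m -> R) (y : M) : R :=
  if `[< chart_dom c y >] then G (chart_map c y) else 0.

Definition good_ball (c : chart R M m) w0 (d : R) :=
  0 < d /\ forall w, sqnorm (w - w0) < d ^+ 2 -> chart_img c w.

(** The set is the image of a compact ball under the inverse chart, hence closed in a Hausdorff
    space; its complement is the open set where an extension by zero is known to vanish. *)
Lemma closed_support c w0 d : atlas M c -> good_ball c w0 d ->
  closed [set y | chart_dom c y /\ sqnorm (chart_map c y - w0) <= 2 / 3 * d ^+ 2].
Proof.
move=> Mc [d0 cd]; have [[oD oI] [di id] [ci ic] [cc cic]] := atlas_chart Mc.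
pose B := [set w : 'rV[R]_m | sqnorm (w - w0) <= 2 / 3 * d ^+ 2].
have d20 : 0 < d ^+ 2 by rewrite exprn_gt0.
have Bi w : B w -> chart_img c w.
  by move=> Bw; apply: cd; apply: le_lt_trans Bw _; lra.
have Bc : compact B.
  apply: (@subclosed_compact 'rV[R]_m B
    [set w : 'rV[R]_m | forall i, `[w0 0 i - d, w0 0 i + d]%classic (w ord0 i)]).
  - have -> : B = ~` (setT `&` (fun w => sqnorm (w - w0)) @^-1` [set t | 2 / 3 * d ^+ 2 < t]).
      apply/seteqP; split=> w; rewrite /B /= leNgt; first by move=> /negP h [_ /h].
      by move=> h; apply/negP => ?; exact: h.
    apply: open_closedC; apply: open_preim => //; first exact: openT.
    apply: sm_sqnorm; first exact: openT.
    move=> j; apply: (sm_ext openT) (smB openT (sm_coord j) (sm_cst (w0 0 j))) => z _.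
    by rewrite !mxE.
  - apply: (@rV_compact R m (fun i => `[w0 0 i - d, w0 0 i + d]%classic)) => i.
    exact: segment_compact.
  - move=> w Bw i /=; rewrite in_itv/=.
    have := entry_lt_sqnorm i d0 (le_lt_trans Bw (_ : 2 / 3 * d ^+ 2 < d ^+ 2)).
    by rewrite !mxE ltr_norml => /(_ ltac:(lra))/andP[h1 h2]; apply/andP; split; lra.
have -> : [set y | chart_dom c y /\ sqnorm (chart_map c y - w0) <= 2 / 3 * d ^+ 2] =
    chart_inv c @` B.
  apply/seteqP; split=> y /=; first by move=> [yc yB]; exists (chart_map c y) => //; exact: ci.
  by move=> [w Bw <-]; have Iw := Bi w Bw; split; [exact: id|rewrite ic].
apply: compact_closed; first exact: manifold_hausdorff.
apply: continuous_compact => //; apply: continuous_in_subspaceT => w /set_mem/Bi.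
exact: cic.
Qed.

Lemma psm_extend c w0 d G : atlas M c -> good_ball c w0 d ->
  psm (@lin_plots R m) setT G ->
  (forall w, 2 / 3 * d ^+ 2 <= sqnorm (w - w0) -> G w = 0) -> psm man_plots setT (extend c G).
Proof.
move=> Mc wd Gs G0 n U xi oU pxi _; have Kc := closed_support Mc wd.
have [[oD _] _ _ _] := atlas_chart Mc.
have [xic xis] := pxi; apply: sm_local => z Uz.
have [zD|zD] := pselect (chart_dom c (xi z)).
  have oV := open_preimage_plot oU xic oD.
  exists (U `&` xi @^-1` chart_dom c); split=> //.
  apply: (@sm_ext _ _ _ oV (fun z => G (chart_map c (xi z)))).
    by move=> y [_ /= yD]; rewrite /extend asboolT.
  apply: Gs => // j; have := xis 1%g c Mc j; congr (sm (_ `&` _) _).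
    by apply/seteqP; split=> y /=; rewrite act1.
  by apply/funext => y; rewrite act1.
have oV := open_preimage_plot oU xic (closed_openC Kc).
eexists; split; [exact: oV|by split=> // -[]|].
apply: (sm_ext oV) (sm_cst 0) => y [_ /= yK]; rewrite /extend.
case: asboolP => // yD; rewrite G0// leNgt; apply/negP => h; apply: yK; split=> //.
exact: ltW.
Qed.

Definition bump_fun w0 (d : R) (w : 'rV[R]_m) := st (1 - sqnorm (w - w0) / d ^+ 2).

Lemma psm_bump_fun w0 d : psm (@lin_plots R m) setT (bump_fun w0 d).
Proof.
move=> n U xi oU pxi _; apply: sm_st => //; apply: smB => //; first exact: sm_cst.
apply: smM => //; last exact: sm_cst.
apply: sm_sqnorm => // j; apply: (sm_ext oU) (smB oU (pxi j) (sm_cst (w0 0 j))) => z _.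
by rewrite !mxE.
Qed.

Lemma bump_fun_eq0 w0 d w : 0 < d -> (bump_fun w0 d w == 0) = (2 / 3 * d ^+ 2 <= sqnorm (w - w0)).
Proof.
move=> d0; rewrite st_eq0 -ler_pdivlMr ?exprn_gt0//; apply/idP/idP; lra.
Qed.

Lemma good_ball_exists x : exists c d, [/\ atlas M c, chart_dom c x & good_ball c (chart_map c x) d].
Proof.
have [_ cov _] := manifold_atlas M; have [c Mc cx] := cov x.
have [[oD oI] [di id] _ _] := atlas_chart Mc.
have : nbhs (chart_map c x) (chart_img c) by apply: open_nbhs_nbhs; split=> //; exact: di.
move=> /nbhs_ballP[d /= d0 dI]; exists c, d; split=> //; split=> // w wd; apply: dI.
split=> // i j; rewrite ord1 /ball /= distrC.
by have := entry_lt_sqnorm j d0 wd; rewrite !mxE.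
Qed.

(** * A map to a vector space that separates the points of each orbit *)

Section separating_family.
Variable kap : nat -> M -> R.
Hypothesis kaps : forall e, psm man_plots setT (kap e).
Hypothesis kap_finite : forall x : M, exists E, nbhs x [set y : M | forall e, (E <= e)%N -> kap e y = 0].
Hypothesis kap_sep : forall x y, (forall e, kap e x = kap e y) -> x = y.

Local Notation q := m.+1.

Definition partial_sum (cf : nat -> 'rV[R]_q) (e : nat) (x : M) : 'rV[R]_q :=
  \sum_(i < e) kap i x *: cf i.

Lemma sm_partial_sum cf e j : psm man_plots setT (fun x => partial_sum cf e x 0 j).
Proof.
move=> n U xi oU pxi _; apply: (@sm_ext _ _ _ oU (fun z => \sum_(i < e) kap i (xi z) * cf i 0 j)).
  by move=> z _; rewrite /partial_sum summxE; apply: eq_bigr => i _; rewrite mxE.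
by apply: sm_sum => // i _; apply: smM => //; [exact: kaps|exact: sm_cst].
Qed.

(* Only the last [e] with [kap e (g x) <> kap e x] matters to separate [x] from
   [g x], so the coefficients can be chosen one after the other. *)
Lemma generic_coefficient cf e : exists v : 'rV[R]_q, forall g x, kap e (act g x) != kap e x ->
  partial_sum cf e (act g x) + kap e (act g x) *: v != partial_sum cf e x + kap e x *: v.
Proof.
have [_ cov _] := manifold_atlas M.
have /choice[ch Hch] x : exists c, atlas M c /\ chart_dom c x by have [c ? ?] := cov x; exists c.
have [|s Hs] := @lindelof M (fun x => chart_dom (ch x)) (@manifold_second_countable _ M).
  move=> x; have [Mc cx] := Hch x; have [[oD _] _ _ _] := atlas_chart Mc.
  exact: open_nbhs_nbhs.
pose dlt (g : gT) (c : chart R M m) z := kap e (act g (chart_inv c z)) - kap e (chart_inv c z).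
pose Z (i : gT * nat) := if s i.2 is Some x then
  chart_img (ch x) `&` dlt i.1 (ch x) @^-1` [set t | t != 0] else set0.
pose b (i : gT * nat) z : 'rV[R]_q := if s i.2 is Some x then
  - (dlt i.1 (ch x) z)^-1 *: (partial_sum cf e (act i.1 (chart_inv (ch x) z)) -
     partial_sum cf e (chart_inv (ch x) z)) else 0.
have dlts g x : sm (chart_img (ch x)) (dlt g (ch x)).
  have [Mc _] := Hch x; have [[_ oI] _ _ _] := atlas_chart Mc.
  have px := chart_plot Mc.
  by apply: smB => //; apply: kaps => //; exact: act_plot.
have oZ i : open (Z i).
  rewrite /Z; case: (s i.2) => [x|]; last exact: open0.
  have [Mc _] := Hch x; have [[_ oI] _ _ _] := atlas_chart Mc.
  by apply: open_preim => //; exact: open_neq.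
have [||||v Hv] := @generic_avoidance R m q q _ Z (fun _ _ => 1%:M) b (ltnSn m).
- exact: oZ.
- by move=> i j l; exact: sm_cst.
- move=> i l; have := oZ i; rewrite /Z /b; case: (s i.2) => [x|] oZi; last exact: sm_cst.
  have [Mc _] := Hch x; have [[_ oI] _ _ _] := atlas_chart Mc.
  have px := chart_plot Mc.
  apply: (@sm_ext _ _ _ oZi (fun z => - (dlt i.1 (ch x) z)^-1 *
    (partial_sum cf e (act i.1 (chart_inv (ch x) z)) 0 l -
     partial_sum cf e (chart_inv (ch x) z) 0 l))).
    by move=> z _; rewrite !mxE.
  have ZI : chart_img (ch x) `&` dlt i.1 (ch x) @^-1` [set t | t != 0] `<=` chart_img (ch x) by move=> ? [].
  apply: smM => //.
    apply: smN => //; apply: smV => //; last exact: sm_sub ZI (dlts _ _).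
    by move=> z [].
  by apply: (sm_sub ZI); apply: smB => //; apply: sm_partial_sum => //; exact: act_plot.
- by move=> i z _; exists 1%:M; rewrite mulmx1.
exists v => g x gx; have [l [y [sl yx]]] := Hs x.
have [Mc _] := Hch y; have [_ [di _] [ci _] _] := atlas_chart Mc.
have := Hv (g, l) (chart_map (ch y) x); rewrite /Z /b /dlt /= sl ci// mulmx1.
move=> H; apply: contra (H _) => [/eqP E|]; last by split; [exact: di|rewrite /= ci// subr_eq0].
have d0 : kap e (act g x) - kap e x != 0 by rewrite subr_eq0.
apply/eqP; apply: (scalerI d0); rewrite scalerA mulrN mulfV// scaleN1r scalerBl opprB.
have -> : kap e (act g x) *: v = partial_sum cf e x + kap e x *: v - partial_sum cf e (act g x).
  by rewrite -E addrC addKr.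
by rewrite addrAC addrK.
Qed.

(** Only points [x] and [act g x] of one orbit are to be separated, so for each of the finitely many
    [g] the parameters are the [m] coordinates of [x]; this is why [m.+1] target coordinates
    suffice, instead of the [2 m + 1] of Whitney's theorem. *)
Lemma embedding : exists h : M -> 'rV[R]_q, (forall j, psm man_plots setT (fun x => h x 0 j)) /\
  forall g x, h (act g x) = h x -> act g x = x.
Proof.
have stable (V : zmodType) (F : nat -> V) E E' : (forall i, (E <= i)%N -> F i = 0) ->
    (E <= E')%N -> \sum_(i < E') F i = \sum_(i < E) F i.
  move=> F0 EE'; rewrite -(subnKC EE') big_split_ord/= [X in _ + X]big1 ?addr0// => i _.
  by rewrite F0// leq_addr.
have /choice[nx Hnx] (p : (nat -> 'rV[R]_q) * nat) := generic_coefficient p.1 p.2.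
(* The choice of each coefficient depends on all the earlier ones, which the recursion carries as a
   list. *)
pose S := fix S e : seq 'rV[R]_q :=
  if e is e'.+1 then rcons (S e') (nx (nth 0 (S e'), e')) else [::].
have size_S e : size (S e) = e by elim: e => //= e IH; rewrite size_rcons IH.
pose cf e := nx (nth 0 (S e), e).
have nth_S e i : (i < e)%N -> nth 0 (S e) i = cf i.
  elim: e => //= e IH; rewrite ltnS leq_eqVlt nth_rcons size_S => /orP[/eqP ->|ie].
    by rewrite ltnn eqxx.
  by rewrite ie IH.
have psS e x : partial_sum (nth 0 (S e)) e x = partial_sum cf e x.
  by apply: eq_bigr => i _; rewrite nth_S.
have /choice[E HE] := kap_finite.
have vanish x e : (E x <= e)%N -> kap e x = 0.
  by move=> Ee; have := nbhs_singleton (HE x); apply.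
pose h x := partial_sum cf (E x) x.
have hE x e : (forall i, (e <= i)%N -> kap i x = 0) -> h x = partial_sum cf e x.
  move=> ex; have st e' e'' := @stable _ (fun i => kap i x *: cf i) e' e''.
  rewrite /h /partial_sum -(st _ (maxn (E x) e)) ?leq_maxl => [|i Ei|//]; last by rewrite vanish// scale0r.
  by rewrite (st e)// ?leq_maxr// => i ei; rewrite ex// scale0r.
exists h; split=> [j n U xi oU pxi _|g x].
  have [xic _] := pxi; apply: sm_local => z Uz.
  pose O := interior [set y : M | forall e, (E (xi z) <= e)%N -> kap e y = 0].
  have oV := open_preimage_plot oU xic (@open_interior M _ : open O).
  exists (U `&` xi @^-1` O); split=> //; first by split=> //; exact: HE.
  apply: (@sm_ext _ _ _ oV (fun y => partial_sum cf (E (xi z)) (xi y) 0 j)).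
    by move=> y [_ /= /interior_subset yO]; rewrite (hE _ (E (xi z))).
  by apply: sm_partial_sum => //; apply: plotS pxi => ? [].
have [//|gx] := pselect (act g x = x); move=> hx; exfalso.
pose P e := kap e (act g x) != kap e x.
have exP : exists e, P e.
  apply: contrapT => no; apply: gx; apply: kap_sep => e.
  by apply/eqP; apply: contraT => Pe; case: no; exists e.
pose B := maxn (E (act g x)) (E x).
have PB e : P e -> (e <= B)%N.
  by apply: contraTT; rewrite -ltnNge => /ltnW; rewrite geq_max /P => /andP[h1 h2]; rewrite !vanish// eqxx.
case: (ex_maxnP exP PB) => e Pe emax.
have := Hnx (nth 0 (S e), e) g x Pe; rewrite /= !psS -/(cf e) => /eqP; apply.
have st := @stable _ (fun i => kap i (act g x) *: cf i - kap i x *: cf i).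
apply/eqP; rewrite -subr_eq0; apply/eqP.
transitivity (h (act g x) - h x); last by rewrite hx subrr.
rewrite (hE _ (maxn B e.+1)); last first.
  by move=> i; rewrite geq_max => /andP[Bi _]; apply: vanish; apply: leq_trans Bi; rewrite leq_maxl.
rewrite (hE x (maxn B e.+1)); last first.
  by move=> i; rewrite geq_max => /andP[Bi _]; apply: vanish; apply: leq_trans Bi; rewrite leq_maxr.
rewrite /partial_sum -[RHS]sumrB (st e.+1)//; last exact: leq_maxr.
  by rewrite big_ord_recr/= sumrB; rewrite opprD addrACA.
move=> i ei; have [Pi|] := boolP (P i); first by have := emax i Pi; rewrite leqNgt ei.
by rewrite negbK => /eqP ->; rewrite subrr.
Qed.

End separating_family.

(** On the core of the [l]-th ball the factor [1 - Psi l None] is 0, so every later [tail] vanishes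
    there: this is the local finiteness. To separate [x] from [y], take the least [l] whose bump is
    nonzero at [x]: then [tail l x = 1], and the quotients by the function of slot [None] return the
    chart coordinates. *)
Lemma separating_family : exists kap : nat -> M -> R,
  [/\ forall e, psm man_plots setT (kap e),
      forall x : M, exists E, nbhs x [set y : M | forall e, (E <= e)%N -> kap e y = 0] &
      forall x y, (forall e, kap e x = kap e y) -> x = y].
Proof.
have /choice[c /choice[d Hcd]] := good_ball_exists.
pose w x := chart_map (c x) x.
pose core x := [set y | chart_dom (c x) y /\ sqnorm (chart_map (c x) y - w x) < 3^-1 * d x ^+ 2].
have core_open x : open (core x).
  have [Mc _ _] := Hcd x; have [[oD _] _ _ [cc _]] := atlas_chart Mc.
  have oW : open (setT `&` (fun y => sqnorm (y - w x)) @^-1` [set t | t < 3^-1 * d x ^+ 2]).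
    apply: open_preim => //; first exact: openT.
    apply: sm_sqnorm; first exact: openT.
    move=> j; apply: (sm_ext openT) (smB openT (sm_coord j) (sm_cst (w x 0 j))) => z _.
    by rewrite !mxE.
  rewrite openE => y [Dy Wy]; apply: filterI; first exact: open_nbhs_nbhs.
  have := cc y Dy _ (open_nbhs_nbhs (conj oW (conj I Wy))).
  by apply: (@filterS _ (nbhs y)) => u [].
have core_nbhs x : nbhs x (core x).
  have [Mc cx [d0 _]] := Hcd x; apply: open_nbhs_nbhs; split=> //; split=> //.
  have /eqP -> : sqnorm (chart_map (c x) x - w x) == 0 by rewrite sqnorm_eq0 subrr.
  by rewrite mulr_gt0 ?exprn_gt0.
have [s Hs] := lindelof (@manifold_second_countable _ M) core_nbhs.
pose G x (o : option 'I_m) u := bump_fun (w x) (d x) u * (if o is Some j then u 0 j else 1).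
pose Psi l o y := if s l is Some x then extend (c x) (G x o) y else 0.
pose tail l y := \prod_(i < l) (1 - Psi i None y).
(* An index codes a ball and a slot: [None] stands for the bump, [Some j] for the bump times the
   [j]-th coordinate. *)
pose slot e : option 'I_m := unlift ord0 (inord (e %% m.+1) : 'I_m.+1).
pose kap e y := Psi (e %/ m.+1)%N (slot e) y * tail (e %/ m.+1)%N y.
have Psis l o : psm man_plots setT (Psi l o).
  rewrite /Psi; case: (s l) => [x|]; last by move=> n U xi oU _ _; exact: sm_cst.
  have [Mc cx gb] := Hcd x; apply: (psm_extend Mc gb) => [n U xi oU pxi _|u /(proj2 (rwP idP))].
    apply: smM => //; first exact: psm_bump_fun.
    by case: o => [j|]; [exact: pxi|exact: sm_cst].
  by rewrite -bump_fun_eq0 ?gb.1// /G => /eqP ->; rewrite mul0r.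
have core1 l x y : s l = Some x -> core x y -> Psi l None y = 1.
  move=> sl [yD yc]; rewrite /Psi sl /extend asboolT// /G mulr1; have [_ _ [d0 _]] := Hcd x.
  apply: st_ge; have : sqnorm (chart_map (c x) y - w x) / d x ^+ 2 < 3^-1.
    by rewrite ltr_pdivrMr ?exprn_gt0.
  lra.
pose rk (o : option 'I_m) : 'I_m.+1 := oapp (lift ord0) ord0 o.
pose idx l o := (l * m.+1 + rk o)%N.
have kapE l o y : kap (idx l o) y = Psi l o y * tail l y.
  rewrite /kap /slot /idx divnMDl// divn_small// addn0 modnMDl modn_small// inord_val.
  by rewrite /rk; case: o => [j|]; rewrite ?liftK ?unlift_none.
exists kap; split.
- move=> e n U xi oU pxi _; apply: smM => //; first exact: Psis.
  apply: sm_prod => // i _; apply: smB => //; first exact: sm_cst.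
  exact: Psis.
- move=> x; have [l [x' [sl x'x]]] := Hs x; exists (l.+1 * m.+1)%N.
  have : nbhs x (core x') by apply: open_nbhs_nbhs.
  apply: filterS => y yc e; rewrite -leq_divRL// => le.
  by rewrite /kap /tail (bigD1 (Ordinal le))//= (core1 _ _ _ sl yc) subrr mul0r mulr0.
- move=> x y xy.
  have exl : exists l, Psi l None x != 0.
    by have [l [x' [sl x'x]]] := Hs x; exists l; rewrite (core1 _ _ _ sl x'x) oner_neq0.
  case: (ex_minnP exl) => l lx lmin.
  have tx : tail l x = 1.
    rewrite /tail big1// => i _; suff /eqP -> : Psi i None x == 0 by rewrite subr0.
    by apply: contraT => /lmin; rewrite leqNgt ltn_ord.
  have Exy o : Psi l o x * tail l x = Psi l o y * tail l y by rewrite -!kapE.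
  have : Psi l None y * tail l y != 0 by rewrite -Exy tx mulr1.
  rewrite mulf_eq0 negb_or => /andP[ly ty].
  move: lx ly Exy; rewrite /Psi; case: (s l) => [z|]; last by rewrite eqxx.
  rewrite /extend; case: asboolP => [xD|]; last by rewrite eqxx.
  case: asboolP => [yD|]; last by rewrite eqxx.
  move=> lx ly Exy; have [Mc _ _] := Hcd z; have [_ _ [ci _] _] := atlas_chart Mc.
  rewrite -(ci x xD) -(ci y yD); congr (chart_inv _ _); apply/rowP => j.
  have := Exy None; have := Exy (Some j); rewrite /G !mulr1 mulrAC [RHS]mulrAC => + E0.
  by rewrite -E0 => /mulfI; apply; rewrite mulf_neq0// ?tx ?oner_neq0//; move: lx; rewrite /G mulr1.
Qed.

Lemma manifold_embedding : exists h : M -> 'rV[R]_m.+1,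
  (forall j, psm man_plots setT (fun x => h x 0 j)) /\
  forall g x, h (act g x) = h x -> act g x = x.
Proof. by have [kap [h1 h2 h3]] := separating_family; exact: (embedding h1 h2 h3). Qed.

End manifold_plots.

(** * The sphere action *)


Section isotropy.
Context {gT : finGroupType} {T : eqType} (act : gT -> T -> T).
Hypothesis actL : left_action act.

Lemma isotropy_group_set x : group_set (isotropy act x).
Proof.
apply/group_setP; split=> [|g h]; rewrite !inE ?actL.1// => /eqP gx /eqP hx.
by rewrite actL.2 hx gx.
Qed.

Canonical isotropy_group x := Group (isotropy_group_set x).

End isotropy.

(** The map sends [x] to the family of the [h (act g x)], on which the group permutes the entries,
    hence by isometries. As [h] separates the points of an orbit, the entry at 1 already detects
    whether an element fixes [x]. *)
Lemma equivariant_embedding {R : realType} {gT : finGroupType} {M : manifold R}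
    (act : gT -> M -> M) : smooth_action act ->
  exists N (A : gT -> 'M[R]_N) (f : M -> 'rV[R]_N),
  [/\ A 1%g = 1%:M, forall g h, A (g * h)%g = A h *m A g,
      forall g y, sqnorm (y *m A g) = sqnorm y,
      forall j, psm (man_plots act) setT (fun x => f x 0 j) &
      forall x, (forall g, f (act g x) = lact A g (f x)) /\ stab A (f x) = isotropy act x].
Proof.
move=> actS; have [[act1 actM] _] := actS.
have [h [hs h_inj]] := manifold_embedding actS.
pose I := (gT * 'I_(Defs.dim M).+1)%type; pose N := #|{: I}|.
pose ev (i : 'I_N) : I := enum_val i.
pose sh g (j : 'I_N) : 'I_N := enum_rank ((ev j).1 * g, (ev j).2)%g.
have sh1 j : sh 1%g j = j by rewrite /sh mulg1 -surjective_pairing enum_valK.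
have shM g g' j : sh g' (sh g j) = sh (g * g')%g j.
  by rewrite /sh /ev enum_rankK /= mulgA.
pose A g : 'M[R]_N := \matrix_(i, j) (i == sh g j)%:R.
have AE n g (y : 'M[R]_(n, N)) i j : (y *m A g) i j = y i (sh g j).
  rewrite mxE (big_only1 (sh g j))// ?mxE ?eqxx ?mulr1// => l lj _.
  by rewrite mxE (negbTE lj) mulr0.
pose f x : 'rV[R]_N := \row_j h (act (ev j).1 x) 0 (ev j).2.
have fE x g : f (act g x) = lact A g (f x).
  by apply/rowP => j; rewrite /lact AE !mxE /sh /ev enum_rankK /= actM.
exists N, A, f; split=> //.
- by apply/matrixP => i j; rewrite !mxE sh1.
- by move=> g g'; apply/matrixP => i j; rewrite AE !mxE shM.
- move=> g y; rewrite /sqnorm [RHS](reindex_inj (h := sh g)).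
    by apply: eq_bigr => j _; rewrite AE.
  by apply: (can_inj (g := sh g^-1%g)) => j; rewrite shM mulgV sh1.
- move=> j n U xi oU pxi _.
  apply: (@sm_ext _ _ _ oU (fun z => h (act (ev j).1 (xi z)) 0 (ev j).2)).
    by move=> z _; rewrite [RHS]mxE.
  by apply: hs => //; exact: act_plot.
- move=> x; split=> //; apply/setP => g; rewrite !inE -fE; apply/eqP/eqP => [fx|->//].
  apply: h_inj; apply/rowP => i; have /rowP/(_ (enum_rank (1%g, i))) := fx.
  by rewrite !mxE /ev enum_rankK /= !act1.
Qed.

Lemma manifold_cocycle {R : realType} {gT : finGroupType} {M : manifold R}
    (act : gT -> M -> M) (k : nat) : smooth_action act -> (0 < k)%N ->
  (forall x, exists p r, [/\ prime p, (r <= k)%N & #|isotropy act x| = (p ^ r)%N]) ->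
  exists2 n, (0 < n)%N & exists cc : gT -> M -> 'M[R]_(n + 1),
  [/\ forall g i j, psm (man_plots act) setT (fun x => cc g x i j),
      forall x, cc 1%g x = 1%:M /\ forall g h, cc (g * h)%g x = cc g (act h x) *m cc h x &
      forall x p (v : 'cV[R]_(n + 1)), prime p -> #|isotropy act x| = (p ^ k)%N ->
        (forall g, g \in isotropy act x -> cc g x *m v = v) -> v = 0].
Proof.
move=> actS k0 Hx; have [N [A [f [A1 AM Aiso fs fE]]]] := equivariant_embedding actS.
have fP x : prime_power_point A k (f x).
  by have [p [r [pp rk xr]]] := Hx x; exists p => //; exists r; rewrite ?(fE x).2.
have [n n1 [cc [ccs ccM ccf]]] := smooth_cocycle A1 AM Aiso k0.
have [n' nE] : exists n', n = (n' + 1)%N by exists n.-1; rewrite addn1 prednK// ltnW.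
subst n; exists n'; first by rewrite addn1 ltnS in n1.
exists (fun g x => cc g (f x)); split.
- move=> g i j n U xi oU pxi _; apply: ccs => // l; exact: fs.
- move=> x; have [c1 cM] := ccM _ (fP x); split=> // g h.
  by rewrite cM (fE x).1.
- move=> x p v pp xk Hv; apply: (ccf (f x) p v pp); first by rewrite (fE x).2.
  by move=> g; rewrite (fE x).2; exact: Hv.
Qed.

Section normalise.
Context {R : realType} {n : nat}.
Implicit Types w : 'rV[R]_n.

Definition normalise w := (Num.sqrt (sqnorm w))^-1 *: w.

Lemma sqnorm_gt0 w : (0 < sqnorm w) = (w != 0).
Proof. by rewrite lt0r sqnorm_ge0 andbT sqnorm_eq0. Qed.

Lemma sqnorm_normalise w : w != 0 -> sqnorm (normalise w) = 1.
Proof.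
by rewrite -sqnorm_gt0 => w0; rewrite sqnormZ exprVn sqr_sqrtr ?mulVf ?gt_eqF// ltW.
Qed.

Lemma normalise_scale a w : 0 < a -> normalise (a *: w) = normalise w.
Proof.
move=> a0; rewrite /normalise sqnormZ sqrtrM ?sqr_ge0// sqrtr_sqr gtr0_norm// scalerA.
by rewrite invfM mulrAC mulVf ?mul1r// gt_eqF.
Qed.

Lemma normalise_id w : sqnorm w = 1 -> normalise w = w.
Proof. by rewrite /normalise => ->; rewrite sqrtr1 invr1 scale1r. Qed.

End normalise.

Lemma continuous_of_charts {R : realType} {P : manifold R} q (F : P -> 'rV[R]_q) :
  (forall c, atlas P c -> forall j, sm (chart_img c) (fun z => F (chart_inv c z) 0 j)) ->
  continuous F.
Proof.
move=> Fs x; have [Hc cov _] := manifold_atlas P; have [c Pc cx] := cov x.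
have [[oD oI] [di id] [ci ic] [cc cic]] := Hc c Pc.
have FF : {for chart_map c x, continuous (F \o chart_inv c)}.
  apply: (Ck_cts (k := 0) (U := chart_img c)); last exact: di.
  by apply: Ck_mx => // i j; rewrite ord1; exact: Fs.
have H : F (chart_inv c (chart_map c y)) @[y --> x] --> F (chart_inv c (chart_map c x)).
  exact: (continuous_comp (cc x cx) FF).
rewrite (ci x cx) in H; apply: cvg_trans H; apply: (@near_eq_cvg _ _ (nbhs x)).
have := open_nbhs_nbhs (conj oD cx); apply: (@filterS _ (nbhs x)) => y yD /=.
by rewrite ci.
Qed.

Section sphere_action.
Context {R : realType} {gT : finGroupType} {M : manifold R} (act : gT -> M -> M).
Hypothesis actS : smooth_action act.
Variables (n : nat) (cc : gT -> M -> 'M[R]_(n + 1)).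
Hypothesis ccs : forall g i j, psm (man_plots act) setT (fun x => cc g x i j).
Hypothesis cc1 : forall x, cc 1%g x = 1%:M.
Hypothesis ccM : forall g h x, cc (g * h)%g x = cc g (act h x) *m cc h x.

Local Notation P := (prod_manifold M (sphere R n)).
Local Notation m := (Defs.dim M).

Let act1 x : act 1%g x = x. Proof. exact: actS.1.1. Qed.
Let actM g h x : act (g * h)%g x = act g (act h x). Proof. exact: actS.1.2. Qed.

Definition vec (x : P) : 'rV[R]_(n + 1) := set_val (x.2 : unit_sphere).

Lemma sqnorm_vec x : sqnorm (vec x) = 1.
Proof. exact: (set_valP (x.2 : unit_sphere)). Qed.

Lemma vec_neq0 x : vec x != 0.
Proof. by rewrite -sqnorm_gt0 sqnorm_vec. Qed.

Lemma cocycle_neq0 g x (w : 'rV[R]_(n + 1)) : w != 0 -> w *m (cc g x)^T != 0.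
Proof.
apply: contra => /eqP w0; have E : (cc g x)^T *m (cc g^-1%g (act g x))^T = 1%:M.
  by rewrite -trmx_mul -ccM mulVg cc1 trmx1.
by rewrite -[w]mulmx1 -E mulmxA w0 mul0mx.
Qed.

(** The cocycle acts on columns and the points of the sphere are rows, hence the transpose. *)
Definition move_vec g (x : P) := normalise (vec x *m (cc g x.1)^T).

Lemma sqnorm_move_vec g x : sqnorm (move_vec g x) = 1.
Proof. by apply: sqnorm_normalise; apply: cocycle_neq0; exact: vec_neq0. Qed.

Definition act_sphere g (x : P) : P :=
  (act g x.1, SigSub (mem_set (sqnorm_move_vec g x : unit_sphere (move_vec g x))) : unit_sphere).

Lemma vec_act_sphere g x : vec (act_sphere g x) = move_vec g x.
Proof. by []. Qed.

Lemma vec_inj (x y : P) : x.1 = y.1 -> vec x = vec y -> x = y.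
Proof. by case: x y => [x v] [y w] /= -> /val_inj E; congr pair. Qed.

Lemma act_sphere_left : left_action act_sphere.
Proof.
split=> [x|g h x]; apply: vec_inj => //=; rewrite ?act1 ?actM// vec_act_sphere /move_vec.
  by rewrite cc1 trmx1 mulmx1 normalise_id// sqnorm_vec.
rewrite vec_act_sphere /move_vec /= -scalemxAl normalise_scale.
  by rewrite ccM trmx_mul mulmxA.
by rewrite invr_gt0 sqrtr_gt0 sqnorm_gt0 cocycle_neq0// vec_neq0.
Qed.

Section chart_expression.
Variables (a : chart R M m) (s : bool).
Hypothesis Ma : atlas M a.

Let W := chart_img (prod_chart a (stereo s)) : set 'rV[R]_(m + n).
Let inv := chart_inv (prod_chart a (stereo s)) : 'rV[R]_(m + n) -> P.

Let oW : open W.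
Proof. by have [[_ oI] _ _ _] := prod_is_chart (atlas_chart Ma) (@stereo_is_chart R n s); exact: oI. Qed.

Lemma prod_plot : plot (man_plots act) W (fun z => (inv z).1).
Proof. by apply: (plotS _ (chart_plot_lsub actS n Ma)) => z []. Qed.

Lemma sm_vec j : sm W (fun z => vec (inv z) 0 j).
Proof.
have H k := @Ck_rsubmx R m n _ k setT _ (Ck_stereo_vec s k).
have Hs : sm [set: 'rV[R]_(m + n)] (fun z : 'rV[R]_(m + n) => stereo_vec s (rsubmx z : 'rV[R]_n) 0 j).
  by move=> k; apply: (Ck_mxE 0 j openT); exact: H.
exact: (sm_sub (@subsetT _ _) Hs).
Qed.

Lemma sm_move_vec g j : sm W (fun z => move_vec g (inv z) 0 j).
Proof.
have ws l : sm W (fun z => (vec (inv z) *m (cc g (inv z).1)^T) 0 l).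
  apply: sm_mulmx => // i i'; first by rewrite ord1; exact: sm_vec.
  apply: (@sm_ext _ _ _ oW (fun z => cc g (inv z).1 i' i)) => [z _|]; first by rewrite mxE.
  by apply: ccs => //; exact: prod_plot.
have w0 z : vec (inv z) *m (cc g (inv z).1)^T != 0.
  by apply: cocycle_neq0; exact: vec_neq0.
apply: (@sm_ext _ _ _ oW (fun z => (Num.sqrt (sqnorm (vec (inv z) *m (cc g (inv z).1)^T)))^-1 *
    (vec (inv z) *m (cc g (inv z).1)^T) 0 j)).
  by move=> z _; rewrite [RHS]mxE.
apply: smM => //; apply: smV => // [z _|].
  by rewrite gt_eqF// sqrtr_gt0 sqnorm_gt0.
by apply: sm_sqrt => // [z _|]; [rewrite sqnorm_gt0|exact: sm_sqnorm].
Qed.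

End chart_expression.

Lemma act_sphere_cts g : continuous (act_sphere g).
Proof.
have fc : continuous (move_vec g).
  by apply: continuous_of_charts => _ [a Ma [_ [s _ <-] <-]] j; exact: sm_move_vec.
move=> x; have gc : {for x, continuous (act g \o (fst : P -> M))}.
  by apply: continuous_comp; [exact: cvg_fst|exact: (actS.2 g).1].
have vc : {for x, continuous (fun y => (act_sphere g y).2)}.
  by apply: subtype_continuous; exact: fc.
exact: cvg_pair gc vc.
Qed.

Lemma act_sphere_smooth : smooth_action act_sphere.
Proof.
split=> [|g]; first exact: act_sphere_left.
split; first exact: act_sphere_cts.
move=> _ _ [a Ma [_ [s _ <-] <-]] [b Mb [_ [s' _ <-] <-]].
set D := _ @` _.
have oD : open D.
  apply: open_chart_map; first exact: prod_is_chart (atlas_chart Ma) (@stereo_is_chart R n s).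
  apply: open_comp => [x _|]; first exact: act_sphere_cts.
  have [[oI _] _ _ _] := prod_is_chart (atlas_chart Mb) (@stereo_is_chart R n s'); exact: oI.
have DW : D `<=` chart_img (prod_chart a (stereo s)).
  move=> _ [x [xD _] <-].
  by have [_ [H _] _ _] := prod_is_chart (atlas_chart Ma) (@stereo_is_chart R n s); exact: H.
have DE z : D z -> act_sphere g (chart_inv (prod_chart a (stereo s)) z) \in
    (chart_dom (prod_chart b (stereo s')) : set P).
  move=> [x [xD gxD] <-]; have [_ _ [ci _] _] := prod_is_chart (atlas_chart Ma) (@stereo_is_chart R n s).
  by rewrite (ci x xD); exact/mem_set.
have vs j : sm D (fun z => move_vec g (chart_inv (prod_chart a (stereo s)) z) 0 j).
  by apply: (sm_sub DW); exact: sm_move_vec.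
have [_ ps] := prod_plot s Ma.
apply: sm_mx => // i j; rewrite ord1; case: (split_ordP j) => l ->.
  apply: (@sm_ext _ _ _ oD (fun z => chart_map b (act g (chart_inv (prod_chart a (stereo s)) z).1) 0 l)).
    by move=> z _ /=; rewrite row_mxEl.
  apply: sm_sub (ps g b Mb l) => z Dz; split; first exact: DW.
  by have /set_mem[] := DE z Dz.
apply: (@sm_ext _ _ _ oD (fun z =>
    (1 - (-1) ^+ s' * move_vec g (chart_inv (prod_chart a (stereo s)) z) 0 (rshift n ord0))^-1 *
    move_vec g (chart_inv (prod_chart a (stereo s)) z) 0 (lshift 1 l))).
  by move=> z _ /=; rewrite row_mxEr /stereo_map /last_coord !mxE.
apply: smM => //; apply: smV => // [z Dz|].
  have /set_mem[_ h] := DE z Dz.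
  exact: (stereo_den (x := (act_sphere g (chart_inv (prod_chart a (stereo s)) z)).2) h).
by apply: smB => //; [exact: sm_cst|apply: smM => //; exact: sm_cst].
Qed.

(** A fixed point gives at first only [vec x *m B = t *: vec x] with [t > 0]. Over the fixed point
    [x.1] the cocycle is multiplicative on the powers of [g], so [t ^+ #[g] = 1] and [t = 1]. *)
Lemma act_sphere_isotropy g x : g \in isotropy act_sphere x ->
  g \in isotropy act x.1 /\ vec x *m (cc g x.1)^T = vec x.
Proof.
rewrite !inE => /eqP gx; have gx1 : act g x.1 = x.1 by rewrite -[in RHS]gx.
split; first exact/eqP.
set w := vec x; set B := (cc g x.1)^T.
have wB0 : w *m B != 0 by apply: cocycle_neq0; exact: vec_neq0.
pose t := Num.sqrt (sqnorm (w *m B)); have t0 : 0 < t by rewrite sqrtr_gt0 sqnorm_gt0.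
have wB : w *m B = t *: w.
  rewrite {2}/w -gx vec_act_sphere /move_vec /normalise scalerA divff ?scale1r//.
  exact: lt0r_neq0.
have iterw i : w *m (cc (g ^+ i)%g x.1)^T = t ^+ i *: w.
  elim: i => [|i IH]; first by rewrite expg0 cc1 trmx1 mulmx1 scale1r.
  rewrite expgSr ccM gx1 trmx_mul mulmxA -/B wB -scalemxAl IH scalerA exprS.
  by [].
have : w *m (cc (g ^+ #[g])%g x.1)^T = 1 *: w by rewrite expg_order cc1 trmx1 mulmx1 scale1r.
rewrite iterw => /eqP; rewrite -subr_eq0 -scalerBl scaler_eq0 (negbTE (vec_neq0 x)) orbF.
rewrite subr_eq0 pexpr_eq1 ?order_gt0// ?ltW// => /eqP t1.
by rewrite wB t1 scale1r.
Qed.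

End sphere_action.

(** The new isotropy group lies in the old one. If its order were still [p ^ k.+1], the two groups
    would coincide and the sphere coordinate would be a nonzero vector fixed by all of it, which the
    cocycle excludes. *)
Lemma sphere_step {R : realType} {gT : finGroupType} {M : manifold R}
    (act : gT -> M -> M) (k : nat) : smooth_action act ->
  (forall x, exists p r, [/\ prime p, (r <= k.+1)%N & #|isotropy act x| = (p ^ r)%N]) ->
  exists2 n, (0 < n)%N & exists act' : gT -> prod_manifold M (sphere R n) -> prod_manifold M (sphere R n),
    smooth_action act' /\
    forall x, exists p r, [/\ prime p, (r <= k)%N & #|isotropy act' x| = (p ^ r)%N].
Proof.
move=> actS Hx; have [n n0 [cc [ccs ccM ccf]]] := manifold_cocycle actS (ltn0Sn k) Hx.
have cc1 x : cc 1%g x = 1%:M by case: (ccM x).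
have {}ccM g h x : cc (g * h)%g x = cc g (act h x) *m cc h x by case: (ccM x).
have act'S := act_sphere_smooth actS ccs cc1 ccM.
exists n => //; exists (act_sphere cc1 ccM); split=> // x.
have [p [r [pp rk xr]]] := Hx x.1; exists p.
pose H := isotropy_group act'S.1 x; pose G := isotropy_group actS.1 x.1.
have HG : H \subset G.
  by apply/fintype.subsetP => g /(act_sphere_isotropy)[].
have := cardSg HG; rewrite /= xr => /(dvdn_pfactor _ _ pp)[r' r'r Hr'].
exists r'; split=> //; rewrite -ltnS ltn_neqAle (leq_trans r'r rk) andbT.
apply/negP => /eqP r'k; have rE : r = k.+1 by apply/eqP; rewrite eqn_leq rk -r'k.
have HE : isotropy act x.1 = isotropy (act_sphere cc1 ccM) x.
  by apply/eqP; rewrite eq_sym finset.eqEcard HG /= xr Hr' r'k rE leqnn.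
have : (vec x)^T = 0.
  apply: (ccf x.1 p) => //; first by rewrite xr rE.
  move=> g; rewrite HE => /(act_sphere_isotropy)[_ gx].
  by apply: trmx_inj; rewrite trmx_mul !trmxK.
by move/(congr1 trmx)/eqP; rewrite trmxK trmx0 (negbTE (vec_neq0 x)).
Qed.

Lemma free_sphere_product {R : realType} {gT : finGroupType} (k : nat) : forall (M : manifold R)
    (act : gT -> M -> M), smooth_action act ->
  (forall x, exists p r, [/\ prime p, (r <= k)%N & #|isotropy act x| = (p ^ r)%N]) ->
  exists n : k.-tuple nat,
    (forall i : 'I_k, (0 < tnth n i)%N) /\
    exists act' : gT -> prod_spheres M n -> prod_spheres M n,
      smooth_action act' /\ free_action act'.
Proof.
elim: k => [|k IH] M act actS Hx.
  exists [tuple]; split=> [[]//|]; exists act; split=> // g x gx.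
  have [p [r [_ + xr]]] := Hx x; rewrite leqn0 => /eqP r0.
  have /eqP : #|isotropy_group actS.1 x| = 1%N by rewrite /= xr r0.
  rewrite -trivg_card1 => /eqP G1.
  have : g \in isotropy_group actS.1 x by rewrite inE gx.
  by rewrite G1 => /set1P.
have [n0 n00 [act1 [act1S H1]]] := sphere_step actS Hx.
have [n [npos [act' H']]] := IH _ act1 act1S H1.
exists [tuple of n0 :: n]; split; last by exists act'.
by move=> i; case: (unliftP ord0 i) => [j|] ->; rewrite ?tnthS ?tnth0.
Qed.

Theorem theorem1p2 (R : realType) (gT : finGroupType) (M : manifold R)
    (act : gT -> M -> M) (k : nat) :
  smooth_action act ->
  (forall x : M, exists2 r : nat,
     (r <= k)%N & elementary_abelian (isotropy act x) r) ->
  exists n : k.-tuple nat,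
    (forall i : 'I_k, (0 < tnth n i)%N) /\
    exists act' : gT -> prod_spheres M n -> prod_spheres M n,
      smooth_action act' /\ free_action act'.
Proof.
move=> actS Hx; apply: (free_sphere_product actS) => x.
have [r rk [p pp iso]] := Hx x; exists p, r; split=> //.
have <- : #|[set: 'rV['F_p]_r]%SET| = (p ^ r)%N by rewrite cardsT card_mx mul1n card_Fp.
exact: (@card_isog _ _ (isotropy_group actS.1 x) [set: 'rV['F_p]_r]%G iso).
Qed.
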